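(* Let $p$ be an odd prime number, let $d\ge 2$ be an even number, and let either $q=p^f$ with $f\ge1$ and with $f\ge2$ if $p=3$, or $q=0$. Let $G$ be a pro-$p$ group with minimal set of generators $\{x_1,\dots,x_d\}$ satisfying the single relation $$1=x_1^q[x_1,x_2][x_3,x_4]\cdots[x_{d-1},x_d].$$ Then the canonical class $\gamma_G\in \mathrm{HH}^{3,-1}(H^\bullet(G,\mathbb{F}_p))$ of $G$ vanishes and $G$ is $A_3$-formal.
   Context: **Presentation.** $[x,y]=x^{-1}y^{-1}xy$, and $G$ is the quotient of the free pro-$p$ group on $x_1,\dots,x_d$ by the closed normal subgroup generated by the single relator. **Cochains.** $\mathcal{C}^\bullet(G,\mathbb{F}_p)$ is the differential graded algebra of continuous inhomogeneous cochains $G^n\to\mathbb{F}_p$ (trivial coefficients) with differential $(\delta\varphi)(g_1,\dots,g_{n+1})=\varphi(g_2,\dots,g_{n+1})+\sum_{i=1}^n(-1)^i\varphi(g_1,\dots,g_ig_{i+1},\dots,g_{n+1})+(-1)^{n+1}\varphi(g_1,\dots,g_n)$ and cup product $(\varphi\cup\psi)(g_1,\dots,g_{i+j})=\varphi(g_1,\dots,g_i)\psi(g_{i+1},\dots,g_{i+j})$. Its cohomology is $H^\bullet(G,\mathbb{F}_p)$. **$A_3$-formality.** Let $\mathcal{A}$ be a differential graded algebra over a field $\mathbb{F}$ with differential $\delta$ that is connected ($\mathcal{A}^i=0$ for $i<0$, $\mathcal{A}^0=\mathbb{F}$), with cohomology algebra $H$. $\mathcal{A}$ is $A_3$-formal if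 there are graded $\mathbb{F}$-linear maps $f_i:H^{\otimes i}\to\mathcal{A}$ of degree $1-i$ for $i=1,2,3$ with $\delta f_1=0$ and $f_1$ inducing an isomorphism on cohomology, $\delta f_2(x,y)=f_1(xy)-f_1(x)f_1(y)$, and $\delta f_3(x,y,z)+(-1)^{|x|}f_1(x)f_2(y,z)-f_2(x,y)f_1(z)=f_2(xy,z)-f_2(x,yz)$ for all homogeneous $x,y,z$ (that is, $H$ with $m_1=0$, induced $m_2$ and $m_3=0$ is a minimal $A_3$-model of $\mathcal{A}$). $G$ is called $A_3$-formal if $\mathcal{C}^\bullet(G,\mathbb{F}_p)$ is. **Graded Hochschild cohomology.** For a non-negatively graded $\mathbb{F}$-algebra $A$ with $A^0=\mathbb{F}$ and a graded $A$-bimodule $M$, $\mathrm{HH}^{n,s}(A,M)$ is the $n$-th cohomology of the complex whose $n$-th term is the space of graded linear maps $A^{\otimes n}\to M$ raising degree by $s$, with differential $\partial f(a_1,\dots,a_{n+1})=(-1)^{s|a_1|}a_1f(a_2,\dots,a_{n+1})+\sum_{i=1}^n(-1)^if(a_1,\dots,a_ia_{i+1},\dots,a_{n+1})+(-1)^{n+1}f(a_1,\dots,a_n)a_{n+1}$. Write $\mathrm{HH}^{n,s}(A)=\mathrm{HH}^{n,s}(A,A)$. **Canonical class.** For connected $\mathcal{A}$ with cohomology $H$, choose a graded linear $f_1:H\to\ker\delta$ inducing the identity on $H$ and a graded linear $f_2:H\otimes H\to\mathcal{A}$ of degree $-1$ with $\delta f_2(x,y)=f_1(xy)-f_1(x)f_1(y)$.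 The elements $\Phi_3(x,y,z)=(-1)^{|x|}f_1(x)f_2(y,z)-f_2(x,y)f_1(z)-f_2(xy,z)+f_2(x,yz)$ are cocycles of $\mathcal{A}$. The induced map $m_3:H^{\otimes3}\to H$ of degree $-1$ is a Hochschild cocycle, and its class $\gamma_{\mathcal{A}}=[m_3]\in\mathrm{HH}^{3,-1}(H)$, which is independent of the choices, is the canonical class of $\mathcal{A}$. One sets $\gamma_G=\gamma_{\mathcal{C}^\bullet(G,\mathbb{F}_p)}$. *)

(* Defs.v *)
From HB Require Import structures.
From mathcomp Require Import all_boot all_order all_algebra.
From mathcomp Require Import ring_quotient generic_quotient.
From mathcomp Require Import all_classical topology.
From mathcomp Require Import ring zify.

Set Implicit Arguments.
Unset Strict Implicit.
Unset Printing Implicit Defensive.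

Import GRing.Theory.
Local Open Scope classical_set_scope.

HB.mixin Record isTopologicalGroup G & Group G & Topological G := {
  mulg_continuous : continuous (fun x : G * G => (x.1 * x.2)%g) ;
  invg_continuous : continuous (fun x : G => (x^-1)%g)
}.

#[short(type="topGroupType")]
HB.structure Definition TopologicalGroup :=
  {G of Group G & Topological G & isTopologicalGroup G}.

Section ProP.
Local Open Scope group_scope.

Definition normal_subgroup (G : groupType) (N : set G) : Prop :=
  [/\ N 1, forall x y, N x -> N y -> N (x * y),
      forall x, N x -> N x^-1 & forall x g, N x -> N (x ^ g)].

Definition has_index (G : groupType) (N : set G) (n : nat) : Prop :=
  exists r : 'I_n -> G, forall g, exists! i, N ((r i)^-1 * g).

Definition pro_p (p : nat) (G : topGroupType) : Prop :=
  [/\ compact [set: G], hausdorff_space G, totally_disconnected [set: G] &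
      forall N : set G, normal_subgroup N -> open N ->
        exists k, has_index N (p ^ k)].

Definition group_hom (G H : groupType) (f : G -> H) : Prop :=
  {morph f : x y / x * y}.

Definition free_pro_p (p d : nat) (F : topGroupType) (y : d.-tuple F) : Prop :=
  pro_p p F /\
  forall (P : topGroupType) (z : d.-tuple P), pro_p p P ->
    exists! f : F -> P, [/\ group_hom f, continuous f & map_tuple f y = z].

Definition closed_normal_closure (G : topGroupType) (r : G) : set G :=
  \bigcap_(N in [set N | [/\ normal_subgroup N, closed N & N r]]) N.

(* [G] is the quotient of the free pro-[p] group on [y_1, ..., y_d] by the
   closed normal subgroup generated by the word [w] in the [y_i], and [x_i] is
   the image of [y_i].  A continuous surjection of compact Hausdorff spaces is
   a quotient map, so [G] automatically has the quotient topology. *)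
Definition one_relator_pro_p (p d : nat)
    (w : forall F : groupType, d.-tuple F -> F)
    (G : topGroupType) (x : d.-tuple G) : Prop :=
  pro_p p G /\
  exists (F : topGroupType) (y : d.-tuple F) (f : F -> G),
    [/\ free_pro_p p y, group_hom f /\ continuous f, set_surj setT setT f,
        map_tuple f y = x & f @^-1` [set 1] = closed_normal_closure (w F y)].

(* [x_1 ^ q [x_1, x_2] [x_3, x_4] ... [x_(d-1), x_d]], with entries of the
   tuple numbered from 0; [~ x, y] is [x^-1 * y^-1 * x * y]. *)
Definition demushkin_word (q d : nat) (F : groupType) (x : d.-tuple F) : F :=
  x`_0 ^+ q * \prod_(i < d./2) [~ x`_(i.*2), x`_(i.*2.+1)].

End ProP.

Local Open Scope ring_scope.
Local Open Scope quotient_scope.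

(* Connected graded algebras.  A graded algebra is represented by its total
   space, the direct sum of its homogeneous components, together with the
   projections onto the components; components of negative degree vanish. *)
Record galg (F : fieldType) := GAlg {
  galg_sort :> algType F;
  gproj : nat -> galg_sort -> galg_sort;
  gproj_linear : forall n, linear (gproj n);
  gproj_proj : forall m n a,
    gproj m (gproj n a) = if m == n then gproj n a else 0;
  gproj_sum : forall a, exists N, a = \sum_(i < N) gproj i a;
  gproj_mul : forall m n a b, gproj m a = a -> gproj n b = b ->
    gproj (m + n) (a * b) = a * b;
  gproj_one : gproj 0 1 = 1;
  gproj_conn : forall a, exists c : F, gproj 0 a = c%:A
}.

Definition gdeg (F : fieldType) (A : galg F) (m : int) (a : A) : Prop :=
  match m with
  | Posz n => gproj n a = a
  | Negz _ => a = 0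
  end.

Definition homogeneous (F : fieldType) (A : galg F) (a : A) : Prop :=
  exists n : nat, gdeg n a.

Record dga (F : fieldType) := DGA {
  dga_galg :> galg F;
  ddiff : dga_galg -> dga_galg;
  ddiff_linear : linear ddiff;
  ddiff_deg : forall (n : nat) (a : dga_galg), gdeg n a -> gdeg n.+1 (ddiff a);
  ddiffK : forall a, ddiff (ddiff a) = 0;
  ddiff_leibniz : forall (n : nat) (a b : dga_galg), gdeg n a ->
    ddiff (a * b) = ddiff a * b + (-1) ^+ n *: (a * ddiff b)
}.

(* The quotient of a vector space by a subspace. *)
Section QuotientModule.
Variables (F : pzRingType) (V : lmodType F) (I : submodClosed V).

Definition submod_mem : {pred V} := fun x => x \in I.

Let submod_mem_zmod_closed : zmod_closed submod_mem.
Proof. exact: GRing.submod_closedB (submodClosedP I). Qed.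
HB.instance Definition _ :=
  GRing.isZmodClosed.Build V submod_mem submod_mem_zmod_closed.

Definition lquot : Type := Quotient.quot submod_mem.
HB.instance Definition _ := GRing.Zmodule.on lquot.

Definition lpi (x : V) : lquot := \pi_(Quotient.quot submod_mem) x.
Definition lrepr (u : lquot) : V := repr (u : Quotient.quot submod_mem).

Lemma lreprK : cancel lrepr lpi. Proof. exact: reprK. Qed.

Lemma lpi_eq x y : (lpi x = lpi y) <-> (x - y \in I).
Proof.
rewrite -[x - y \in I]/(x - y \in submod_mem) Quotient.idealrBE.
by split=> [|/eqP]//; move/eqP.
Qed.

Lemma lpiD : {morph lpi : x y / x + y}.
Proof. by move=> x y; rewrite /lpi !piE. Qed.

Definition lquot_scale (a : F) (u : lquot) : lquot := lpi (a *: lrepr u).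

Lemma lpi_scale a x : lquot_scale a (lpi x) = lpi (a *: x).
Proof. by apply/lpi_eq; rewrite -scalerBr rpredZ//; apply/lpi_eq/lreprK. Qed.

Let scaleqA a b u : lquot_scale a (lquot_scale b u) = lquot_scale (a * b) u.
Proof. by rewrite -[u]lreprK !lpi_scale scalerA. Qed.
Let scale1q : left_id 1 lquot_scale.
Proof. by move=> u; rewrite -[u]lreprK !lpi_scale scale1r. Qed.
Let scaleqDr : right_distributive lquot_scale +%R.
Proof.
by move=> a u v; rewrite -[u]lreprK -[v]lreprK -lpiD !lpi_scale scalerDr lpiD.
Qed.
Let scaleqDl u : {morph lquot_scale^~ u : a b / a + b}.
Proof. by move=> a b; rewrite -[u]lreprK !lpi_scale scalerDl lpiD. Qed.

HB.instance Definition _ :=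
  GRing.Zmodule_isLmodule.Build F lquot scaleqA scale1q scaleqDr scaleqDl.

Lemma lpi_linear : linear lpi.
Proof. by move=> a x y; rewrite lpiD -lpi_scale. Qed.
HB.instance Definition _ := GRing.isLinear.Build F V lquot _ lpi lpi_linear.

End QuotientModule.

HB.instance Definition _ (F : fieldType) (A : galg F) (n : nat) :=
  GRing.isLinear.Build F A A _ (@gproj F A n) (@gproj_linear F A n).
HB.instance Definition _ (F : fieldType) (A : dga F) :=
  GRing.isLinear.Build F A A _ (@ddiff F A) (@ddiff_linear F A).

Section Cohomology.
Variables (F : fieldType) (A : dga F).

Lemma gproj_id n (a : A) : gproj n (gproj n a) = gproj n a.
Proof. by rewrite gproj_proj eqxx. Qed.

Lemma ddiff_gproj n (a : A) : ddiff (gproj n a) = gproj n.+1 (ddiff a).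
Proof.
have dP i : gproj i.+1 (ddiff (gproj i a)) = ddiff (gproj i a).
  exact: (ddiff_deg (gproj_id i a)).
have [N aE] := gproj_sum a.
rewrite [in RHS]aE !linear_sum /=.
have [nN|Nn] := ltnP n N.
  rewrite (bigD1 (Ordinal nN))//= dP big1 ?addr0// => i ni.
  by rewrite -dP gproj_proj eqSS eq_sym ifN.
rewrite big1 => [|i _].
  suff -> : gproj n a = 0 by rewrite linear0.
  rewrite aE linear_sum big1// => i _ /=.
  by rewrite gproj_proj gtn_eqF// (leq_trans (ltn_ord i)).
by rewrite -dP gproj_proj eqSS gtn_eqF// (leq_trans (ltn_ord i)).
Qed.

Lemma ddiff1 : ddiff (1 : A) = 0.
Proof.
have := @ddiff_leibniz _ A 0 1 1 (gproj_one A).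
rewrite expr0 scale1r !mulr1 mul1r => e.
by apply: (addrI (ddiff 1)); rewrite addr0 -e.
Qed.

Definition is_cocycle : {pred A} := fun z => ddiff z == 0.

Lemma is_cocycle_subalg : GRing.subalg_closed is_cocycle.
Proof.
split=> [|c u v /eqP du /eqP dv|u v /eqP du /eqP dv]; apply/eqP.
- exact: ddiff1.
- by rewrite linearP /= du dv scaler0 addr0.
- have [N ->] := gproj_sum u.
  rewrite mulr_suml linear_sum big1// => i _ /=.
  rewrite (ddiff_leibniz _ (gproj_id i u)) dv mulr0 scaler0 addr0.
  by rewrite ddiff_gproj du linear0 mul0r.
Qed.
HB.instance Definition _ := GRing.isSubalgClosed.Build F A is_cocycle
  is_cocycle_subalg.

Record cocycle := Cocycle { cocycle_val :> A; _ : cocycle_val \in is_cocycle }.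
HB.instance Definition _ := [isSub for cocycle_val].
HB.instance Definition _ := [Choice of cocycle by <:].
HB.instance Definition _ :=
  GRing.SubChoice_isSubAlgebra.Build F A is_cocycle cocycle is_cocycle_subalg.

Definition is_coboundary : {pred cocycle} :=
  fun z => `[< exists a : A, ddiff a = z >].

Lemma is_coboundary_submod : submod_closed is_coboundary.
Proof.
split=> [|c u v /asboolP[a da] /asboolP[b db]]; apply/asboolP.
  by exists 0; rewrite linear0.
by exists (c *: a + b); rewrite linearP /= da db.
Qed.
HB.instance Definition _ := GRing.isSubmodClosed.Build F cocycle is_coboundary
  is_coboundary_submod.

Lemma is_coboundaryMr (u v : cocycle) :
  u \in is_coboundary -> u * v \in is_coboundary.
Proof.
move=> /asboolP[a da]; apply/asboolP; exists (a * (v : A)).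
have dv : ddiff (v : A) = 0 by case: v => v /= /eqP.
have [N aE] := gproj_sum a.
rewrite /= -da {1}aE mulr_suml linear_sum /= {2}aE linear_sum mulr_suml.
apply: eq_bigr => i _.
by rewrite /= (ddiff_leibniz _ (gproj_id i a)) dv mulr0 scaler0 addr0.
Qed.

Lemma is_coboundaryMl (u v : cocycle) :
  v \in is_coboundary -> u * v \in is_coboundary.
Proof.
move=> /asboolP[b db]; apply/asboolP.
have du : ddiff (u : A) = 0 by case: u => u /= /eqP.
have [N uE] := gproj_sum (u : A).
exists (\sum_(i < N) (-1) ^+ i *: (gproj i (u : A) * b)).
rewrite /= -db [in RHS]uE mulr_suml linear_sum.
apply: eq_bigr => i _; rewrite linearZ /= (ddiff_leibniz _ (gproj_id i _)).
by rewrite ddiff_gproj du linear0 mul0r add0r scalerA -exprMn mulrNN mulr1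
  expr1n scale1r.
Qed.

Definition cohomology : Type := lquot is_coboundary.
HB.instance Definition _ := GRing.Lmodule.on cohomology.

Definition coclass (z : cocycle) : cohomology := lpi is_coboundary z.
HB.instance Definition _ := GRing.isLinear.Build F cocycle cohomology _ coclass
  (@lpi_linear F cocycle is_coboundary).

Let crepr (h : cohomology) : cocycle := lrepr h.
Let creprK : cancel crepr coclass. Proof. exact: lreprK. Qed.

Lemma coclass_eq x y : coclass x = coclass y <-> x - y \in is_coboundary.
Proof. exact: lpi_eq. Qed.

Definition cohomology_mul (g h : cohomology) : cohomology :=
  coclass (crepr g * crepr h).

Lemma coclassM x y : cohomology_mul (coclass x) (coclass y) = coclass (x * y).
Proof.
apply/coclass_eq; set x' := crepr _; set y' := crepr _.
have -> : x' * y' - x * y = (x' - x) * y' + x * (y' - y).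
  by rewrite mulrBl mulrBr addrA subrK.
apply: rpredD; [apply: is_coboundaryMr|apply: is_coboundaryMl].
  by apply/coclass_eq/creprK.
by apply/coclass_eq/creprK.
Qed.

Let cmulA : associative cohomology_mul.
Proof.
by move=> x y z; rewrite -[x]creprK -[y]creprK -[z]creprK !coclassM mulrA.
Qed.
Let cmul1l : left_id (coclass 1) cohomology_mul.
Proof. by move=> x; rewrite -[x]creprK coclassM mul1r. Qed.
Let cmul1r : right_id (coclass 1) cohomology_mul.
Proof. by move=> x; rewrite -[x]creprK coclassM mulr1. Qed.
Let cmulDl : left_distributive cohomology_mul +%R.
Proof.
move=> x y z; rewrite -[x]creprK -[y]creprK -[z]creprK.
by rewrite -linearD /= !coclassM -linearD mulrDl.
Qed.
Let cmulDr : right_distributive cohomology_mul +%R.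
Proof.
move=> x y z; rewrite -[x]creprK -[y]creprK -[z]creprK.
by rewrite -linearD /= !coclassM -linearD mulrDr.
Qed.
Let cone_neq0 : coclass 1 != 0.
Proof.
apply/eqP; rewrite -[0](linear0 coclass) => /coclass_eq; rewrite subr0.
move=> /asboolP[a /= da]; have /eqP := oner_neq0 A; apply.
rewrite -(gproj_one A) -da; have [N ->] := gproj_sum a.
rewrite !linear_sum big1// => i _ /=.
by rewrite ddiff_gproj gproj_proj.
Qed.
HB.instance Definition _ := GRing.Zmodule_isNzRing.Build cohomology
  cmulA cmul1l cmul1r cmulDl cmulDr cone_neq0.

Lemma coclass_mul x y : coclass x * coclass y = coclass (x * y).
Proof. exact: coclassM. Qed.

Lemma coclass_scale c x : c *: coclass x = coclass (c *: x).
Proof. by rewrite linearZ. Qed.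

Let cscaleAl (c : F) (x y : cohomology) : c *: (x * y) = c *: x * y.
Proof.
rewrite -[x]creprK -[y]creprK; set u := crepr x; set v := crepr y.
rewrite (coclass_mul u v) (coclass_scale c (u * v)) (coclass_scale c u).
by rewrite (coclass_mul (c *: u) v) scalerAl.
Qed.
Let cscaleAr (c : F) (x y : cohomology) : c *: (x * y) = x * (c *: y).
Proof.
rewrite -[x]creprK -[y]creprK; set u := crepr x; set v := crepr y.
rewrite (coclass_mul u v) (coclass_scale c (u * v)) (coclass_scale c v).
by rewrite (coclass_mul u (c *: v)) scalerAr.
Qed.
HB.instance Definition _ := GRing.Lmodule_isLalgebra.Build F cohomology cscaleAl.
HB.instance Definition _ := GRing.Lalgebra_isAlgebra.Build F cohomology cscaleAr.

Lemma cocycle_proj_subproof n (z : cocycle) : gproj n (z : A) \in is_cocycle.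
Proof.
by case: z => z /= /eqP dz; apply/eqP; rewrite ddiff_gproj dz linear0.
Qed.
Definition cocycle_proj n (z : cocycle) : cocycle :=
  Cocycle (cocycle_proj_subproof n z).

Lemma cocycle_proj_linear n : linear (cocycle_proj n).
Proof. by move=> c x y; apply: val_inj; rewrite /= linearP. Qed.
HB.instance Definition _ n :=
  GRing.isLinear.Build F cocycle cocycle _ (cocycle_proj n)
    (cocycle_proj_linear n).

Definition cohomology_proj n (h : cohomology) : cohomology :=
  coclass (cocycle_proj n (crepr h)).

Lemma coclass_proj n z :
  cohomology_proj n (coclass z) = coclass (cocycle_proj n z).
Proof.
apply/coclass_eq; rewrite -linearB.
have /coclass_eq := creprK (coclass z); move: (_ - z) => w /asboolP[a da].
apply/asboolP; rewrite /= -da; case: n => [|n].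
  have [N ->] := gproj_sum a; exists 0.
  rewrite linear0 linear_sum linear_sum big1// => i _ /=.
  by rewrite ddiff_gproj gproj_proj.
by exists (gproj n a); rewrite ddiff_gproj.
Qed.

Let cproj_linear n : linear (cohomology_proj n).
Proof.
move=> c x y; rewrite -[x]creprK -[y]creprK -linearP !coclass_proj.
by rewrite -linearP -linearP.
Qed.
Let cproj_proj m n h : cohomology_proj m (cohomology_proj n h) =
  if m == n then cohomology_proj n h else 0.
Proof.
rewrite -[h]creprK !coclass_proj; have [->|mn] := eqVneq m n.
  by congr coclass; apply: val_inj; rewrite /= gproj_id.
rewrite -[RHS](linear0 coclass); congr coclass; apply: val_inj.
by rewrite /= gproj_proj (negPf mn).
Qed.
Let cproj_sum h : exists N, h = \sum_(i < N) cohomology_proj i h.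
Proof.
have [N zE] := gproj_sum (crepr h : A); exists N.
rewrite -{1}[h]creprK -linear_sum; congr coclass; apply: val_inj.
by rewrite [RHS]raddf_sum; exact: zE.
Qed.
Let cproj_mul m n x y : cohomology_proj m x = x -> cohomology_proj n y = y ->
  cohomology_proj (m + n) (x * y) = x * y.
Proof.
rewrite -[x]creprK -[y]creprK; set u := crepr x; set v := crepr y.
rewrite (coclass_proj m u) (coclass_proj n v) => <- <-.
set u' := cocycle_proj m u; set v' := cocycle_proj n v.
rewrite (coclass_mul u' v') (coclass_proj (m + n) (u' * v')).
congr coclass; apply: val_inj => /=.
by apply: gproj_mul; rewrite gproj_id.
Qed.
Let cproj_one : cohomology_proj 0 1 = 1.
Proof.
rewrite -[1]/(coclass 1) coclass_proj; congr coclass; apply: val_inj.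
exact: gproj_one.
Qed.
Let cproj_conn h : exists c : F, cohomology_proj 0 h = c%:A.
Proof.
rewrite -[h]creprK coclass_proj.
have [c cE] := gproj_conn (crepr h : A); exists c.
rewrite -[c%:A]/(c *: coclass 1) -linearZ; congr coclass; exact: val_inj.
Qed.

Definition cohomology_galg : galg F :=
  @GAlg F cohomology cohomology_proj cproj_linear cproj_proj cproj_sum
    cproj_mul cproj_one cproj_conn.

End Cohomology.

Section Hochschild.
Variable F : fieldType.

Definition multilinear (n : nat) (V W : lmodType F) (f : n.-tuple V -> W) :
    Prop :=
  forall (t : n.-tuple V) (i : 'I_n),
    linear (fun x => f [tuple if j == i then x else tnth t j | j < n]).

(* Multilinear maps on [n]-tuples stand for linear maps on the [n]-fold tensor
   power. *)
Definition graded_map (A B : galg F) (n : nat) (s : int) (f : n.-tuple A -> B) :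
    Prop :=
  multilinear f /\
  forall (e : n.-tuple nat) (t : n.-tuple A),
    (forall i, gdeg (tnth e i) (tnth t i)) ->
    gdeg (\sum_(i < n) (tnth e i : int) + s) (f t).

Variable A : galg F.

Definition merge_tuple (n : nat) (i : 'I_n) (a : n.+1.-tuple A) : n.-tuple A :=
  [tuple if (j < i)%N then tnth a (widen_ord (leqnSn n) j)
         else if j == i then
           tnth a (widen_ord (leqnSn n) j) * tnth a (lift ord0 j)
         else tnth a (lift ord0 j) | j < n].

(* The value of [\partial f] at [a], where [e] is the degree of the first entry
   of [a]; the sign makes sense only when that entry is homogeneous, which
   suffices to determine [\partial f] by linearity. *)
Definition hochschild_diff (n : nat) (s : int) (f : n.-tuple A -> A) (e : nat)
    (a : n.+1.-tuple A) : A :=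
  ((-1 : F) ^ (s * e))%R *:
    (thead a * f [tuple tnth a (lift ord0 j) | j < n])
  + \sum_(i < n) (-1) ^+ i.+1 *: f (merge_tuple i a)
  + (-1) ^+ n.+1 *:
    (f [tuple tnth a (widen_ord (leqnSn n) j) | j < n] * tnth a ord_max).

Definition is_hochschild_diff (n : nat) (s : int) (f : n.-tuple A -> A)
    (g : n.+1.-tuple A -> A) : Prop :=
  forall (e : nat) (a : n.+1.-tuple A), gdeg e (thead a) ->
    g a = hochschild_diff s f e a.

Variables (n : nat) (s : int).

Definition is_hcocycle : {pred n.-tuple A -> A} :=
  fun f => `[< graded_map s f /\ is_hochschild_diff s f (fun=> 0) >].

Lemma gdeg_linear m c (x y : A) : gdeg m x -> gdeg m y -> gdeg m (c *: x + y).
Proof.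
case: m => m /=; first by move=> xP yP; rewrite linearP /= xP yP.
by move=> -> ->; rewrite scaler0 addr0.
Qed.

Lemma gdeg0 m : gdeg m (0 : A).
Proof. by case: m => m //=; rewrite linear0. Qed.

Lemma graded_map0 (B : galg F) k r : graded_map r (fun _ : k.-tuple B => 0 : A).
Proof.
by split=> [t i c x y|e t _]; [rewrite scaler0 addr0|exact: gdeg0].
Qed.

Lemma graded_mapP (B : galg F) k r c (f g : k.-tuple B -> A) :
  graded_map r f -> graded_map r g -> graded_map r (c *: f + g).
Proof.
move=> [f1 f2] [g1 g2]; split=> [t i d x y|e t te].
  rewrite -[(c *: f + g) _]/(c *: f _ + g _) f1 g1 -!/((c *: f + g) _).
  rewrite -[(c *: f + g) _]/(c *: f _ + g _).
  rewrite -[(c *: f + g) [tuple if j == i then y else _ | j < _]]/(c *: f _ + g _).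
  by rewrite !scalerDr !scalerA [c * d]mulrC addrACA.
by apply: gdeg_linear; [exact: f2|exact: g2].
Qed.

Lemma hochschild_diffP k c (f g : k.-tuple A -> A) e a :
  hochschild_diff s (c *: f + g) e a =
  c *: hochschild_diff s f e a + hochschild_diff s g e a.
Proof.
have fgE t : (c *: f + g) t = c *: f t + g t by [].
rewrite /hochschild_diff !fgE mulrDr mulrDl -!scalerAr -!scalerAl !scalerDr.
under eq_bigr do rewrite fgE scalerDr.
rewrite big_split /= scaler_sumr.
have sC (b : F) (u : A) : c *: (b *: u) = b *: (c *: u).
  by rewrite !scalerA mulrC.
rewrite !sC; under [X in _ = _ + X + _ + _]eq_bigr do rewrite sC.
by rewrite [X in X + _ = _]addrACA [LHS]addrACA.
Qed.

Lemma hochschild_diff0 k e (a : k.+1.-tuple A) :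
  hochschild_diff s (fun=> 0) e a = 0.
Proof.
rewrite /hochschild_diff mulr0 mul0r !scaler0 big1 ?addr0// => i _.
by rewrite scaler0.
Qed.

Lemma is_hcocycle_submod : submod_closed is_hcocycle.
Proof.
split=> [|c f g /asboolP[fP df] /asboolP[gP dg]]; apply/asboolP; split.
- exact: graded_map0.
- by move=> e a _; rewrite [RHS]hochschild_diff0.
- exact: graded_mapP.
- move=> e a ae; rewrite hochschild_diffP -(df e a ae) -(dg e a ae).
  by rewrite scaler0 addr0.
Qed.
HB.instance Definition _ := GRing.isSubmodClosed.Build F (n.-tuple A -> A)
  is_hcocycle is_hcocycle_submod.

Record hcocycle := HCocycle {
  hcocycle_val :> n.-tuple A -> A; _ : hcocycle_val \in is_hcocycle }.
HB.instance Definition _ := [isSub for hcocycle_val].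
HB.instance Definition _ := [Choice of hcocycle by <:].
HB.instance Definition _ := GRing.SubChoice_isSubLmodule.Build F
  (n.-tuple A -> A) is_hcocycle hcocycle is_hcocycle_submod.

Definition hcoboundary (k : nat) : (k.-tuple A -> A) -> Prop :=
  match k with
  | 0 => fun f => f = 0
  | k'.+1 => fun f =>
      exists g : k'.-tuple A -> A, graded_map s g /\ is_hochschild_diff s g f
  end.

Definition is_hcoboundary : {pred hcocycle} := fun f => `[< @hcoboundary n f >].

Lemma is_hcoboundary_submod : submod_closed is_hcoboundary.
Proof.
rewrite /is_hcoboundary.
split=> [|c f g /asboolP fB /asboolP gB]; apply/asboolP.
  rewrite [hcocycle_val 0](raddf0 val); move: {+}n => [|k]//=.
  exists (fun=> 0); split; first exact: graded_map0.
  by move=> e a _; rewrite hochschild_diff0.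
rewrite [hcocycle_val _](linearP val) /=; move: fB gB.
move: (hcocycle_val f) (hcocycle_val g); move: {f g}n => [|k] f g /=.
  by move=> -> ->; rewrite scaler0 addr0.
move=> [f' [f'P fE]] [g' [g'P gE]]; exists (c *: f' + g').
split; first exact: graded_mapP.
by move=> e a ae; rewrite hochschild_diffP -fE// -gE.
Qed.
HB.instance Definition _ := GRing.isSubmodClosed.Build F hcocycle
  is_hcoboundary is_hcoboundary_submod.

Definition HH : Type := lquot is_hcoboundary.
HB.instance Definition _ := GRing.Lmodule.on HH.

Definition hclass (f : hcocycle) : HH := lpi is_hcoboundary f.

End Hochschild.

Section Formality.
Variables (F : fieldType) (A : dga F).
Local Notation H := (cohomology_galg A).

(* [a] is a cocycle of [A] whose cohomology class is [h]. *)
Definition represents (a : A) (h : H) : Prop :=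
  exists2 z : cocycle A, a = z & h = coclass z.

Definition A3_formal : Prop :=
  exists (f1 : 1.-tuple H -> A) (f2 : 2.-tuple H -> A) (f3 : 3.-tuple H -> A),
    [/\ [/\ graded_map 0 f1, graded_map (-1) f2 & graded_map (-2) f3],
        exists2 phi : H -> H, bijective phi &
          forall x, represents (f1 [tuple x]) (phi x),
        forall x y : H, homogeneous x -> homogeneous y ->
          ddiff (f2 [tuple x; y]) =
            f1 [tuple x * y] - f1 [tuple x] * f1 [tuple y] &
        forall (i : nat) (x y z : H),
          gdeg i x -> homogeneous y -> homogeneous z ->
          ddiff (f3 [tuple x; y; z])
            + (-1) ^+ i *: (f1 [tuple x] * f2 [tuple y; z])
            - f2 [tuple x; y] * f1 [tuple z] =
          f2 [tuple x * y; z] - f2 [tuple x; y * z]].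

Definition is_canonical_class (gamma : HH H 3 (-1)) : Prop :=
  exists (f1 : 1.-tuple H -> A) (f2 : 2.-tuple H -> A) (m3 : hcocycle H 3 (-1)),
    [/\ graded_map 0 f1 /\ graded_map (-1) f2,
        forall x, represents (f1 [tuple x]) x,
        forall x y : H, homogeneous x -> homogeneous y ->
          ddiff (f2 [tuple x; y]) =
            f1 [tuple x * y] - f1 [tuple x] * f1 [tuple y],
        forall (i : nat) (x y z : H),
          gdeg i x -> homogeneous y -> homogeneous z ->
          represents
            ((-1) ^+ i *: (f1 [tuple x] * f2 [tuple y; z])
              - f2 [tuple x; y] * f1 [tuple z]
              - f2 [tuple x * y; z] + f2 [tuple x; y * z])
            (m3 [tuple x; y; z]) &
        gamma = hclass m3].

End Formality.

(* Continuous inhomogeneous cochains with trivial coefficients in a discrete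
   field.  The disjoint union of the powers [G ^ n] is the type of words
   [seq G], so the direct sum over [n] of the spaces of continuous functions
   [G ^ n -> F] is the space of functions [seq G -> F] that are continuous on
   the words of each length [n] and vanish on the words of large length. *)
Section Cochains.
Variables (G : topGroupType) (F : fieldType).
Implicit Types (s t : seq G) (f g h : seq G -> F^o) (x y : G).

Definition words (n : nat) (t : prod_topology (fun _ : 'I_n => G)) : seq G :=
  [seq t i | i : 'I_n].

Definition is_cochain : {pred seq G -> F^o} := fun f =>
  `[< (forall n, continuous (fun u => f (@words n u) : discrete_topology F)) /\
      exists N, forall s, (N <= size s)%N -> f s = 0 >].

Definition cup f g : seq G -> F^o := fun s =>
  \sum_(i < (size s).+1) f (take i s) * g (drop i s).

(* Word [g_1, ..., g_i * g_(i+1), ..., g_n]. *)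
Definition merge_word (i : nat) s : seq G :=
  take i.-1 s ++ (nth 1 s i.-1 * nth 1 s i)%g :: drop i.+1 s.

(* On a word of length [n + 1] this is [\delta \phi] for [\phi] the component
   of degree [n] of [f]. *)
Definition delta f : seq G -> F^o := fun s =>
  if s is [::] then 0 else
  f (behead s) + \sum_(1 <= i < size s) (-1) ^+ i * f (merge_word i s)
  + (-1) ^+ size s * f (take (size s).-1 s).

(* Restriction to words of length [n]. *)
Definition restr (n : nat) f : seq G -> F^o := fun s =>
  if size s == n then f s else 0.

Definition cup_one : seq G -> F^o := fun s => (s == [::])%:R.

Let sh x f : seq G -> F^o := fun s => f (x :: s).

Lemma cup_nil f g : cup f g [::] = f [::] * g [::].
Proof. by rewrite /cup big_ord_recl big_ord0 addr0. Qed.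

Lemma cup_cons f g x s :
  cup f g (x :: s) = f [::] * g (x :: s) + cup (sh x f) g s.
Proof. by rewrite /cup big_ord_recl. Qed.

Lemma cupDl f g h : cup (f + g) h = cup f h + cup g h.
Proof.
apply/funext => s; rewrite -[RHS]/(cup f h s + cup g h s) /cup -big_split.
by apply: eq_bigr => i _; exact: mulrDl.
Qed.
Lemma cupDr f g h : cup f (g + h) = cup f g + cup f h.
Proof.
apply/funext => s; rewrite -[RHS]/(cup f g s + cup f h s) /cup -big_split.
by apply: eq_bigr => i _; exact: mulrDr.
Qed.
Lemma cupZl (c : F) f g : cup (c *: f) g = c *: cup f g.
Proof.
apply/funext => s; rewrite -[RHS]/(c *: cup f g s) /cup scaler_sumr; apply: eq_bigr => i _.
exact/esym/mulrA.
Qed.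
Lemma cupZr (c : F) f g : cup f (c *: g) = c *: cup f g.
Proof.
apply/funext => s; rewrite -[RHS]/(c *: cup f g s) /cup scaler_sumr; apply: eq_bigr => i _.
exact: mulrCA.
Qed.

Lemma cupA : associative cup.
Proof.
move=> f g h; apply/funext => s; elim: s f g => [|x s IHs] f g.
  by rewrite !cup_nil mulrA.
rewrite !cup_cons cup_nil.
have -> : sh x (cup f g) = f [::] *: sh x g + cup (sh x f) g.
  by apply/funext => t; rewrite /sh cup_cons.
rewrite cupDl cupZl IHs.
rewrite -[(_ *: _ + _) s]/(f [::] * cup (sh x g) h s + cup (cup (sh x f) g) h s).
by rewrite mulrDr mulrA addrA.
Qed.

Lemma cup1l : left_id cup_one cup.
Proof.
move=> f; apply/funext => s; rewrite /cup big_ord_recl take0 drop0.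
rewrite /cup_one eqxx mul1r big1 ?addr0// => i _.
by case: s i => [[]//|x s] i; rewrite mul0r.
Qed.

Lemma cup1r : right_id cup_one cup.
Proof.
move=> f; apply/funext => s; rewrite /cup big_ord_recr /= take_size drop_size.
rewrite /cup_one eqxx mulr1 big1 ?add0r// => i _.
rewrite -size_eq0 size_drop subn_eq0 leqNgt ltn_ord mulr0//.
Qed.

Lemma delta1 f x : delta f [:: x] = 0.
Proof. by rewrite /delta /= big_geq// addr0 mulN1r subrr. Qed.

Lemma delta_cons f x y s : delta f (x :: y :: s) =
  f (y :: s) - f ((x * y)%g :: s) + f (x :: s) - delta (sh x f) (y :: s).
Proof.
rewrite /delta [behead _]/= [size _]/= big_nat_recl//.
rewrite expr1 mulN1r {1}/merge_word /= drop0.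
under eq_big_nat => i /andP[i0 _].
  rewrite exprS mulN1r mulNr.
  rewrite (_ : merge_word i.+1 _ = x :: merge_word i (y :: s)); last first.
    by case: i i0 => // i _; rewrite /merge_word /=.
  over.
rewrite sumrN /sh exprS mulN1r mulNr !opprD.
by rewrite !addrA addrK.
Qed.

Lemma deltaP (c : F) f g : delta (c *: f + g) = c *: delta f + delta g.
Proof.
apply/funext => s; rewrite -[RHS]/(c * delta f s + delta g s).
have fgE t : (c *: f + g) t = c * f t + g t by [].
case: s => [|x s]; first by rewrite /= mulr0 addr0.
rewrite /delta !fgE; under eq_bigr do rewrite fgE mulrDr mulrCA.
rewrite big_split /= -mulr_sumr; set S := \sum_(_ <= i < _) _.
by set T := \sum_(_ <= i < _) _; ring.
Qed.

Definition twist f : seq G -> F^o := fun s => (-1) ^+ size s * f s.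

Lemma delta_cup f g s :
  delta (cup f g) s = cup (delta f) g s + cup (twist f) (delta g) s.
Proof.
elim: s f => [|x s IHs] f.
  by rewrite !cup_nil /= mul0r mulr0 addr0.
case: s IHs => [|y s] IHs.
  rewrite delta1 !cup_cons !cup_nil /sh !delta1 /= !(mul0r, mulr0, addr0).
  by [].
rewrite delta_cons [X in delta X](_ : _ =
    f [::] *: sh x g + cup (sh x f) g); last first.
  by apply/funext => t; rewrite /sh cup_cons.
rewrite deltaP -[(_ *: _ + _) _]/(f [::] * delta (sh x g) (y :: s)
  + delta (cup (sh x f) g) (y :: s)) IHs.
rewrite (cup_cons (delta f) g x) (cup_cons (sh x (delta f)) g y).
rewrite (cup_cons (delta (sh x f)) g y) (cup_cons (twist f) (delta g) x).
rewrite (cup_cons f g y) (cup_cons f g (x * y)%g) (cup_cons f g x).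
have -> : (sh y (sh x (delta f)) = (-1) *: sh y (delta (sh x f)) +
   ((-1) *: sh (x * y)%g f + (sh y f + sh x f))).
  apply/funext => t; rewrite -[RHS]/(-1 * delta (sh x f) (y :: t) +
    (-1 * f ((x * y)%g :: t) + (f (y :: t) + f (x :: t)))).
  by rewrite /sh delta_cons; ring.
move: (sh y (delta (sh x f))) => p.
rewrite !(cupDl, cupZl).
rewrite -[(_ *: _ + _) s]/(-1 * cup p g s +
    (-1 * cup (sh (x * y)%g f) g s + (cup (sh y f) g s + cup (sh x f) g s))).
have -> : sh x (twist f) = (-1) *: twist (sh x f).
  apply/funext => t.
  by rewrite -[RHS]/(-1 * ((-1) ^+ size t * f (x :: t))) mulrA -exprS.
rewrite cupZl.
rewrite -[(-1 *: _) _]/(-1 * cup (twist (sh x f)) (delta g) (y :: s)).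
rewrite (delta_cons g) [twist f [::]]mul1r /sh !delta1.
rewrite [delta f [::]]/= [delta _ [::]]/=.
by ring.
Qed.

Lemma deltaK f : delta (delta f) = 0.
Proof.
apply/funext => s; rewrite -[RHS]/(0 : F); elim: s f => [//|x s IHs] f.
case: s IHs => [|y s] IHs; first by rewrite delta1.
pose A : seq G -> F^o := fun t => if t is z :: u then f ((x * z)%g :: u) else f [::].
pose C : seq G -> F^o := fun t => if t is z :: u then f (x :: u) else 0.
rewrite delta_cons [sh x _](_ : _ =
  (-1) *: A + ((-1) *: delta (sh x f) + (1 *: C + f))); last first.
  apply/funext => t; rewrite -[RHS]/(-1 * A t + (-1 * delta (sh x f) t +
    (1 * C t + f t))) /sh.
  case: t => [|z t]; last by rewrite delta_cons /A /C /sh; ring.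
  by rewrite delta1 /A /C /=; ring.
rewrite !deltaP -[(_ *: _ + _) _]/(-1 * delta A (y :: s) +
  (-1 * delta (delta (sh x f)) (y :: s) + (1 * delta C (y :: s)
    + delta f (y :: s)))) IHs.
case: s IHs => [|z s] _; first by rewrite !delta1; ring.
rewrite (delta_cons A) (delta_cons C).
have -> : sh y A = sh (x * y)%g f by [].
have -> : sh y C = sh x f by [].
rewrite !(delta_cons f) /A /C mulgA.
by ring.
Qed.

Lemma twist_restr n f : restr n f = f -> twist f = (-1) ^+ n *: f.
Proof.
move=> fE; apply/funext => s; rewrite /twist -[RHS]/((-1) ^+ n * f s) -fE.
by rewrite /restr; case: eqP => [->//|_]; rewrite !mulr0.
Qed.

Lemma restr_linear n (c : F) f g :
  restr n (c *: f + g) = c *: restr n f + restr n g.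
Proof.
apply/funext => s; rewrite -[RHS]/(c * restr n f s + restr n g s) /restr.
by case: ifP; rewrite // mulr0 addr0.
Qed.

Lemma restr_restr m n f : restr m (restr n f) = if m == n then restr n f else 0.
Proof.
have [->|mn] := eqVneq m n; apply/funext => s; rewrite /restr.
  by case: eqP.
by rewrite -[RHS]/(0 : F); case: eqVneq => // ->; rewrite (negPf mn).
Qed.

Lemma restrP n f : restr n f = f <-> forall s, size s != n -> f s = 0.
Proof.
split=> [<- s /negPf sn|H]; first by rewrite /restr sn.
by apply/funext => s; rewrite /restr; case: eqVneq => // /H.
Qed.

Lemma restr_cup m n f g : restr m f = f -> restr n g = g ->
  restr (m + n) (cup f g) = cup f g.
Proof.
move=> /restrP fm /restrP gn; apply/restrP => s smn; apply: big1 => i _.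
have [ti|/fm->] := eqVneq (size (take i s)) m; last by rewrite mul0r.
rewrite (gn (drop i s)) ?mulr0//; apply: contraNneq smn => di.
by rewrite -[s](cat_take_drop i) size_cat ti di.
Qed.

Lemma restr_one : restr 0 cup_one = cup_one.
Proof. by apply/restrP => -[]. Qed.

Lemma restr0 f : restr 0 f = f [::] *: cup_one.
Proof.
apply/funext => s; rewrite -[RHS]/(f [::] * cup_one s) /restr /cup_one.
by case: s => [|x s]; rewrite ?mulr1 ?mulr0.
Qed.

Lemma size_merge_word i s : (0 < i < size s)%N ->
  size (merge_word i s) = (size s).-1.
Proof.
case: i => // i /= si; rewrite size_cat /= size_takel; last by rewrite ltnW// ltnW.
by rewrite size_drop; move: si; lia.
Qed.

Lemma restr_delta n f : restr n f = f -> restr n.+1 (delta f) = delta f.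
Proof.
move=> /restrP fn; apply/restrP => -[//|x s] sn.
rewrite /delta !fn ?size_takel//= ?mulr0 ?addr0 ?add0r.
rewrite big_nat big1// => i si; rewrite fn ?mulr0//.
by rewrite size_merge_word//.
Qed.

Let locconst (T : topologicalType) (f : T -> F^o) :=
  continuous (f : T -> discrete_topology F).

Let locconstP (T : topologicalType) (f : T -> F^o) :
  locconst f <-> forall a, \forall b \near a, f b = f a.
Proof.
split=> [fc a|fc a].
  by have /(@discrete_cvg (discrete_topology F)) := fc a.
by apply/(@discrete_cvg (discrete_topology F)); exact: fc.
Qed.

Let locconst2 (T : topologicalType) (op : F^o -> F^o -> F^o) (f g : T -> F^o) :
  locconst f -> locconst g -> locconst (fun a => op (f a) (g a)).
Proof.
move=> /locconstP fc /locconstP gc; apply/locconstP => a.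
by apply: filterS2 (fc a) (gc a) => b -> ->.
Qed.

Let locconst_cst (T : topologicalType) (c : F^o) : locconst (fun _ : T => c).
Proof. by apply/locconstP => a; exact: nearW. Qed.

Let locconst_sum (T : topologicalType) I (r : seq I) (P : pred I)
    (f : I -> T -> F^o) :
  (forall i, P i -> locconst (f i)) ->
  locconst (fun a => \sum_(i <- r | P i) f i a).
Proof.
move=> fc; elim: r => [|i r IHr].
  by under eq_fun do rewrite big_nil; exact: locconst_cst.
under eq_fun do rewrite big_cons.
by case: (boolP (P i)) => [/fc fi|//]; apply: (locconst2 (op := +%R)).
Qed.

Let size_words n u : size (@words n u) = n.
Proof. by rewrite size_map size_enum_ord. Qed.

Let nth_words n u j (jn : (j < n)%N) : nth 1%g (@words n u) j = u (Ordinal jn).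
Proof.
rewrite /words /image_mem (@nth_map _ (Ordinal jn) _ 1%g u j) ?size_enum_ord//; congr u.
by apply: val_inj; rewrite /= nth_enum_ord.
Qed.

Let locconst_words f m (T : topologicalType) (w : T -> seq G) :
  (forall n, locconst (fun u => f (@words n u))) ->
  (forall a, size (w a) = m) ->
  (forall j, (j < m)%N -> exists2 v : T -> G, continuous v &
    forall a, nth 1%g (w a) j = v a) ->
  locconst (fun a => f (w a)).
Proof.
move=> fc wm wc.
pose v a : prod_topology (fun _ : 'I_m => G) := fun j => nth 1%g (w a) j.
have -> : (fun a => f (w a)) = (fun a => f (words (v a))).
  apply/funext => a; congr f; apply: (@eq_from_nth _ 1%g).
    by rewrite size_words wm.
  by move=> j; rewrite wm => jm; rewrite nth_words.
move=> a; apply: (@continuous_comp _ _ (discrete_topology F) v (fun u => f (words u))).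
  apply/cvg_sup => j U [V] [[W] oW <-] Wj WU.
  apply: (filterS WU); have [z zc zE] := wc j (ltn_ord j).
  suff : nbhs a [set b | W (v b j)] by [].
  rewrite (_ : [set b | _] = z @^-1` W); last first.
    by apply/seteqP; split => b; rewrite /= /v zE.
  apply: zc; rewrite -zE.
  by apply: open_nbhs_nbhs; split.
exact: fc.
Qed.

Let nth_words_continuous n j :
  (j < n)%N -> continuous (fun u => nth 1%g (@words n u) j).
Proof.
move=> jn; rewrite (_ : (fun _ => _) = (proj (Ordinal jn))); last first.
  by apply/funext => u; rewrite nth_words.
exact: proj_continuous.
Qed.

Lemma is_cochain_cup f g :
  f \in is_cochain -> g \in is_cochain -> cup f g \in is_cochain.
Proof.
move=> /asboolP[fc [N fN]] /asboolP[gc [M gM]]; apply/asboolP; split; last first.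
  exists (N + M)%N => s NMs; apply: big1 => i _.
  have [Ni|iN] := leqP N (size (take i s)); first by rewrite fN// mul0r.
  rewrite gM ?mulr0//; move: NMs; rewrite -{1}(cat_take_drop i s) size_cat.
  by lia.
move=> n; rewrite (_ : (fun _ => _) = fun u : prod_topology (fun _ : 'I_n => G) =>
  \sum_(i < n.+1) f (take i (words u)) * g (drop i (words u))); last first.
  by apply/funext => u; rewrite /cup size_words.
apply: locconst_sum => i _; apply: (locconst2 (op := *%R)).
- apply: (locconst_words (m := i)) => // [u|j ji].
    by rewrite size_takel// size_words -ltnS.
  exists (fun u => nth 1%g (@words n u) j) => [|u]; last by rewrite nth_take.
  by apply: nth_words_continuous; rewrite (leq_trans ji)// -ltnS.
- apply: (locconst_words (m := (n - i)%N)) => // [u|j ji].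
    by rewrite size_drop size_words.
  exists (fun u => nth 1%g (@words n u) (i + j)%N) => [|u].
    by apply: nth_words_continuous; move: ji; lia.
  by rewrite nth_drop.
Qed.

Lemma is_cochain_one : cup_one \in is_cochain.
Proof.
apply/asboolP; split; last by exists 1%N => -[].
move=> n; rewrite (_ : (fun _ => _) = fun=> (n == 0%N)%:R).
  exact: locconst_cst.
by apply/funext => u; rewrite /cup_one -size_eq0 size_words.
Qed.

Lemma is_cochain_submod : submod_closed is_cochain.
Proof.
split.
  by apply/asboolP; split; [move=> n; exact: locconst_cst|exists 0%N].
move=> c f g /asboolP[fc [N fN]] /asboolP[gc [M gM]]; apply/asboolP; split.
  move=> n; apply: (locconst2 (op := fun a b => c * a + b)); first exact: fc.
  exact: gc.
exists (maxn N M) => s; rewrite geq_max => /andP[Ns Ms].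
by rewrite -[LHS]/(c * f s + g s) fN// gM// mulr0 addr0.
Qed.

Lemma is_cochain_restr n f : f \in is_cochain -> restr n f \in is_cochain.
Proof.
move=> /asboolP[fc [N fN]]; apply/asboolP; split; last first.
  by exists N => s /fN; rewrite /restr; case: ifP.
move=> m; rewrite (_ : (fun _ => _) = fun u : prod_topology (fun _ : 'I_m => G) =>
  if m == n then f (words u) else 0); last first.
  by apply/funext => u; rewrite /restr size_words.
by case: (boolP (m == n)) => _; [exact: fc|exact: locconst_cst].
Qed.

Lemma is_cochain_delta f : f \in is_cochain -> delta f \in is_cochain.
Proof.
move=> /asboolP[fc [N fN]]; apply/asboolP; split; last first.
  exists N.+1 => -[//|x s] /= Ns; rewrite /delta !fN//; last first.
    by rewrite size_takel/=.
  rewrite mulr0 addr0 add0r big_nat big1// => i si.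
  by rewrite fN ?mulr0// size_merge_word.
move=> [|n].
  rewrite (_ : (fun _ => _) = fun=> 0); first exact: locconst_cst.
  by apply/funext => u; have /size0nil -> := size_words u.
rewrite (_ : (fun _ => _) = fun u : prod_topology (fun _ : 'I_n.+1 => G) =>
  f (behead (words u)) + \sum_(1 <= i < n.+1) (-1) ^+ i * f (merge_word i (words u))
  + (-1) ^+ n.+1 * f (take n (words u))); last first.
  apply/funext => u; have := size_words u; rewrite /delta.
  by case: (words u) => [//|y s] ->.
apply: (locconst2 (op := +%R)); first apply: (locconst2 (op := +%R)).
- apply: (locconst_words (m := n)) => // [u|j jn].
    by rewrite size_behead size_words.
  exists (fun u => nth 1%g (@words n.+1 u) j.+1) => [|u].
    exact: nth_words_continuous.
  by rewrite nth_behead.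
- rewrite (_ : (fun _ => _) = fun u : prod_topology (fun _ : 'I_n.+1 => G) =>
    \sum_(1 <= i < n.+1 | (1 <= i < n.+1)%N)
       (-1) ^+ i * f (merge_word i (words u))); last first.
    by apply/funext => u; rewrite big_nat.
  apply: locconst_sum => i /[dup] iP /andP[i0 iN].
  apply: (locconst2 (op := *%R)); first exact: locconst_cst.
  apply: (locconst_words (m := n)) => // [u|j jn].
    by rewrite size_merge_word size_words.
  have st (u : prod_topology (fun _ : 'I_n.+1 => G)) : size (take i.-1 (words u)) = i.-1.
    by rewrite size_takel// size_words; lia.
  rewrite /merge_word; have [ji|ij] := ltnP j i.-1.
    exists (fun u => nth 1%g (@words n.+1 u) j) => [|u].
      by apply: nth_words_continuous; lia.
    by rewrite nth_cat st ji nth_take.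
  have [->|ji] := eqVneq j i.-1.
    exists (fun u => nth 1%g (@words n.+1 u) i.-1 * nth 1%g (@words n.+1 u) i)%g.
      move=> u; apply: (@continuous_comp _ _ _
        (fun u => (nth 1%g (@words n.+1 u) i.-1, nth 1%g (@words n.+1 u) i))
        (fun x : G * G => (x.1 * x.2)%g)); last exact: mulg_continuous.
      have ipn : (i.-1 < n.+1)%N by lia.
      have c1 := nth_words_continuous ipn; have c2 := nth_words_continuous iN.
      exact: (cvg_pair (c1 u) (c2 u)).
    by move=> u; rewrite nth_cat st ltnn subnn.
  exists (fun u => nth 1%g (@words n.+1 u) j.+1) => [|u].
    by apply: nth_words_continuous; lia.
  rewrite nth_cat st ltnNge ij /=; have -> : (j - i.-1)%N = (j - i).+1 by lia.
  by rewrite /= nth_drop; congr (nth _ _ _); lia.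
- apply: (locconst2 (op := *%R)); first exact: locconst_cst.
  apply: (locconst_words (m := n)) => // [u|j jn].
    by rewrite size_takel// size_words.
  exists (fun u => nth 1%g (@words n.+1 u) j) => [|u]; last by rewrite nth_take.
  by apply: nth_words_continuous; lia.
Qed.

HB.instance Definition _ := GRing.isSubmodClosed.Build F (seq G -> F^o)
  is_cochain is_cochain_submod.

Record cochain := Cochain {
  cochain_val :> seq G -> F^o; cochainP : cochain_val \in is_cochain }.
HB.instance Definition _ := [isSub for cochain_val].
HB.instance Definition _ := [Choice of cochain by <:].
HB.instance Definition _ := GRing.SubChoice_isSubLmodule.Build F
  (seq G -> F^o) is_cochain cochain is_cochain_submod.

Definition cochain_mul (a b : cochain) : cochain :=
  Cochain (is_cochain_cup (cochainP a) (cochainP b)).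
Definition cochain_one : cochain := Cochain is_cochain_one.
Definition cochain_diff (a : cochain) : cochain :=
  Cochain (is_cochain_delta (cochainP a)).
Definition cochain_proj (n : nat) (a : cochain) : cochain :=
  Cochain (is_cochain_restr n (cochainP a)).

Let comulA : associative cochain_mul.
Proof. by move=> a b c; apply: val_inj; exact: cupA. Qed.
Let comul1l : left_id cochain_one cochain_mul.
Proof. by move=> a; apply: val_inj; exact: cup1l. Qed.
Let comul1r : right_id cochain_one cochain_mul.
Proof. by move=> a; apply: val_inj; exact: cup1r. Qed.
Let comulDl : left_distributive cochain_mul +%R.
Proof. by move=> a b c; apply: val_inj; exact: cupDl. Qed.
Let comulDr : right_distributive cochain_mul +%R.
Proof. by move=> a b c; apply: val_inj; exact: cupDr. Qed.
Let coone_neq0 : cochain_one != 0.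
Proof.
apply/eqP => /(congr1 (fun a : cochain => a [::])) /eqP.
by rewrite [cochain_one _]/= /cup_one eqxx [X in _ == X]/= oner_eq0.
Qed.
HB.instance Definition _ := GRing.Zmodule_isNzRing.Build cochain
  comulA comul1l comul1r comulDl comulDr coone_neq0.

Let coscaleAl (c : F) (a b : cochain) : c *: (a * b) = c *: a * b.
Proof. by apply: val_inj; rewrite /= cupZl. Qed.
Let coscaleAr (c : F) (a b : cochain) : c *: (a * b) = a * (c *: b).
Proof. by apply: val_inj; rewrite /= cupZr. Qed.
HB.instance Definition _ := GRing.Lmodule_isLalgebra.Build F cochain coscaleAl.
HB.instance Definition _ := GRing.Lalgebra_isAlgebra.Build F cochain coscaleAr.

Let coproj_linear n : linear (cochain_proj n).
Proof.
move=> c a b; apply: val_inj.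
exact: (restr_linear n c (cochain_val a) (cochain_val b)).
Qed.
Let coproj_proj m n (a : cochain) : cochain_proj m (cochain_proj n a) =
  if m == n then cochain_proj n a else 0.
Proof. by apply: val_inj; rewrite /= restr_restr; case: ifP. Qed.
Let coproj_sum (a : cochain) : exists N, a = \sum_(i < N) cochain_proj i a.
Proof.
have /asboolP[_ [N aN]] := cochainP a; exists N; apply: val_inj.
rewrite [RHS]raddf_sum; apply/funext => s; rewrite fct_sumE /= /restr.
have [/[dup] Ns /aN ->|sN] := leqP N (size s).
  by rewrite big1// => i _; rewrite gtn_eqF// (leq_trans (ltn_ord i)).
rewrite (bigD1 (Ordinal sN))//= eqxx big1 ?addr0// => i iN.
by rewrite ifN// eq_sym.
Qed.
Let coproj_mul m n (a b : cochain) : cochain_proj m a = a ->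
  cochain_proj n b = b -> cochain_proj (m + n) (a * b) = a * b.
Proof.
move=> /(congr1 val) am /(congr1 val) bn; apply: val_inj.
exact: restr_cup am bn.
Qed.
Let coproj_one : cochain_proj 0 1 = 1.
Proof. by apply: val_inj; exact: restr_one. Qed.
Let coproj_conn (a : cochain) : exists c : F, cochain_proj 0 a = c%:A.
Proof. by exists (a [::]); apply: val_inj; exact: restr0. Qed.

Definition cochain_galg : galg F :=
  @GAlg F cochain cochain_proj coproj_linear coproj_proj coproj_sum coproj_mul
    coproj_one coproj_conn.

Let codiff_linear : linear (cochain_diff : cochain_galg -> cochain_galg).
Proof.
move=> c a b; apply: val_inj.
exact: (deltaP c (cochain_val a) (cochain_val b)).
Qed.
Let codiff_deg (n : nat) (a : cochain_galg) :
  gdeg n a -> gdeg n.+1 (cochain_diff a : cochain_galg).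
Proof. by move=> /(congr1 val) an; apply: val_inj; exact: restr_delta. Qed.
Let codiffK (a : cochain_galg) :
  cochain_diff (cochain_diff a) = 0 :> cochain_galg.
Proof. by apply: val_inj; exact: deltaK. Qed.
Let codiff_leibniz (n : nat) (a b : cochain_galg) : gdeg n a ->
  cochain_diff (a * b) =
  (cochain_diff a : cochain_galg) * b + (-1) ^+ n *: (a * cochain_diff b)
    :> cochain_galg.
Proof.
move=> /(congr1 val) an; apply: val_inj; apply/funext => s /=.
by rewrite delta_cup (twist_restr an) cupZl.
Qed.

Definition cochain_dga : dga F :=
  @DGA F cochain_galg cochain_diff codiff_linear codiff_deg codiffK
    codiff_leibniz.

End Cochains.

(* Main.v *)
(* Let F -> G be the presentation and r the relator.  A continuous 2-cocycle of
   G with finite p-primary coefficients becomes on F the coboundary of a cochain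
   u, and u descends to G as soon as u r = u 1, so that u r - u 1 is the only
   obstruction.  This trace takes every value: solve D r = c for a derivation D
   of F into the functions on a large cyclic quotient of G.  Embedding a module
   into a coinduced one then kills cohomology in degrees at least 3, and
   cohomology has a basis 1, chi_i, e = chi_1 chi_0, the chi_i being dual to the
   generators x_0, ..., x_(d-1).

   On F choose D_ij with coboundary chi_i cup chi_j; with the right values on the
   generators, the homomorphisms to unipotent 4 x 4 matrices having the chi_i and
   the D_ij above the diagonal have a corner entry T_ijk that is trivial on each
   commutator of r, and on x_0 ^ q because p divides q, 'C(q, 2) and 'C(q, 3).
   Hence T_ijk, corrected by primitives of e chi_k and chi_i e, descends to G and
   provides f_3 on classes of degree 1; in higher total degree f_3 exists because
   cohomology vanishes.  So m_3 = 0 for this choice of f_1 and f_2, and any other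
   choice changes m_3 by an explicit Hochschild coboundary. *)
From HB Require Import structures.
Require Import Defs.
From mathcomp Require Import all_boot all_order all_algebra.
From mathcomp Require Import fingroup perm cyclic pgroup.
From mathcomp Require Import all_classical topology.
From mathcomp Require Import ring zify.

Set Implicit Arguments.
Unset Strict Implicit.
Unset Printing Implicit Defensive.

Import GRing.Theory.
Local Open Scope classical_set_scope.

(** * Topological groups and locally constant maps *)

(** The Fox derivatives of r reduce modulo p to elements of the augmentation ideal, so a derivation
    of F into a nonzero module C on which a p-group acts reaches only a proper part of C at r.
    Passing to functions from a cyclic group of order p^(k+1) to C, on which x_1 acts through
    translation, puts every constant function in the image of 1 - x_1. The derivation is then
    constant-valued on the kernel of F -> G, and evaluating it at 0 gives a 1-cochain whose
    coboundary still comes from G. Vanishing in degree 3 and above is proved for all finite modules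
    killed by p at once, because the dimension shift changes the module. The trace is used in degree
    3 only: an obstruction in the quotient of the coinduced module is lifted to the coinduced module
    and removed there by a cocycle with that trace. As p divides q, every homomorphism F -> F_p
    kills r. Hence T_ijk(r) does not depend on the values of T_ijk on the generators, and neither do
    the traces of the D_ij on theirs: the freedom that makes T_ijk(r) vanish lies in the generator
    values of the D_ij, which can be adjusted without changing the cup products. *)

Definition loc_const (T : topologicalType) (A : Type) (f : T -> A) : Prop :=
  forall a, \forall b \near a, f b = f a.

Lemma loc_const_comp (S T : topologicalType) (A : Type) (g : S -> T)
  (f : T -> A) : continuous g -> loc_const f -> loc_const (f \o g).
Proof. by move=> gc fc a; exact: gc (fc (g a)). Qed.

Lemma loc_const2 (T : topologicalType) (A B C : Type) (op : A -> B -> C)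
    (f : T -> A) (g : T -> B) :
  loc_const f -> loc_const g -> loc_const (fun a => op (f a) (g a)).
Proof. by move=> fc gc a; apply: filterS2 (fc a) (gc a) => b -> ->. Qed.

Lemma loc_const1 (T : topologicalType) (A B : Type) (op : A -> B)
    (f : T -> A) :
  loc_const f -> loc_const (fun a => op (f a)).
Proof. by move=> fc a; apply: filterS (fc a) => b ->. Qed.

Lemma loc_const_cst (T : topologicalType) (A : Type) (c : A) :
  loc_const (fun _ : T => c).
Proof. by move=> a; apply: (@filterS _ _ _ setT); [|exact: filterT]. Qed.

Lemma loc_constP (T : topologicalType) (A : choiceType) (f : T -> A) :
  continuous (f : T -> discrete_topology A) <-> loc_const f.
Proof.
split=> fc a; first by have /(@discrete_cvg (discrete_topology A)) := fc a.
by apply/(@discrete_cvg (discrete_topology A)); exact: fc.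
Qed.

Lemma loc_const_open (T : topologicalType) (A : Type) (f : T -> A) (P : set A) :
  loc_const f -> open (f @^-1` P).
Proof.
move=> fc; rewrite openE => a Pa; rewrite /interior.
by apply: filterS (fc a) => b /= ->.
Qed.

Lemma loc_const_closed (T : topologicalType) (A : Type) (f : T -> A)
  (P : set A) : loc_const f -> closed (f @^-1` P).
Proof.
move=> fc; rewrite -[X in closed X]setCK closedC.
exact: (@loc_const_open _ _ f (~` P) fc).
Qed.

Lemma compact_tube (X Y : topologicalType) (P : X -> Y -> Prop) (y : Y) :
  compact [set: X] ->
  (forall x : X, \forall x' \near x & y' \near y, P x' y') ->
  \forall y' \near y, forall x, P x y'.
Proof.
move=> /compact_near_coveringP Xc xP.
have := Xc Y (nbhs y) (fun y' x => P x y') (nbhs_filter y) (fun x _ => xP x).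
by apply: filterS => y' h x; exact: h.
Qed.

Lemma prod_topology_continuous (I : choiceType) (K : I -> topologicalType)
    (T : topologicalType) (v : T -> prod_topology K) :
  (forall j, continuous (fun a => v a j)) -> continuous v.
Proof.
move=> vc a; apply/cvg_sup => j U [V] [[W] oW <-] Wj WU.
apply: (filterS WU).
suff : nbhs a [set b | W (v b j)] by [].
by apply: (vc j a); apply: open_nbhs_nbhs; split.
Qed.

Lemma pair_continuous (T U V : topologicalType) (f : T -> U) (g : T -> V) :
  continuous f -> continuous g -> continuous (fun t => (f t, g t)).
Proof. by move=> fc gc t; exact: (cvg_pair (fc t) (gc t)). Qed.

Section OpenSubgroups.
Local Open Scope group_scope.
Variable G : topGroupType.
Implicit Types (N U : set G) (g h x y : G).

Lemma mull_continuous g : continuous (fun x => g * x).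
Proof.
move=> x; have := @mulg_continuous G (g, x).
apply: (@continuous_comp _ _ _ (fun x => (g, x)) (fun x : G * G => x.1 * x.2)).
by apply: cvg_pair; [exact: cvg_cst|exact: cvg_id].
Qed.

Lemma continuous_mul (T : topologicalType) (f g : T -> G) :
  continuous f -> continuous g -> continuous (fun t => f t * g t).
Proof.
move=> fc gc t.
apply: (@continuous_comp _ _ _ (fun t => (f t, g t)) (fun x : G * G => x.1 * x.2)).
  by apply: cvg_pair; [exact: fc|exact: gc].
exact: mulg_continuous.
Qed.

Lemma continuous_inv (T : topologicalType) (f : T -> G) :
  continuous f -> continuous (fun t => (f t)^-1).
Proof.
move=> fc t; apply: (@continuous_comp _ _ _ f (fun x => x^-1)); first exact: fc.
exact: invg_continuous.
Qed.

Definition open_normal U := normal_subgroup U /\ open U.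

Lemma normal_coset_nbhs U g : normal_subgroup U -> nbhs 1 U ->
  nbhs g [set h | U (g^-1 * h)].
Proof.
move=> [_ _ _ _] nU; apply: (mull_continuous (g := g^-1) (x := g)).
by rewrite mulVg.
Qed.

Lemma nbhs_open_normal U : normal_subgroup U -> nbhs 1 U -> open_normal U.
Proof.
move=> NU nU; split=> //; rewrite openE => g Ug; rewrite /interior.
apply: filterS (normal_coset_nbhs g NU nU) => h /= Uh.
by have [_ UM _ _] := NU; rewrite -[h](mulVKg g); exact: UM.
Qed.

Lemma open_normal_nbhs U : open_normal U -> nbhs 1 U.
Proof. by move=> [[U1 _ _ _] oU]; apply: open_nbhs_nbhs. Qed.

Lemma open_normalI U V : open_normal U -> open_normal V -> open_normal (U `&` V).
Proof.
move=> [[U1 UM UV UJ] oU] [[V1 VM VV VJ] oV]; split; last exact: openI.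
split=> [|x y [xU xV] [yU yV]|x [xU xV]|x g [xU xV]]; split; auto.
Qed.

(** The core is the set of elements all of whose conjugates lie in [S]; by the tube lemma one
    neighbourhood of 1 serves all conjugating elements of the compact group at once. *)
Lemma open_normal_core (S : set G) : compact [set: G] -> S 1 ->
  (forall x y, S x -> S y -> S (x * y)) -> (forall x, S x -> S x^-1) ->
  nbhs 1 S -> exists2 U, open_normal U & U `<=` S.
Proof.
move=> Gc S1 SM SV nS; exists [set g | forall h, S (g ^ h)]; last first.
  by move=> g /(_ 1); rewrite conjg1.
apply: nbhs_open_normal; first split.
- by move=> h; rewrite conj1g.
- by move=> x y /= Sx Sy h; rewrite conjMg; exact: SM.
- by move=> x Sx h; rewrite conjVg; exact: SV.
- by move=> x g Sx h; rewrite /= -conjgM.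
apply: (compact_tube (P := fun h g => S (g ^ h))) => // h.
have c1 : continuous (fun z : G * G => z.1) by move=> z; exact: cvg_fst.
have c2 : continuous (fun z : G * G => z.2) by move=> z; exact: cvg_snd.
have : continuous (fun z : G * G => z.2 ^ z.1).
  apply: continuous_mul; first exact: continuous_inv.
  exact: continuous_mul.
by move=> /(_ (h, 1)) H; apply: H; rewrite /= conj1g.
Qed.

Lemma compact_has_index U : compact [set: G] -> open_normal U ->
  exists n, has_index U n.
Proof.
move=> Gc Uo; have [[U1 UM UV UJ] _] := Uo.
have : exists s : seq G, forall g, exists2 h, h \in s & U (h^-1 * g).
  have /compact_near_coveringP := Gc.
  (* [B] is the filter of finite lists ordered by inclusion, so the covering form of compactness
     produces one finite list that meets every coset. *)
  pose B := [set S : set (seq G) | exists s0 : seq G,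
    forall s : seq G, (forall h, h \in s0 -> h \in s) -> S s].
  have BF : Filter B.
    split=> [|P Q [s sP] [t tQ]|P Q PQ [s sP]]; first by exists [::].
      exists (s ++ t) => r str; split; [apply: sP|apply: tQ] => g gs; apply: str;
      by rewrite mem_cat gs ?orbT.
    by exists s => r sr; apply/PQ/sP.
  move=> /(_ _ B (fun (s : seq G) g => exists2 h, h \in s & U (h^-1 * g)) BF) [].
    move=> g _; exists ([set x | U (g^-1 * x)], [set s : seq G | g \in s]).
      split=> /=; first exact: (normal_coset_nbhs g Uo.1 (open_normal_nbhs Uo)).
      by exists [:: g] => s; apply; rewrite inE.
    by move=> [x s] /= [Ux gs]; exists g.
  by move=> s0 /(_ s0 (fun g => id)) H; exists s0 => g; exact: H.
move=> [s sP].
pose c g := find (fun h => `[< U (h^-1 * g) >]) s.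
have hasc g : has (fun h => `[< U (h^-1 * g) >]) s.
  by apply/hasP; have [h hs Uh] := sP g; exists h => //; apply/asboolP.
have cs g : (c g < size s)%N by rewrite -has_find.
have Uc g : U ((nth 1 s (c g))^-1 * g).
  by apply/asboolP; exact: (nth_find 1 (hasc g)).
have cE g h : U (g^-1 * h) <-> c g = c h.
  split=> [Ugh|gh].
    apply: eq_find => k; apply/asbool_equiv_eq; split=> [|Ukh].
      by move=> /UM/(_ Ugh); rewrite -mulgA mulVKg.
    by have := UM _ _ Ukh (UV _ Ugh); rewrite invgM invgK -mulgA mulVKg.
  by have := UM _ _ (UV _ (Uc g)) (Uc h); rewrite gh invgM invgK -mulgA mulVKg.
(* [c g] is the first position in [s] of a representative of the coset of [g]; the positions fixed
   by [c] list every coset exactly once. *)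
pose T : finType := {i : 'I_(size s) | c (nth 1 s i) == i}.
exists #|T|, (fun k => nth 1 s (val (val (enum_val k : T)))) => g.
have Pg : c (nth 1 s (Ordinal (cs g))) == Ordinal (cs g) by apply/eqP/cE/Uc.
exists (enum_rank (exist _ (Ordinal (cs g)) Pg : T)); split.
  by rewrite enum_rankK; exact: Uc.
move=> k /cE ckg; apply: enum_val_inj; rewrite enum_rankK.
do 2![apply: val_inj => /=]; rewrite -ckg; apply/eqP.
exact: (valP (enum_val k : T)).
Qed.

(** The quotient is realized by permutations of the coset representatives. Permutations compose from
    left to right, which makes [lam] an antihomomorphism, and [kap g] is therefore [lam g^-1]. The
    action is regular, which gives the order [n]. *)
Lemma finite_quotient U n : normal_subgroup U -> has_index U n ->
  exists (K : finGroupType) (kap : G -> K),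
    [/\ group_hom kap, (forall k, exists g, kap g = k),
        (forall g, kap g = 1 <-> U g) & #|K| = n].
Proof.
move=> [U1 UM UV UJ] [r rP].
have eqr i j : U ((r i)^-1 * r j) -> i = j.
  move=> Uij; have [k [Uk kP]] := rP (r j).
  by rewrite -(kP i Uij) -(kP j)// mulVg.
pose idx g := projT1 (cid (rP g)).
have idxP g : U ((r (idx g))^-1 * g) by rewrite /idx; case: cid => i [].
have idx_eq g i : U ((r i)^-1 * g) -> i = idx g.
  move=> Ui; apply: eqr.
  by have := UM _ _ Ui (UV _ (idxP g)); rewrite invgM invgK mulgA mulgK.
have lam_inj g : injective (fun i => idx (g * r i)).
  move=> i j ij; apply: eqr.
  have := UM _ _ (UV _ (idxP (g * r i))) (idxP (g * r j)).
  by rewrite ij invgM invgK -mulgA mulVKg invgM -mulgA mulKg.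
pose lam g : 'S_n := perm (@lam_inj g).
have lamM g h : lam (g * h) = lam h * lam g.
  apply/permP => i; rewrite permM !permE; apply/esym/idx_eq.
  have A := idxP (h * r i); have B := idxP (g * r (idx (h * r i))).
  by have := UM _ _ B A; rewrite !mulgA mulgK -!mulgA.
have lam1 : lam 1 = 1 by apply: (mulgI (lam 1)); rewrite -lamM !mulg1.
have lamV g : (lam g)^-1 = lam g^-1.
  by apply: (mulgI (lam g)); rewrite mulgV -lamM mulVg lam1.
have lam_ker g : lam g = 1 <-> U g.
  split=> [/permP l1|Ug].
    have := l1 (idx 1); rewrite permE perm1 => /(congr1 r) e.
    have := idxP (g * r (idx 1)); rewrite e => A.
    have B := UJ _ (r (idx 1))^-1 A.
    by move: B; rewrite conjgE invgK -!mulgA mulVKg mulgV mulg1.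
  apply/permP => i; rewrite permE perm1; apply/esym/idx_eq.
  by rewrite -conjgE; exact: UJ.
pose P := [set s : 'S_n | `[< exists g, lam g = s >]]%SET.
have PE s : s \in P <-> exists g, lam g = s.
  by rewrite [s \in P]finset.in_set; split=> [/asboolP|H]//; exact/asboolP.
have Pg : group_set P.
  apply/group_setP; split; first by apply/PE; exists 1.
  by move=> s t /PE[g <-] /PE[h <-]; apply/PE; exists (h * g).
pose Q := group Pg.
have QP g : lam g^-1 \in Q by apply/PE; exists g^-1.
exists (subg_of Q), (fun g => Subg (QP g)); split.
- by move=> g h; apply: val_inj; rewrite /= invgM lamM.
- move=> [s sQ]; have /PE[g gs] := sQ.
  by exists g^-1; apply: val_inj; rewrite /= invgK.
- move=> g; rewrite -lam_ker; split=> [/(congr1 val)/=|lg].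
    by rewrite -lamV => /(congr1 invg); rewrite invgK invg1.
  by apply: val_inj; rewrite /= -lamV lg invg1.
have rQ i : lam (r i) \in Q by apply/PE; exists (r i).
have rinj : injective (fun i => Subg (rQ i)).
  move=> i j /(congr1 val)/= ij; apply: eqr; apply/lam_ker.
  by rewrite lamM -lamV ij mulgV.
have ronto u : u \in codom (fun i => Subg (rQ i)).
  have /PE[g gu] := valP u; apply/codomP; exists (idx g); apply: val_inj => /=.
  have := idxP g => /lam_ker; rewrite lamM -lamV gu => e.
  by apply: (mulIg (lam (r (idx g)))^-1); rewrite e mulgV.
by rewrite -[RHS]card_ord -(card_codom rinj); apply/eq_card => u; rewrite ronto.
Qed.

End OpenSubgroups.

Section UniformLocalConstancy.
Local Open Scope group_scope.
Variable G : topGroupType.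
Implicit Types (U : set G) (s t : seq G).

Definition congr_mod U s t : Prop :=
  size s = size t /\ forall i, U ((nth 1 s i)^-1 * nth 1 t i).

Lemma size_words n (u : prod_topology (fun _ : 'I_n => G)) : size (words u) = n.
Proof. by rewrite size_map size_enum_ord. Qed.

Lemma nth_words n (u : prod_topology (fun _ : 'I_n => G)) (i : 'I_n) :
  nth 1 (words u) i = u i.
Proof.
rewrite /words /image_mem (@nth_map _ i) ?size_enum_ord//.
by rewrite nth_ord_enum.
Qed.

Lemma words_nth n s : size s = n ->
  s = words (fun i : 'I_n => nth 1 s i : G).
Proof.
move=> sn; apply: (@eq_from_nth G 1); rewrite ?size_words ?sn => // i ni.
by rewrite (nth_words _ (Ordinal ni)).
Qed.

Section Uniform.
Variables (n : nat) (A : Type) (f : seq G -> A).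
Let X : topologicalType := prod_topology (fun _ : 'I_n => G).
Let phi (u : X) := f (words u).
Let upd (u : X) (i : 'I_n) (s : G) : X := fun j => if j == i then u j * s else u j.

Let stab (i : 'I_n) (s : G) : Prop := forall u, phi (upd u i s) = phi u.

Let updM u i (s t : G) : upd (upd u i s) i t = upd u i (s * t).
Proof. by apply/funext => j; rewrite /upd; case: (j == i) => //; rewrite mulgA. Qed.

Let upd1 u i : upd u i 1 = u.
Proof. by apply/funext => j; rewrite /upd mulg1 if_same. Qed.

(** The right translations of one coordinate that preserve [phi] form a subgroup, a neighbourhood of
    1 by the tube lemma on the compact space [X]. A normal core [U] serves all coordinates, and
    congruent words are joined by the hybrids [hyb k], which change one letter at a time. *)
Lemma loc_const_uniform : compact [set: G] -> loc_const phi ->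
  exists2 U, open_normal U &
    forall s t, size s = n -> congr_mod U s t -> f s = f t.
Proof.
move=> Gc fc.
have Xc : compact [set: X].
  have := @tychonoff 'I_n (fun _ => G) (fun _ => setT) (fun _ => Gc).
  by congr compact; apply/seteqP; split.
have nS i : nbhs 1 (stab i).
  apply: (@compact_tube X G (fun u (s : G) => phi (upd u i s) = phi u) 1 Xc) => u.
  have c : continuous (fun z : X * G => upd z.1 i z.2).
    apply: (@prod_topology_continuous _ (fun _ => G)) => j.
    have c1 : continuous (fun z : X * G => z.1 j).
      move=> z; apply: (@continuous_comp _ _ _ (fun z : X * G => z.1) (proj j)).
        exact: cvg_fst.
      exact: (@proj_continuous _ (fun _ => G)).
    rewrite /upd; case: (j == i) => //; apply: continuous_mul => //.
    by move=> z; exact: cvg_snd.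
  have H : \forall z \near (u, 1 : G), phi (upd z.1 i z.2) = phi u.
    by apply: filterS (loc_const_comp c fc (u, 1 : G)) => z /= ->; rewrite upd1.
  have H' : \forall z \near (u, 1 : G), phi z.1 = phi u.
    have c1 : continuous (fun z : X * G => z.1) by move=> z; exact: cvg_fst.
    exact: (loc_const_comp c1 fc (u, 1 : G)).
  by apply: filterS2 H H' => z -> ->.
have sM i (s t : G) : stab i s -> stab i t -> stab i (s * t).
  by move=> Ss St u; rewrite -updM St Ss.
have sV i (s : G) : stab i s -> stab i s^-1.
  by move=> Ss u; rewrite -Ss updM mulVg upd1.
have [U Uo US] : exists2 U, open_normal U & U `<=` [set s : G | forall i, stab i s].
  apply: open_normal_core => //= [i u|s t Ss St i|s Ss i|].
  - by rewrite upd1.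
  - exact: sM.
  - exact: sV.
  - exact: (@filter_forall G _ stab (nbhs 1)).
exists U => // s t sn [st Ust].
rewrite (words_nth sn) (@words_nth n t) -?st//.
set u : X := fun i => nth 1 s i; set v : X := fun i => nth 1 t i.
pose hyb k : X := fun i => if (i < k)%N then v i else u i.
have -> : v = hyb n by apply/funext => i; rewrite /hyb ltn_ord.
suff H k : (k <= n)%N -> phi u = phi (hyb k) by exact: H.
elim: k => [_|k IHk kn]; first by congr phi; apply/funext.
rewrite IHk ?(ltnW kn)//; have /US/(_ (Ordinal kn))/(_ (hyb k)) <- := Ust k.
congr phi; apply/funext => i; rewrite /upd /hyb.
have [->|ik] := eqVneq i (Ordinal kn); first by rewrite /= ltnn ltnSn mulVKg.
have ik' : (i : nat) != k by apply: contraNneq ik => e; apply/eqP/val_inj.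
by rewrite ltnS [(i <= k)%N]leq_eqVlt (negPf ik').
Qed.

Lemma uniform_loc_const U : open_normal U ->
  (forall s t, size s = n -> congr_mod U s t -> f s = f t) -> loc_const phi.
Proof.
move=> Uo fU u.
have : \forall v \near u, forall i, U ((u i)^-1 * v i).
  apply: (@filter_forall X _ (fun i v => U ((u i)^-1 * v i)) (nbhs u)) => i.
  have := @proj_continuous _ (fun _ : 'I_n => G) i u [set g | U ((u i)^-1 * g)].
  apply; exact: (normal_coset_nbhs _ Uo.1 (open_normal_nbhs Uo)).
apply: filterS => v Uv; apply/esym/fU; first exact: size_words.
split=> [|i]; first by rewrite !size_words.
have [ni|ni] := ltnP i n; first by rewrite !(nth_words _ (Ordinal ni)).
by rewrite !nth_default ?size_words// mulVg; have [[]] := Uo.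
Qed.

End Uniform.

Lemma loc_const_invariant (A : Type) (f : G -> A) :
  compact [set: G] -> loc_const f ->
  exists2 U, open_normal U & forall g h, U (g^-1 * h) -> f g = f h.
Proof.
move=> Gc fc; have [|U Uo UP] := @loc_const_uniform 1 _ (fun s => f (nth 1 s 0)) Gc.
  have c : continuous (fun u : prod_topology (fun _ : 'I_1 => G) => u ord0).
    exact: (@proj_continuous _ (fun _ : 'I_1 => G)).
  move=> u; apply: filterS (loc_const_comp c fc u) => v /=.
  by rewrite !(nth_words _ ord0).
exists U => // g h Ugh; apply: (UP [:: g] [:: h]) => //; split=> // -[|i]//=.
by rewrite !nth_nil mulVg; have [[]] := Uo.
Qed.

Lemma invariant_loc_const (A : Type) (f : G -> A) U : open_normal U ->
  (forall g h, U (g^-1 * h) -> f g = f h) -> loc_const f.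
Proof.
move=> Uo fU g; apply: filterS (normal_coset_nbhs g Uo.1 (open_normal_nbhs Uo)).
by move=> h Ugh; apply/esym/fU.
Qed.

End UniformLocalConstancy.

(** * Twisted products and free pro-p groups *)

Section ZmodTactic.
Variable V : zmodType.

Inductive zmod_expr :=
  | ZVar of nat | ZZero | ZAdd of zmod_expr & zmod_expr | ZOpp of zmod_expr.

Fixpoint zmod_eval (env : nat -> V) (e : zmod_expr) : V :=
  match e with
  | ZVar i => env i
  | ZZero => 0%R
  | ZAdd a b => (zmod_eval env a + zmod_eval env b)%R
  | ZOpp a => (- zmod_eval env a)%R
  end.

Fixpoint zmod_vars (e : zmod_expr) : nat :=
  match e with
  | ZVar i => i.+1
  | ZZero => 0
  | ZAdd a b => maxn (zmod_vars a) (zmod_vars b)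
  | ZOpp a => zmod_vars a
  end.

Fixpoint zmod_coef (e : zmod_expr) (i : nat) : int :=
  match e with
  | ZVar j => if j == i then 1%R else 0%R
  | ZZero => 0%R
  | ZAdd a b => (zmod_coef a i + zmod_coef b i)%R
  | ZOpp a => (- zmod_coef a i)%R
  end.

Lemma zmod_evalE env e n : (zmod_vars e <= n)%N ->
  zmod_eval env e = (\sum_(i < n) env i *~ zmod_coef e i)%R.
Proof.
elim: e => [j|_|a IHa b IHb|a IHa] /=.
- move=> jn; rewrite (bigD1 (Ordinal jn))//= eqxx mulr1z big1 ?addr0// => i ij.
  by rewrite ifN ?mulr0z//; apply: contraNneq ij => ij; apply/eqP/val_inj.
- by rewrite big1// => i _; rewrite mulr0z.
- rewrite geq_max => /andP[an bn]; rewrite IHa// IHb// -big_split /=.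
  by apply: eq_bigr => i _; rewrite mulrzDr.
- by move=> an; rewrite IHa// -sumrN; apply: eq_bigr => i _; rewrite mulrNz.
Qed.

Lemma zmod_evalP env e1 e2 :
  all (fun i => zmod_coef e1 i == zmod_coef e2 i)
      (iota 0 (maxn (zmod_vars e1) (zmod_vars e2))) ->
  zmod_eval env e1 = zmod_eval env e2.
Proof.
move=> /allP eqc; set n := maxn _ _ in eqc.
rewrite (@zmod_evalE _ e1 n) ?leq_maxl// (@zmod_evalE _ e2 n) ?leq_maxr//.
apply: eq_bigr => i _; congr (_ *~ _)%R; apply/eqP/eqc.
by rewrite mem_iota /= add0n ltn_ord.
Qed.

End ZmodTactic.

Ltac zmod_index x l :=
  match l with
  | ?y :: _ => let _ := match goal with _ => unify x y end in constr:(0%N)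
  | _ :: ?t => let i := zmod_index x t in constr:(S i)
  end.

Ltac zmod_mem x l :=
  match l with
  | nil => constr:(false)
  | ?y :: _ => let _ := match goal with _ => unify x y end in constr:(true)
  | _ :: ?t => zmod_mem x t
  end.

Ltac zmod_atoms l e :=
  lazymatch e with
  | (?a + ?b)%R => let l := zmod_atoms l a in zmod_atoms l b
  | (- ?a)%R => zmod_atoms l a
  | 0%R => l
  | _ => let m := zmod_mem e l in
         lazymatch m with true => l | false => constr:(e :: l) end
  end.

Ltac zmod_reify l e :=
  lazymatch e with
  | (?a + ?b)%R => let x := zmod_reify l a in let y := zmod_reify l b in
                   constr:(ZAdd x y)
  | (- ?a)%R => let x := zmod_reify l a in constr:(ZOpp x)
  | 0%R => constr:(ZZero)
  | _ => let i := zmod_index e l in constr:(ZVar i)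
  end.

Ltac zmod :=
  lazymatch goal with
  | |- @eq ?V ?a ?b =>
    let l := zmod_atoms (@nil V) a in
    let l := zmod_atoms l b in
    let x := zmod_reify l a in
    let y := zmod_reify l b in
    change (zmod_eval (fun i => nth 0%R l i) x = zmod_eval (fun i => nth 0%R l i) y);
    apply: zmod_evalP; vm_compute; reflexivity
  end.

(** Coefficients are finite: extensions by them are then compact, and injective additive maps can be
    inverted. The action is purely algebraic here; its continuity is a separate hypothesis. *)
Record gmodule (G : groupType) := GModule {
  gm_car :> finZmodType;
  gm_act : G -> gm_car -> gm_car;
  gm_actD : forall g, {morph gm_act g : a b / (a + b)%R};
  gm_act1 : forall a, gm_act 1%g a = a;
  gm_actM : forall g h a, gm_act (g * h)%g a = gm_act g (gm_act h a)
}.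

Section GModuleTheory.
Variables (G : groupType) (M : gmodule G).
Implicit Types (g h : G) (a b : M).

Lemma gm_act0 g : gm_act g (0 : M)%R = 0%R.
Proof. by apply: (addrI (gm_act g 0%R)); rewrite -gm_actD !addr0. Qed.

Lemma gm_actN g a : gm_act g (- a)%R = (- gm_act g a)%R.
Proof. by apply: (addrI (gm_act g a)); rewrite -gm_actD !subrr gm_act0. Qed.

Lemma gm_actB g a b : gm_act g (a - b)%R = (gm_act g a - gm_act g b)%R.
Proof. by rewrite gm_actD gm_actN. Qed.

Lemma gm_actMn g a n : gm_act g (a *+ n)%R = (gm_act g a *+ n)%R.
Proof. by elim: n => [|n IHn]; rewrite ?mulr0n ?gm_act0// !mulrS gm_actD IHn. Qed.

Lemma gm_act_sum g I (r : seq I) (P : pred I) (f : I -> M) :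
  gm_act g (\sum_(i <- r | P i) f i)%R = (\sum_(i <- r | P i) gm_act g (f i))%R.
Proof. exact: (big_morph _ (gm_actD g) (gm_act0 g)). Qed.

Lemma gm_actK g : cancel (gm_act g) (@gm_act _ M g^-1%g).
Proof. by move=> a; rewrite -gm_actM mulVg gm_act1. Qed.

Lemma gm_actVK g : cancel (@gm_act _ M g^-1%g) (gm_act g).
Proof. by move=> a; rewrite -gm_actM mulgV gm_act1. Qed.

Definition trivial_on (U : set G) : Prop := forall g a, U g -> gm_act g a = a.

Lemma trivial_on_congr (U : set G) g h a :
  trivial_on U -> U (g^-1 * h)%g -> gm_act g a = gm_act h a.
Proof. by move=> MU Ugh; rewrite -[h](mulVKg g) gm_actM (MU _ a Ugh). Qed.

End GModuleTheory.

Definition p_power_torsion (p : nat) (A : zmodType) : Prop :=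
  exists n, forall a : A, (a *+ p ^ n = 0)%R.

Definition cocycle2 (G : groupType) (M : gmodule G) (z : G -> G -> M) : Prop :=
  forall g h k,
    (gm_act g (z h k) + z g (h * k)%g = z (g * h)%g k + z g h)%R.

Lemma cocycle2_1l (G : groupType) (M : gmodule G) (z : G -> G -> M) :
  cocycle2 z -> forall g, z 1%g g = z 1%g 1%g.
Proof.
move=> zP g; have := zP 1%g 1%g g; rewrite gm_act1 !mul1g.
exact: addrI.
Qed.

Lemma cocycle2_1r (G : groupType) (M : gmodule G) (z : G -> G -> M) :
  cocycle2 z -> forall g, z g 1%g = gm_act g (z 1%g 1%g).
Proof.
move=> zP g; have := zP g 1%g 1%g; rewrite !mulg1.
by move/addIr.
Qed.

(* The extension of [G] by [M] with factor set [z]; [z] need not be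
   normalized, so the unit is [(- z 1 1, 1)]. *)
Record factor_set (G : topGroupType) := FactorSet {
  fs_mod : gmodule G;
  fs_fun :> G -> G -> fs_mod;
  fs_cocycle : cocycle2 fs_fun;
  fs_act_lc : forall a : fs_mod, loc_const (fun g => gm_act g a);
  fs_fun_lc : loc_const (fun x : G * G => fs_fun x.1 x.2)
}.

Section Extension.
Variables (G : topGroupType) (z : factor_set G).
Local Notation M := (fs_mod z).

Definition ext : Type := (discrete_topology M * G)%type.
HB.instance Definition _ := Choice.on ext.
HB.instance Definition _ := Topological.copy ext (discrete_topology M * G)%type.

Definition ext_pair (a : M) (g : G) : ext := (a, g).
Definition ext_mod (x : ext) : M := x.1.
Definition ext_grp (x : ext) : G := x.2.

Definition ext_one : ext := ext_pair (- z 1%g 1%g)%R 1%g.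
Definition ext_mul (x y : ext) : ext :=
  ext_pair (ext_mod x + gm_act (ext_grp x) (ext_mod y)
              + z (ext_grp x) (ext_grp y))%R
    (ext_grp x * ext_grp y)%g.
Definition ext_inv (x : ext) : ext :=
  let g := (ext_grp x)^-1%g in
  ext_pair (- z 1%g 1%g - gm_act g (ext_mod x) - z g (ext_grp x))%R g.

Let extA : associative ext_mul.
Proof.
move=> [a g] [b h] [c k]; congr (_, _); rewrite ?mulgA//= !gm_actD gm_actM.
rewrite /ext_mod /ext_grp /=.
transitivity (a + gm_act g b + gm_act g (gm_act h c) + (gm_act g (z h k) + z g (h * k)%g))%R.
  by zmod.
by rewrite fs_cocycle; zmod.
Qed.

Let ext1m : left_id ext_one ext_mul.
Proof.
move=> [a g]; congr (_, _); rewrite /ext_mod /ext_grp ?mul1g//= gm_act1.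
by rewrite (cocycle2_1l (fs_cocycle z) g); zmod.
Qed.

Let extm1 : right_id ext_one ext_mul.
Proof.
move=> [a g]; congr (_, _); rewrite /ext_mod /ext_grp ?mulg1//= gm_actN.
by rewrite (cocycle2_1r (fs_cocycle z) g); zmod.
Qed.

Let extVm : left_inverse ext_one ext_inv ext_mul.
Proof.
move=> [a g]; congr (_, _); rewrite ?mulVg//= /ext_mod /ext_grp /=.
by zmod.
Qed.

Let extmV : right_inverse ext_one ext_inv ext_mul.
Proof.
move=> [a g]; congr (_, _); rewrite ?mulgV//= /ext_mod /ext_grp /=.
rewrite !gm_actB gm_actVK gm_actN.
have := fs_cocycle z g g^-1%g g; rewrite mulVg mulgV.
rewrite (cocycle2_1l (fs_cocycle z) g) (cocycle2_1r (fs_cocycle z) g).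
move=> e; have -> : gm_act g (z g^-1%g g) =
    (z 1%g 1%g + z g g^-1%g - gm_act g (z 1%g 1%g))%R by rewrite -e addrK.
by zmod.
Qed.

HB.instance Definition _ := isGroup.Build ext extA ext1m extm1 extVm extmV.

Lemma ext_mod_lc : loc_const ext_mod.
Proof. by apply/loc_constP => x; exact: cvg_fst. Qed.

Lemma ext_grp_continuous : continuous ext_grp.
Proof. by move=> x; exact: cvg_snd. Qed.

Lemma ext_continuous (T : topologicalType) (f : T -> ext) :
  loc_const (fun t => ext_mod (f t)) -> continuous (fun t => ext_grp (f t)) ->
  continuous f.
Proof.
move=> /loc_constP f1 f2 t.
rewrite (_ : f = fun t => ((f t).1, (f t).2)); last first.
  by apply/funext => u; case: (f u).
exact: (cvg_pair (f1 t) (f2 t)).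
Qed.

Lemma gm_act_lc (T : topologicalType) (f : T -> G) (a : T -> M) :
  continuous f -> loc_const a -> loc_const (fun t => gm_act (f t) (a t)).
Proof.
move=> fc ac t; apply: filterS2 (ac t) (loc_const_comp fc (fs_act_lc (a t)) t).
by move=> u /= -> ->.
Qed.

Let ext_mul_continuous : continuous (fun x : ext * ext => (x.1 * x.2)%g).
Proof.
have c1 : continuous (fun x : ext * ext => x.1) by move=> x; exact: cvg_fst.
have c2 : continuous (fun x : ext * ext => x.2) by move=> x; exact: cvg_snd.
have g1 : continuous (fun x : ext * ext => ext_grp x.1).
  by move=> x; apply: (continuous_comp (c1 x)); exact: ext_grp_continuous.
have g2 : continuous (fun x : ext * ext => ext_grp x.2).
  by move=> x; apply: (continuous_comp (c2 x)); exact: ext_grp_continuous.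
have m1 := loc_const_comp c1 ext_mod_lc.
have m2 := loc_const_comp c2 ext_mod_lc.
apply: ext_continuous; last exact: continuous_mul.
apply: (loc_const2 +%R).
  by apply: (loc_const2 +%R) => //; exact: gm_act_lc.
apply: (loc_const_comp (g := fun x : ext * ext => (ext_grp x.1, ext_grp x.2)) _
  (fs_fun_lc z)).
exact: pair_continuous.
Qed.

Let ext_inv_continuous : continuous (fun x : ext => (x^-1)%g).
Proof.
have gc := continuous_inv ext_grp_continuous.
apply: ext_continuous; last exact: gc.
apply: (loc_const2 (fun a b : M => (a - b)%R)).
  apply: (loc_const1 (fun a : M => (- z 1%g 1%g - a)%R)).
  by apply: gm_act_lc => //; exact: ext_mod_lc.
apply: (loc_const_comp (g := fun x : ext => ((ext_grp x)^-1%g, ext_grp x)) _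
  (fs_fun_lc z)).
exact: (pair_continuous gc ext_grp_continuous).
Qed.

HB.instance Definition _ :=
  isTopologicalGroup.Build ext ext_mul_continuous ext_inv_continuous.

End Extension.

Section GroupHom.
Local Open Scope group_scope.
Variables (G H : groupType) (f : G -> H).
Hypothesis fM : group_hom f.

Lemma group_hom1 : f 1 = 1.
Proof. by apply: (mulgI (f 1)); rewrite -fM !mulg1. Qed.

Lemma group_homV x : f x^-1 = (f x)^-1.
Proof. by apply: (mulgI (f x)); rewrite -fM !mulgV group_hom1. Qed.

Lemma group_homX x n : f (x ^+ n) = f x ^+ n.
Proof.
by elim: n => [|n IHn]; rewrite ?expg0 ?group_hom1// !expgS fM IHn.
Qed.

Lemma group_homJ x y : f (x ^ y) = f x ^ f y.
Proof. by rewrite !conjgE !fM group_homV. Qed.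

End GroupHom.

Lemma comp_loc_const_cluster (S T : topologicalType) (f : S -> T) p q :
  continuous f -> cluster (nbhs p) q -> cluster (nbhs (f p)) (f q).
Proof.
move=> fc pq A B /(fc p) Ap /(fc q) Bq.
by have [x [Ax Bx]] := pq _ _ Ap Bq; exists (f x).
Qed.

Lemma connected_component_map (S T : topologicalType) (f : S -> T) x y :
  continuous f -> connected_component setT x y ->
  connected_component setT (f x) (f y).
Proof.
move=> fc [C [Cx _ Cc] Cy]; exists (f @` C); last by exists y.
split=> //.
by apply: (connected_continuous_connected Cc); exact: continuous_subspaceT.
Qed.

Lemma pro_p_quotient (p : nat) (G : topGroupType) (U : set G) :
  pro_p p G -> open_normal U -> exists (K : finGroupType) (kap : G -> K) (k : nat),
    [/\ group_hom kap, (forall k, exists g, kap g = k),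
        (forall g, kap g = 1%g <-> U g) & #|K| = (p ^ k)%N].
Proof.
move=> [_ _ _ Gp] [UN Uo]; have [k Uk] := Gp U UN Uo.
by have [K [kap [? ? ? ?]]] := finite_quotient UN Uk; exists K, kap, k.
Qed.

Section ExtensionProP.
Local Open Scope group_scope.
Variables (p : nat) (G : topGroupType) (z : factor_set G).
Hypotheses (p_pr : prime p) (Gp : pro_p p G).
Local Notation M := (fs_mod z).
Hypothesis Mp : p_power_torsion p M.
Let E : topGroupType := ext z.

(** Since [z] need not be normalized, the shift by [z 1 1] is what makes this embedding of the
    module a homomorphism. *)
Let incl (a : M) : E := ext_pair (a - z 1%g 1%g)%R 1%g.

Let inclD a b : incl (a + b)%R = incl a * incl b.
Proof.
rewrite /incl -[RHS]/(ext_pair (a - z 1%g 1%g + gm_act 1%g (b - z 1%g 1%g) + z 1%g 1%g)%R (1 * 1)).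
by rewrite gm_act1 mulg1; congr ext_pair; zmod.
Qed.

Let incl0 : incl 0%R = 1.
Proof. by rewrite /incl sub0r. Qed.

Let inclMn a n : incl (a *+ n)%R = incl a ^+ n.
Proof. by elim: n => [|n IHn]; rewrite ?mulr0n ?incl0// mulrS inclD IHn expgS. Qed.

Let ext_grpM : group_hom (@ext_grp G z : E -> G).
Proof. by []. Qed.

Let inclE (x y : E) : ext_grp x = ext_grp y ->
  x = incl (ext_mod x - ext_mod y)%R * y.
Proof.
case: x y => a g [b h]; rewrite /ext_grp /= => <-.
rewrite -[RHS]/(ext_pair (a - b - z 1%g 1%g + gm_act 1%g b + z 1%g g)%R (1 * g)).
rewrite mul1g gm_act1 (cocycle2_1l (fs_cocycle z) g) /ext_pair; congr pair.
by zmod.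
Qed.

Lemma ext_compact : compact [set: E].
Proof.
have [Gc _ _ _] := Gp.
have Mc : compact [set: discrete_topology M].
  by apply: finite_compact; exact: (@finite_finset M).
have := compact_setX Mc Gc.
by congr compact; apply/seteqP; split.
Qed.

Lemma ext_hausdorff : hausdorff_space E.
Proof.
have [_ Gh _ _] := Gp => x y xy.
rewrite [x]surjective_pairing [y]surjective_pairing; congr pair.
  have h := @discrete_hausdorff (discrete_topology M).
  apply: h; apply: comp_loc_const_cluster xy => t; exact: cvg_fst.
by apply: Gh; apply: comp_loc_const_cluster xy => t; exact: cvg_snd.
Qed.

Lemma ext_totally_disconnected : totally_disconnected [set: E].
Proof.
have [_ _ Gt _] := Gp => x _; apply/seteqP; split=> [y xy|_ ->]; last first.
  exact: connected_component_refl.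
rewrite /= [x]surjective_pairing [y]surjective_pairing; congr pair.
  have Mt : totally_disconnected [set: discrete_topology M].
    by apply: zero_dimension_totally_disconnected; exact: discrete_zero_dimension.
  have : connected_component setT (x.1 : discrete_topology M) y.1.
    by apply: connected_component_map xy => t; exact: cvg_fst.
  by rewrite Mt.
have : connected_component setT x.2 y.2.
  by apply: connected_component_map xy => t; exact: cvg_snd.
by rewrite Gt.
Qed.

(** The image [V] of [U] in [G] is open of p-power index, so some [x ^+ (p ^ k)] differs from an
    element [y] of [U] by an element of the module, which the p-power torsion then kills. *)
Let ext_quotient (U : set E) : open_normal U ->
  forall x : E, exists k, U (x ^+ (p ^ k)).
Proof.
move=> Uo x; have [[U1 UM UV UJ] Uop] := Uo.
pose V : set G := [set g | exists2 a, U a & ext_grp a = g].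
have Vo : open_normal V.
  apply: (@nbhs_open_normal G V); first split.
  - by exists 1.
  - by move=> _ _ [a Ua <-] [b Ub <-]; exists (a * b); [exact: UM|].
  - by move=> _ [a Ua <-]; exists a^-1; [exact: UV|].
  - move=> _ g [a Ua <-]; exists (a ^ (ext_pair 0%R g : E)); first exact: UJ.
    exact: group_homJ.
  have := open_normal_nbhs Uo.
  case=> -[A B] /= [A1 B1] ABU; apply: filterS B1 => g Bg.
  exists (ext_pair (- z 1%g 1%g)%R g) => //; apply: ABU; split=> //=.
  exact: nbhs_singleton A1.
have [K [kap [k [kapM _ kapV Kk]]]] := pro_p_quotient Gp Vo.
have [y Uy yx] : V (ext_grp x ^+ (p ^ k)).
  apply/kapV; rewrite (group_homX kapM) -Kk -cardsT.
  by apply: (@expg_cardG K [set: K]%G); rewrite finset.in_setT.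
have [n Mn] := Mp.
have [m Um] := compact_has_index ext_compact Uo.
have [K' [kap' [kapM' _ kapU' _]]] := finite_quotient Uo.1 Um.
exists (k + n)%N; apply/kapU'; rewrite expnD expgnA.
rewrite (@inclE (x ^+ (p ^ k)) y); last by rewrite (group_homX ext_grpM) yx.
have /kapU' y1 := Uy.
by rewrite (group_homX kapM') kapM' y1 mulg1 -(group_homX kapM') -inclMn Mn incl0
  (group_hom1 kapM').
Qed.

(** A prime dividing the order of a finite quotient is, by Cauchy, the order of one of its elements;
    [ext_quotient] forces this prime to be [p]. *)
Lemma ext_pro_p : pro_p p E.
Proof.
split; [exact: ext_compact|exact: ext_hausdorff|exact: ext_totally_disconnected|].
move=> U UN Uo; have [m Um] := compact_has_index ext_compact (conj UN Uo).
have [K [kap [kapM kap_onto kapU Km]]] := finite_quotient UN Um.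
suff /p_natP[k Kk] : p.-nat #|K| by exists k; rewrite -Kk Km.
apply/pnatP => [|q q_pr]; first by rewrite -cardsT cardG_gt0.
rewrite -cardsT => /(Cauchy q_pr)[a _ aq].
have [x xa] := kap_onto a; have [k Ux] := ext_quotient (conj UN Uo) x.
have /eqP : a ^+ (p ^ k) = 1 by rewrite -xa -(group_homX kapM); exact/kapU.
rewrite -order_dvdn aq Euclid_dvdX// dvdn_prime2// => /andP[/eqP -> _].
by rewrite -topredE /= eqxx.
Qed.

End ExtensionProP.

Section Cochains12.
Variables (G : groupType) (M : gmodule G).
Local Open Scope ring_scope.

Definition cobd (u : G -> M) (g h : G) : M :=
  gm_act g (u h) - u (g * h)%g + u g.

Lemma cobd_cocycle u : cocycle2 (cobd u).
Proof.
move=> g h k; rewrite /cobd gm_actD gm_actB -gm_actM mulgA.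
by zmod.
Qed.

Lemma cobdB u v g h : cobd (fun x => u x - v x) g h = cobd u g h - cobd v g h.
Proof. by rewrite /cobd gm_actB; zmod. Qed.

End Cochains12.

Definition gm_pull (F G : groupType) (f : F -> G) (fM : group_hom f)
  (M : gmodule G) : gmodule F :=
  @GModule F M (fun g => gm_act (f g)) (fun g => gm_actD (f g))
    (fun a => eq_trans (congr1 (fun g => gm_act g a) (group_hom1 fM))
               (gm_act1 a))
    (fun g h a => eq_trans (congr1 (fun g => gm_act g a) (fM g h))
               (gm_actM (f g) (f h) a)).

Section FreeLift.
Variables (p d : nat) (F : topGroupType) (y : d.-tuple F).
Hypotheses (p_pr : prime p) (yF : free_pro_p p y).

(** A primitive of [z] amounts, up to sign, to a section of the extension by [z]. The universal
    property gives a homomorphism into the extension with chosen module parts on the generators; its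
    uniqueness for maps from [F] to itself shows that the group component is the identity. *)
Lemma free_lift (z : factor_set F) (a : 'I_d -> fs_mod z) :
  p_power_torsion p (fs_mod z) ->
  exists u : F -> fs_mod z, [/\ loc_const u,
    forall g h, cobd u g h = z g h & forall i, u (tnth y i) = a i].
Proof.
move=> Mp; have [Fp yP] := yF.
have [s [[sM sc sy] _]] := yP (ext z) [tuple ext_pair (- a i)%R (tnth y i) | i < d]
  (ext_pro_p p_pr Fp Mp).
have si i : s (tnth y i) = ext_pair (- a i)%R (tnth y i).
  by have := congr1 (fun t => tnth t i) sy; rewrite tnth_map tnth_mktuple.
have sG g : ext_grp (s g) = g.
  have [t [[_ _ _] tu]] := yP F y Fp.
  have e1 : t = (fun g => ext_grp (s g)).
    apply: tu; split; first by move=> g' h; rewrite sM.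
      by move=> x; apply: (continuous_comp (sc x)); exact: ext_grp_continuous.
    by apply: eq_from_tnth => i; rewrite tnth_map si.
  have eid : t = id.
    apply: tu; split=> //; first by move=> x; exact: cvg_id.
    by apply: eq_from_tnth => i; rewrite tnth_map.
  by have := congr1 (fun f => f g) e1; rewrite eid => <-.
exists (fun g => - ext_mod (s g))%R; split=> [|g h|i].
- by apply: loc_const1; exact: (loc_const_comp sc (@ext_mod_lc _ z)).
- rewrite /cobd sM gm_actN.
  rewrite -[ext_mod (s g * s h)%g]/(ext_mod (s g) + gm_act (ext_grp (s g))
    (ext_mod (s h)) + z (ext_grp (s g)) (ext_grp (s h)))%R !sG.
  by zmod.
- by rewrite si /= opprK.
Qed.

End FreeLift.

(** * Descent along a presentation *)

Definition loc_const_act (G : topGroupType) (M : gmodule G) : Prop :=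
  forall a : M, loc_const (fun g => gm_act g a).

Lemma trivial_on_loc_const (G : topGroupType) (M : gmodule G) (U : set G) :
  open_normal U -> trivial_on M U -> loc_const_act M.
Proof.
move=> Uo MU a; apply: (invariant_loc_const Uo) => g h Ugh.
exact: (trivial_on_congr _ MU).
Qed.

Section FreeUnique.
Variables (p d : nat) (F : topGroupType) (y : d.-tuple F) (M : gmodule F).
Hypotheses (p_pr : prime p) (yF : free_pro_p p y).
Hypotheses (Mp : p_power_torsion p M) (Mlc : loc_const_act M).

(** Both [g -> (u g, g)] and [g -> (0, g)] are continuous homomorphisms into the split extension,
    and they agree on the generators. *)
Lemma free_derivation_eq0 (u : F -> M) : loc_const u ->
  (forall g h, cobd u g h = 0%R) -> (forall i, u (tnth y i) = 0%R) ->
  forall g, u g = 0%R.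
Proof.
move=> uc du uy; have [Fp yP] := yF.
have z0 : cocycle2 (fun _ _ : F => 0%R : M) by move=> g h k; rewrite gm_act0.
have zc : loc_const (fun x : F * F => 0%R : M) by exact: loc_const_cst.
pose z := FactorSet z0 Mlc zc.
have [s [_ sP]] := yP (ext z) [tuple ext_pair (z := z) 0%R (tnth y i) | i < d]
  (ext_pro_p (z := z) p_pr Fp Mp).
have e1 : s = (fun g => ext_pair (z := z) (u g) g).
  apply: sP; split=> [g h||].
  - rewrite -[RHS]/(ext_pair (z := z) (u g + gm_act g (u h) + 0)%R (g * h)%g).
    congr ext_pair; have := du g h; rewrite /cobd => e.
    transitivity (u g + gm_act g (u h) - (gm_act g (u h) - u (g * h)%g + u g))%R.
      by zmod.
    by rewrite e; zmod.
  - by apply: ext_continuous; [exact: uc|move=> x; apply: cvg_id].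
  - by apply: eq_from_tnth => i; rewrite tnth_map tnth_mktuple uy.
have e2 : s = (fun g => ext_pair (z := z) 0%R g).
  apply: sP; split=> [g h||].
  - rewrite -[RHS]/(ext_pair (z := z) (0 + gm_act g 0 + 0)%R (g * h)%g).
    by rewrite gm_act0 !addr0.
  - apply: ext_continuous; [exact: loc_const_cst|by move=> x; exact: cvg_id].
  - by apply: eq_from_tnth => i; rewrite tnth_map tnth_mktuple.
by move=> g; have := congr1 (fun t => ext_mod (t g)) e1; rewrite e2 /= => <-.
Qed.

End FreeUnique.

Section Presentation.
Local Open Scope group_scope.
Variables (p d : nat) (G F : topGroupType) (y : d.-tuple F) (f : F -> G) (r : F).
Hypotheses (p_pr : prime p) (Gp : pro_p p G) (yF : free_pro_p p y).
Hypotheses (fM : group_hom f) (fc : continuous f) (f_onto : set_surj setT setT f).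
Hypothesis fker : f @^-1` [set 1] = closed_normal_closure r.

Lemma presentation_ind (S : set F) : normal_subgroup S -> closed S -> S r ->
  forall n, f n = 1 -> S n.
Proof.
move=> SN Sc Sr n fn; have : (f @^-1` [set 1]) n by [].
by rewrite fker => /(_ S); apply.
Qed.

Lemma presentation_relator : f r = 1.
Proof.
by suff : (f @^-1` [set 1]) r by []; rewrite fker => N [].
Qed.

Lemma presentation_kernel_closed : closed [set n | f n = 1].
Proof.
move/continuous_closedP: fc => /(_ [set 1]); apply.
have [_ Gh _ _] := Gp; apply: accessible_closed_set1.
exact: hausdorff_accessible.
Qed.

Lemma presentation_onto g : exists x, f x = g.
Proof. by have [x _ <-] := f_onto (I : setT g); exists x. Qed.

(** [f] maps a compact space to a Hausdorff one, so the image of the closed set where [u] takes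
    another value is closed; its complement is the required neighbourhood. *)
Lemma descend (A : Type) (u : F -> A) : loc_const u ->
  (forall n g, f n = 1 -> u (n * g) = u g) ->
  exists2 v : G -> A, loc_const v & forall g, v (f g) = u g.
Proof.
move=> uc uP; pose sec g := projT1 (cid (presentation_onto g)).
have secK g : f (sec g) = g by rewrite /sec; case: cid.
have vf g : u (sec (f g)) = u g.
  rewrite -[in LHS](mulgVK g (sec (f g))) uP// fM secK (group_homV fM).
  by rewrite mulgV.
exists (u \o sec) => //= b.
have [Fc _ _ _] := yF.1; have [_ Gh _ _] := Gp.
pose C := f @` [set g | u g <> u (sec b)].
have Cc : closed C.
  apply: compact_closed => //; apply: continuous_compact.
    by apply: continuous_subspaceT.
  apply: subclosed_compact Fc _ => //.
  exact: (@loc_const_closed _ _ u [set a | a <> u (sec b)]).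
have : nbhs b (~` C).
  apply: open_nbhs_nbhs; split; first exact: closed_openC.
  by move=> [g ug gb]; apply: ug; rewrite -gb vf.
apply: filterS => c Cc'; apply: contrapT => uc'; apply: Cc'.
by exists (sec c).
Qed.

Section Coefficients.
Variable M : gmodule G.
Hypothesis Mlc : loc_const_act M.
Local Notation fM' := (gm_pull fM M).

Lemma pull_loc_const_act : loc_const_act (gm_pull fM M).
Proof. by move=> a; exact: (loc_const_comp fc (Mlc a)). Qed.

Lemma pull_lift (z : G -> G -> M) (a : 'I_d -> M) :
  p_power_torsion p M -> cocycle2 z -> loc_const (fun x : G * G => z x.1 x.2) ->
  exists u : F -> gm_pull fM M, [/\ loc_const u,
    forall g h, cobd u g h = z (f g) (f h) & forall i, u (tnth y i) = a i].
Proof.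
move=> Mp zP zc.
have zP' : cocycle2 (fun g h => z (f g) (f h) : gm_pull fM M).
  by move=> g h k; rewrite /= !fM; exact: zP.
have c : continuous (fun x : F * F => (f x.1, f x.2)).
  apply: pair_continuous => x.
    by apply: continuous_comp; [exact: cvg_fst|exact: fc].
  by apply: continuous_comp; [exact: cvg_snd|exact: fc].
have zc' : loc_const (fun x : F * F => z (f x.1) (f x.2) : gm_pull fM M).
  exact: (loc_const_comp c zc).
exact: (@free_lift p d F y p_pr yF (FactorSet zP' pull_loc_const_act zc') a Mp).
Qed.

(* A cochain [u] with coboundary inflated from [G] is a homomorphism on the
   kernel, up to the constant [u 1]; so it descends as soon as [u r = u 1]. *)
Lemma descend_cochain (z : G -> G -> M) (u : F -> gm_pull fM M) :
  loc_const u -> (forall g h, cobd u g h = z (f g) (f h)) -> u r = u 1 ->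
  exists v : G -> M, [/\ loc_const v, forall g, v (f g) = u g &
    forall g h, cobd v g h = z g h].
Proof.
move=> uc du ur.
have z11 : z 1 1 = u 1.
  have := du 1 1; rewrite /cobd (group_hom1 fM) mulg1 gm_act1 => <-.
  by zmod.
have zP : cocycle2 z.
  move=> g h k; have [g' <-] := presentation_onto g.
  have [h' <-] := presentation_onto h; have [k' <-] := presentation_onto k.
  by rewrite -!fM -!du; exact: (cobd_cocycle u).
have un n g : f n = 1 -> u (n * g) = (u g + u n - u 1%g)%R.
  move=> fn; have := du n g; rewrite fn (cocycle2_1l zP) z11 => <-.
  by rewrite /cobd /= fn gm_act1; zmod.
have nu n g : f n = 1 -> u (g * n) = (u g + gm_act (f g) (u n - u 1%g))%R.
  move=> fn; have := du g n; rewrite fn (cocycle2_1r zP) z11 gm_actB => <-.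
  by rewrite /cobd /=; zmod.
pose S := [set n | f n = 1 /\ u n = u 1].
have Sn n : f n = 1 -> u n = u 1.
  move=> fn; suff [] : S n by []; apply: presentation_ind fn; first split.
  - by split=> //; exact: group_hom1.
  - move=> a b [fa ua] [fb ub]; split; first by rewrite fM fa fb mulg1.
    by rewrite un// ua ub addrK.
  - move=> a [fa ua]; split; first by rewrite (group_homV fM) fa invg1.
    by have := un a a^-1 fa; rewrite mulgV ua addrK.
  - move=> a g [fa ua]; split; first by rewrite (group_homJ fM) fa conj1g.
    have fag : f (a ^ g) = 1 by rewrite (group_homJ fM) fa conj1g.
    have := nu _ g fag; rewrite -conjgC un// ua addrK => /eqP.
    rewrite -subr_eq0 opprD addNKr oppr_eq0 => /eqP /(congr1 (gm_act (f g)^-1)).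
    by rewrite gm_actK gm_act0 => /eqP; rewrite subr_eq0 => /eqP.
  - apply: closedI; last exact: (@loc_const_closed _ _ u [set a | a = u 1]).
    exact: presentation_kernel_closed.
  - by split=> //; exact: presentation_relator.
have [v vc vf] := descend uc (fun n g fn => etrans (un n g fn)
  (etrans (congr1 (fun a => u g + a - u 1%g)%R (Sn n fn)) (addrK _ _))).
exists v; split=> // g h; have [g' <-] := presentation_onto g.
have [h' <-] := presentation_onto h.
by rewrite /cobd -fM !vf -du.
Qed.

End Coefficients.
End Presentation.

(** * Fox calculus on the relator and surjectivity of the trace *)

Section Derivations.
Local Open Scope ring_scope.
Variables (F : groupType) (B : gmodule F) (D : F -> B).
Hypothesis DM : forall g h, cobd D g h = 0.

Lemma derM g h : D (g * h)%g = D g + gm_act g (D h).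
Proof.
transitivity (D g + gm_act g (D h) - cobd D g h); last by rewrite DM subr0.
by rewrite /cobd; zmod.
Qed.

Lemma der1 : D 1%g = 0.
Proof. by apply: (addrI (D 1%g)); rewrite -{2}(gm_act1 (D 1%g)) -derM mulg1 addr0. Qed.

Lemma derV g : D g^-1%g = - gm_act g^-1%g (D g).
Proof.
by apply: (addrI (gm_act g^-1%g (D g))); rewrite subrr addrC -derM mulVg der1.
Qed.

Lemma derX g n : D (g ^+ n)%g = \sum_(i < n) gm_act (g ^+ i)%g (D g).
Proof.
elim: n => [|n IHn]; first by rewrite big_ord0 der1.
by rewrite big_ord_recr /= -IHn expgSr derM.
Qed.

Lemma derR g h : D [~ g, h]%g =
  gm_act (g^-1 * h^-1)%g (D g - gm_act h (D g) + (gm_act g (D h) - D h)).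
Proof.
rewrite commgEl conjgE !derM !derV !gm_actD !gm_actN !gm_actM.
by rewrite !gm_actK; zmod.
Qed.

Lemma der_prod_eq0 I (s : seq I) (P : pred I) (g : I -> F) :
  (forall i, P i -> D (g i) = 0) -> D (\prod_(i <- s | P i) g i)%g = 0.
Proof.
move=> gD; elim/big_ind: _ => //; first exact: der1.
by move=> x y Dx Dy; rewrite derM Dx Dy gm_act0 addr0.
Qed.

End Derivations.

Section NormSums.
Local Open Scope ring_scope.
Variables (G : groupType) (B : gmodule G).
Implicit Types (g : G) (a b v : B).

Definition norm_sum g n a : B := \sum_(i < n) gm_act (g ^+ i)%g a.

Lemma norm_sumS g n a : norm_sum g n.+1 a = a + gm_act g (norm_sum g n a).
Proof.
rewrite /norm_sum big_ord_recl expg0 gm_act1 gm_act_sum; congr (_ + _).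
by apply: eq_bigr => i _; rewrite -gm_actM -expgS.
Qed.

Lemma norm_sumSr g n a : norm_sum g n.+1 a = norm_sum g n a + gm_act (g ^+ n)%g a.
Proof. by rewrite /norm_sum big_ord_recr. Qed.

Lemma norm_sumD g m n a : norm_sum g (m + n) a =
  norm_sum g m a + gm_act (g ^+ m)%g (norm_sum g n a).
Proof.
elim: m => [|m IHm]; first by rewrite /norm_sum big_ord0 add0r expg0 gm_act1.
by rewrite addSn !norm_sumS IHm gm_actD expgS gm_actM addrA.
Qed.

Lemma norm_sum_fixed g n a : gm_act g a = a -> norm_sum g n a = a *+ n.
Proof.
move=> ga; elim: n => [|n IHn]; first by rewrite /norm_sum big_ord0.
by rewrite norm_sumS IHn gm_actMn ga mulrS.
Qed.

Lemma norm_sum_periodic g s n a : gm_act (g ^+ s)%g (norm_sum g s a) = norm_sum g s a ->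
  norm_sum g (n * s) a = norm_sum g s a *+ n.
Proof.
move=> gs; elim: n => [|n IHn]; first by rewrite mul0n /norm_sum big_ord0.
by rewrite mulSn norm_sumD IHn gm_actMn gs mulrS.
Qed.

Lemma norm_sum_is_additive g n a b :
  norm_sum g n (a - b) = norm_sum g n a - norm_sum g n b.
Proof.
rewrite /norm_sum -sumrN -big_split; apply: eq_bigr => i _.
by rewrite gm_actB.
Qed.

Lemma act_fixed_coprime g a m n : (0 < m)%N -> coprime m n ->
  gm_act (g ^+ m)%g a = a -> gm_act (g ^+ n)%g a = a -> gm_act g a = a.
Proof.
move=> m0 mn gm gn.
have fix_mul k s : gm_act (g ^+ s)%g a = a -> gm_act (g ^+ (k * s))%g a = a.
  move=> gs; elim: k => [|k IHk]; first by rewrite mul0n expg0 gm_act1.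
  by rewrite mulSn expgnDr gm_actM IHk gs.
have [km kn e _] := egcdnP n m0; move: e; rewrite (eqP mn) => e.
by rewrite -[RHS](fix_mul km _ gm) e addn1 expgS gm_actM fix_mul.
Qed.

(** In the group ring this is [N_n(X) = (X - 1) (N_0(X) + ... + N_(n-1)(X)) + n]. When [n]
    annihilates the module, the norm becomes a multiple of [X - 1]. *)
Lemma norm_sum_quotient g n a :
  norm_sum g n a = gm_act g (\sum_(i < n) norm_sum g i a)
    - \sum_(i < n) norm_sum g i a + a *+ n.
Proof.
elim: n => [|n IHn].
  by rewrite /norm_sum !big_ord0 gm_act0 subr0 addr0.
rewrite !big_ord_recr /= gm_actD norm_sumSr {1}IHn mulrSr.
have e : gm_act g (norm_sum g n a) + a = norm_sum g n a + gm_act (g ^+ n)%g a.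
  by rewrite addrC -norm_sumS norm_sumSr.
transitivity (gm_act g (\sum_(i < n) norm_sum g i a) - \sum_(i < n) norm_sum g i a
  + a *+ n + (norm_sum g n a + gm_act (g ^+ n)%g a) - norm_sum g n a).
  by zmod.
by rewrite -e; zmod.
Qed.

(* With [X = g] and [Y = h], [a] and [b] solve
   [N_q(X) a + X ^ q X^-1 Y^-1 ((1 - Y) a + (X - 1) b) = c], where
   [N_q(X) = 1 + X + ... + X ^ (q - 1)], as soon as [Y X X^-q c] is in the image
   of [1 - Y].  The operator [nu = X X^-q N_q(X)] is a multiple of [X - 1], and
   [1 - nu] is injective, hence surjective as [B] is finite. *)
Lemma relator_solve (p k q : nat) g h (c v : B) :
  prime p -> (p %| q)%N -> (forall a, a *+ p = 0) ->
  (forall a, gm_act (g ^+ (p ^ k))%g a = a) ->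
  v - gm_act h v = gm_act (h * g * g ^- q)%g c ->
  exists a b, norm_sum g q a + gm_act (g ^+ q * (g^-1 * h^-1))%g
    (a - gm_act h a + (gm_act g b - b)) = c.
Proof.
move=> p_pr pq pB gB vc.
have qB a : a *+ q = 0 by have /dvdnP[m ->] := pq; rewrite mulnC mulrnA pB mul0rn.
pose nu a := gm_act (g * g ^- q)%g (norm_sum g q a).
have nuB a b : nu (a - b) = nu a - nu b by rewrite /nu norm_sum_is_additive gm_actB.
(* Write [N] for [N_q(X)]. From [nu a = a] comes [X N a = X ^ q a], and then
   [a + X N a = N a + X ^ q a] gives [N a = a]. So [X ^ (q - 1) a = a] with [q - 1] prime to [p],
   while a p-power of [X] acts trivially; hence [X a = a] and [a = N a = q a = 0]. *)
have nu_inj a : nu a = a -> a = 0.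
  case: q @nu pq qB nuB {vc} => [|q] nu pq qB nuB nua.
    by rewrite -nua /nu /norm_sum big_ord0 gm_act0.
  have Xq : gm_act (g ^+ q.+1)%g a = gm_act g (norm_sum g q.+1 a).
    rewrite -[a in LHS]nua /nu -gm_actM; congr (gm_act _ _).
    by rewrite mulgA -expgSr expgS -mulgA mulgV mulg1.
  have Na : norm_sum g q.+1 a = a.
    have := norm_sumS g q.+1 a; rewrite norm_sumSr Xq => e.
    by apply: (addIr (gm_act g (norm_sum g q.+1 a))).
  have : gm_act (g ^+ q)%g a = a.
    by rewrite Na expgS gm_actM in Xq; exact: (can_inj (gm_actK g)).
  move=> gq; suff ga : gm_act g a = a by rewrite -Na norm_sum_fixed// qB.
  apply: (@act_fixed_coprime g a (p ^ k) q) => //; first by rewrite expn_gt0 prime_gt0.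
  apply: coprimeXl; rewrite prime_coprime//; apply: contraL pq => pq'.
  by rewrite -addn1 dvdn_addr// dvdn1 neq_ltn prime_gt1// orbT.
have [a aE] : exists a, a - nu a = v.
  have inj : injective (fun a => a - nu a).
    move=> a b /eqP; rewrite -subr_eq0 => /eqP e; apply/eqP; rewrite -subr_eq0.
    apply/eqP/nu_inj; rewrite nuB; apply/esym/eqP; rewrite -subr_eq0 -e; apply/eqP.
    by zmod.
  by exists (invF inj v); rewrite (f_invF inj).
pose mu : B := \sum_(i < q) norm_sum g i a.
(* This [b] satisfies [(X - 1) b = - nu a], because [N_q(X) a = (X - 1) mu] in a module killed by
   [q]. *)
exists a, (- gm_act (g * g ^- q)%g mu).
have gc : (g * (g * g ^- q) = g * g ^- q * g)%g.
  by rewrite -!mulgA; congr (g * _)%g; apply/commuteV/commuteX.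
have -> : gm_act g (- gm_act (g * g ^- q)%g mu) - - gm_act (g * g ^- q)%g mu = - nu a.
  rewrite gm_actN -gm_actM gc gm_actM opprK /nu norm_sum_quotient qB addr0 -/mu.
  by rewrite gm_actB; zmod.
have -> : a - gm_act h a - nu a = gm_act (h * g * g ^- q)%g c - gm_act h (nu a).
  by rewrite -vc -aE gm_actB; zmod.
have e : (g ^+ q * (g^-1 * h^-1) * (h * g * g ^- q) = 1)%g.
  by rewrite -!mulgA mulKg mulKg mulgV.
have e' : (g ^+ q * (g^-1 * h^-1) * h * (g * g ^- q) = 1)%g.
  by rewrite -e !mulgA.
by rewrite gm_actB -gm_actM e gm_act1 /nu -!gm_actM e' gm_act1; zmod.
Qed.

End NormSums.

HB.instance Definition _ (I : finType) (C : finZmodType) :=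
  GRing.Zmodule.on {ffun I -> C}.

Section FunctionModule.
Local Open Scope ring_scope.
Variables (G : groupType) (C : gmodule G) (I : finType) (sh : G -> I -> I).
Hypothesis sh1 : forall n, sh 1%g n = n.
Hypothesis shM : forall g h n, sh (g * h)%g n = sh h (sh g n).

Let act (g : G) (f : {ffun I -> C}) : {ffun I -> C} :=
  [ffun n => gm_act g (f (sh g n))].

Let actD g : {morph act g : a b / a + b}.
Proof. by move=> a b; apply/ffunP => n; rewrite !ffunE gm_actD. Qed.

Let act1 a : act 1%g a = a.
Proof. by apply/ffunP => n; rewrite !ffunE sh1 gm_act1. Qed.

Let actM g h a : act (g * h)%g a = act g (act h a).
Proof. by apply/ffunP => n; rewrite !ffunE gm_actM shM. Qed.

(** [sh g] stands for translation by the inverse of [g], hence the order of the factors in [shM].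
    Functions on a cyclic quotient and coinduced modules are both instances. *)
Definition gm_maps : gmodule G := @GModule G {ffun I -> C} act actD act1 actM.

Definition gm_const (c : C) : gm_maps := [ffun=> c] : {ffun I -> C}.

Lemma gm_mapsE g (f : gm_maps) n :
  (gm_act g f : {ffun I -> C}) n = gm_act g ((f : {ffun I -> C}) (sh g n)).
Proof. by rewrite ffunE. Qed.

Lemma gm_act_const g c : gm_act g (gm_const c) = gm_const (gm_act g c).
Proof. by apply/ffunP => n; rewrite !ffunE. Qed.

Lemma gm_const_inj : I -> injective gm_const.
Proof. by move=> i c c' /ffunP/(_ i); rewrite !ffunE. Qed.

Lemma gm_constB : {morph gm_const : a b / a - b}.
Proof. by move=> a b; apply/ffunP => n; rewrite !ffunE. Qed.

End FunctionModule.

Section CyclicFunctions.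
Local Open Scope ring_scope.
Variables (G : groupType) (C : gmodule G) (I : finZmodType) (theta : G -> I).
Hypothesis thetaM : forall g h, theta (g * h)%g = theta g + theta h.

Let sh1 n : n - theta 1%g = n.
Proof.
suff -> : theta 1%g = 0 by rewrite subr0.
by apply: (addrI (theta 1%g)); rewrite -thetaM mulg1 addr0.
Qed.

Let shM g h n : n - theta (g * h)%g = n - theta g - theta h.
Proof. by rewrite thetaM opprD addrA. Qed.

Definition gm_funs : gmodule G :=
  @gm_maps G C I (fun g n => n - theta g) sh1 shM.

Definition gm_funs_const (c : C) : gm_funs :=
  @gm_const G C I (fun g n => n - theta g) sh1 shM c.

Lemma gm_funsE g (f : gm_funs) n :
  (gm_act g f : {ffun I -> C}) n = gm_act g ((f : {ffun I -> C}) (n - theta g)).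
Proof. by rewrite ffunE. Qed.

Lemma gm_act_funs_const g c :
  gm_act g (gm_funs_const c) = gm_funs_const (gm_act g c).
Proof. exact: gm_act_const. Qed.

End CyclicFunctions.

Lemma Zp_val_N1 N : (1 < N)%N -> (0 - 1 : 'Z_N)%R = N.-1 :> nat.
Proof. by case: N => [|[|N]]//= _; rewrite !modn_small// subn1. Qed.

Lemma Zp_val_pred N (n : 'Z_N) : (1 < N)%N -> n != 0%R ->
  n = (n - 1)%R.+1 :> nat.
Proof.
case: N n => [|[|N]]// n _ n0; set m := (n - 1)%R.
have nE : n = (m + 1)%R by rewrite subrK.
have mE : nat_of_ord (m + 1)%R = ((m + 1 %% N.+2) %% N.+2)%N by [].
have m1 : (m.+1 < N.+2)%N.
  rewrite ltn_neqAle ltn_ord andbT; apply: contra n0 => /eqP e.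
  by rewrite nE; apply/eqP/val_inj; rewrite /= (modn_small (m := 1))// addn1 e modnn.
by rewrite {1}nE mE (modn_small (m := 1))// addn1 modn_small.
Qed.

(** The equation reads [v n - h (v (n - 1)) = c] and is solved by the partial norms
    [v n = N_n(h) c]. Going once around the cycle requires the norm of length [p ^ k.+1] to vanish:
    it is [p] times the norm of length [p ^ k], as [h ^+ (p ^ k)] acts trivially. This is why the
    modulus has one more factor [p]. *)
Lemma cyclic_functions_solve (G : groupType) (C : gmodule G) (p k : nat)
    (theta : G -> 'Z_(p ^ k.+1)) (thetaM : forall g h, theta (g * h)%g = (theta g + theta h)%R)
    (h : G) (c : C) :
  prime p -> (forall a : C, a *+ p = 0)%R ->
  (forall a : C, gm_act (h ^+ (p ^ k))%g a = a) -> theta h = 1%R ->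
  exists v : gm_funs C thetaM, (v - gm_act h v = gm_funs_const thetaM c)%R.
Proof.
move=> p_pr pC hC th; have N1 : (1 < p ^ k.+1)%N.
  by rewrite -(exp1n k.+1) ltn_exp2r// prime_gt1.
exists ([ffun n : 'Z_(p ^ k.+1) => norm_sum h n c] : {ffun _ -> _}).
apply/ffunP => n; rewrite !ffunE th.
have [->|n0] := eqVneq n 0%R.
  rewrite {1}/norm_sum big_ord0 sub0r.
  have e : norm_sum h (p ^ k.+1) c = 0%R.
    by rewrite expnS norm_sum_periodic ?pC.
  rewrite Zp_val_N1//.
  rewrite -[c in RHS](addrK (gm_act h (norm_sum h (p ^ k.+1).-1 c))) -norm_sumS.
  by rewrite prednK ?(ltnW N1)// e sub0r.
rewrite {1}(Zp_val_pred N1 n0).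
by rewrite norm_sumS addrK.
Qed.

Section TrivialModule.
Variables (G : groupType) (A : finZmodType).

Definition gm_triv : gmodule G :=
  @GModule G A (fun _ a => a) (fun _ _ _ => erefl) (fun _ => erefl)
    (fun _ _ _ => erefl).

End TrivialModule.

Lemma Zp_torsion N (a : 'Z_N) : (1 < N)%N -> (a *+ N = 0)%R.
Proof. by move=> N1; rewrite -mulr_natr pchar_Zp// mulr0. Qed.

Section Surjectivity.
Local Open Scope ring_scope.
Variables (p q d : nat) (G F : topGroupType) (y : d.-tuple F) (f : F -> G).
Hypotheses (p_pr : prime p) (Gp : pro_p p G) (yF : free_pro_p p y).
Hypotheses (fM : group_hom f) (fc : continuous f) (f_onto : set_surj setT setT f).
Hypothesis fker : f @^-1` [set 1%g] = closed_normal_closure (demushkin_word q y).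
Hypotheses (d_ge2 : (2 <= d)%N) (pq : (p %| q)%N).
Local Notation r := (demushkin_word q y).

Let i0 : 'I_d := Ordinal (ltnW d_ge2).
Let i1 : 'I_d := Ordinal d_ge2.

(** The coefficients are the Fox derivatives of [r] in the first two generators; the other
    commutators contribute nothing when [D] vanishes on their entries. *)
Lemma demushkin_der (B : gmodule F) (D : F -> B) :
  (forall g h, cobd D g h = 0) ->
  (forall i : 'I_d, (2 <= i)%N -> D (tnth y i) = 0) ->
  D r = norm_sum (tnth y i0) q (D (tnth y i0))
    + gm_act (tnth y i0 ^+ q * ((tnth y i0)^-1 * (tnth y i1)^-1))%g
        (D (tnth y i0) - gm_act (tnth y i1) (D (tnth y i0))
         + (gm_act (tnth y i0) (D (tnth y i1)) - D (tnth y i1))).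
Proof.
move=> DM D0.
have Dk k : (2 <= k)%N -> D (nth 1%g y k) = 0.
  move=> k2; have [kd|dk] := ltnP k d.
    by rewrite -(tnth_nth 1%g y (Ordinal kd)) D0.
  by rewrite nth_default ?size_tuple// (der1 DM).
have [m dm] : exists m, d./2 = m.+1.
  by exists (d./2).-1; rewrite prednK// half_gt0.
rewrite /demushkin_word dm big_ord_recl !(tnth_nth 1%g) /=.
rewrite (derM DM (_ ^+ q)%g) (derM DM [~ _, _]%g) (der_prod_eq0 DM) => [|i _]; last first.
  rewrite (derR DM) !Dk ?gm_act0 ?subrr ?addr0 ?gm_act0//;
  by rewrite /bump /= ?doubleS.
by rewrite gm_act0 addr0 (derX DM) (derR DM) -gm_actM.
Qed.

(** The character is 1 on [x_1] and 0 on the other generators. As it vanishes on [x_0], the factor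
    [x_0 ^ q] contributes nothing, and the relator is respected for every modulus [p ^ k.+1],
    whatever power of [p] divides [q]. *)
Lemma cyclic_character k : exists theta : G -> 'Z_(p ^ k.+1),
  [/\ loc_const theta, forall g h, theta (g * h)%g = theta g + theta h &
      theta (f (tnth y i1)) = 1].
Proof.
have N1 : (1 < p ^ k.+1)%N by rewrite -(exp1n k.+1) ltn_exp2r// prime_gt1.
pose M := gm_triv G 'Z_(p ^ k.+1).
have Mlc : loc_const_act M by move=> a; exact: loc_const_cst.
have Mp : p_power_torsion p M.
  by exists k.+1 => a; exact: Zp_torsion.
have z0 : cocycle2 (fun _ _ : G => 0 : M) by move=> g h l; rewrite addr0.
have [u [uc du uy]] := pull_lift p_pr yF fM fc Mlc (fun i => (i == i1)%:R : M) Mp z0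
  (@loc_const_cst (G * G)%type M 0).
have ur : u r = u 1%g.
  rewrite (demushkin_der du) => [|i i2]; last first.
    by rewrite uy; case: eqP => // e; move: i2; rewrite e.
  rewrite (der1 du) (uy i0) (uy i1) eqxx (_ : (i0 == i1) = false)//.
  rewrite norm_sum_fixed// mul0rn add0r /= subrr add0r.
  exact: subrr.
have [v [vc vf dv]] := descend_cochain (z := fun _ _ => 0) Gp yF fc f_onto fker uc du ur.
exists v; split=> // [g h|]; first by rewrite (derM dv).
by rewrite vf uy eqxx.
Qed.

(* [u] is the value at [0] of a derivation into the functions on a cyclic
   quotient of [G] that sends [r] to a constant function. *)
Lemma trace_onto (C : gmodule G) (U : set G) (c : C) :
  (forall a : C, a *+ p = 0) -> open_normal U -> trivial_on C U ->
  exists (z : G -> G -> C) (u : F -> gm_pull fM C),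
    [/\ cocycle2 z, loc_const (fun x : G * G => z x.1 x.2), loc_const u,
        forall g h, cobd u g h = z (f g) (f h) & u 1%g = 0 /\ u r = c].
Proof.
move=> pC Uo CU; have Clc := trivial_on_loc_const Uo CU.
have [K [kap [k [kapM _ kapU Kk]]]] := pro_p_quotient Gp Uo.
have Cpow g (a : C) : gm_act (g ^+ (p ^ k))%g a = a.
  apply: CU; apply/kapU; rewrite (group_homX kapM) -Kk -cardsT.
  by apply: (@expg_cardG K [set: K]%G); rewrite finset.in_setT.
have [theta [thc thM th1]] := cyclic_character k.
pose B := gm_funs C thM.
have pB (b : B) : b *+ p = 0.
  by apply/ffunP => n; rewrite ffunMnE pC ffunE.
have Blc : loc_const_act B.
  move=> b g.
  have Cg := @filter_forall G C (fun a h => gm_act h a = gm_act g a)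
    (nbhs g) (nbhs_filter g) (fun a => Clc a g).
  apply: filterS2 (thc g) Cg => h e1 e2.
  by apply/ffunP => n; rewrite !gm_funsE e1 e2.
have B0 : cocycle2 (fun _ _ : G => 0 : B) by move=> g h l; rewrite gm_act0 addr0.
have B1 : p_power_torsion p B by exists 1%N => b; rewrite expn1.
pose h0 := f (tnth y i0); pose h1 := f (tnth y i1).
have [v vE] : exists v : B, v - gm_act h1 v
    = gm_funs_const thM (gm_act (h1 * h0 * h0 ^- q)%g c).
  exact: cyclic_functions_solve.
have [a [b ab]] : exists a b : B, norm_sum h0 q a
    + gm_act (h0 ^+ q * (h0^-1 * h1^-1))%g
       (a - gm_act h1 a + (gm_act h0 b - b)) = gm_funs_const thM c.
  (* The power [p ^ k] of [h0] acts trivially on [C], and the further power [p ^ k.+1] kills its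
     translation by [theta]. *)
  apply: (@relator_solve G B p (k + k.+1) q h0 h1 _ v) => // [b|]; last first.
    by rewrite vE -gm_act_funs_const.
  apply/ffunP => n; rewrite gm_funsE expnD expgnA.
  have -> : gm_act (h0 ^+ (p ^ k) ^+ (p ^ k.+1))%g = (fun a : C => a).
    apply/funext => e; elim: (p ^ k.+1)%N => [|j IHj]; first by rewrite expg0 gm_act1.
    by rewrite expgSr gm_actM Cpow.
  congr (b _); set x := (h0 ^+ (p ^ k))%g.
  have thX j : theta (x ^+ j)%g = theta x *+ j.
    elim: j => [|j IHj]; last by rewrite expgS thM IHj mulrS.
    by rewrite expg0 mulr0n; apply: (addrI (theta 1%g)); rewrite -thM mulg1 addr0.
  by rewrite thX Zp_torsion ?subr0// -(exp1n k.+1) ltn_exp2r// prime_gt1.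
have [D [Dc dD Dy]] := pull_lift p_pr yF fM fc Blc
  (fun i => if i == i0 then a else if i == i1 then b else 0) B1 B0
  (@loc_const_cst (G * G)%type B 0).
have Dr : D r = gm_funs_const thM c.
  rewrite (demushkin_der dD) => [|i i2]; last first.
    by rewrite Dy; case: eqP => [e|_]; [|case: eqP => // e]; move: i2; rewrite e.
  rewrite (Dy i0) (Dy i1) eqxx (_ : (i1 == i0) = false)// eqxx -ab.
  by rewrite /norm_sum /= !fM !(group_homV fM) (group_homX fM); congr (_ + _);
    apply: eq_bigr => j _; rewrite (group_homX fM).
have actF (g : F) (b' : B) : @gm_act _ (gm_pull fM B) g b' = gm_act (f g) b' by [].
(* The kernel of [f] acts trivially and the constants are stable under [G], so having a constant
   value of [D] defines a closed normal subgroup inside the kernel; it contains [r]. *)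
have Dker n : f n = 1%g -> exists c', D n = gm_funs_const thM c'.
  pose S := [set n | f n = 1%g /\ exists c', D n = gm_funs_const thM c'].
  move=> fn; suff [] : S n by [].
  apply: (presentation_ind fker) fn; first split.
  - split; first exact: group_hom1.
    by exists 0; rewrite (der1 dD); apply/ffunP => n'; rewrite !ffunE.
  - move=> g h [fg [cg Dg]] [fh [ch Dh]]; split; first by rewrite fM fg fh mulg1.
    exists (cg + ch); rewrite (derM dD) Dg Dh actF fg gm_act1.
    by apply/ffunP => n'; rewrite !ffunE.
  - move=> g [fg [cg Dg]]; split; first by rewrite (group_homV fM) fg invg1.
    exists (- cg); rewrite (derV dD) Dg actF (group_homV fM) fg invg1 gm_act1.
    by apply/ffunP => n'; rewrite !ffunE.
  - move=> g h [fg [cg Dg]]; split; first by rewrite (group_homJ fM) fg conj1g.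
    exists (gm_act (f h)^-1%g cg); rewrite conjgE !(derM dD) (derV dD) Dg.
    rewrite gm_actD !actF fg gm_act1 (group_homV fM) gm_act_funs_const addrCA.
    by rewrite addNr addr0.
  - apply: closedI; first exact: (presentation_kernel_closed Gp fc).
    exact: (@loc_const_closed _ _ D [set b | exists c', b = gm_funs_const thM c']).
  - split; first exact: (presentation_relator fker).
    by exists c.
pose ev (b : B) (n : 'Z_(p ^ k.+1)) : C := (b : {ffun _ -> _}) n.
pose u (g : F) : gm_pull fM C := ev (D g) 0.
have uc : loc_const u by exact: (loc_const1 (fun b => ev b 0) Dc).
(* Differences with the value at 0 do not see constants, so they descend to [w] on [G]. Since [g]
   translates by [theta g], the value of [w] at [- theta g] computes [cobd u]. *)
pose dif (b : B) (n : 'Z_(p ^ k.+1)) : C := ev b n - ev b 0.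
have difn n g : f n = 1%g -> dif (D (n * g)%g) = dif (D g).
  move=> fn; have [c' Dn] := Dker n fn.
  rewrite (derM dD) actF fn gm_act1 Dn; apply/funext => m.
  by rewrite /dif /ev !ffunE; zmod.
have [w wc wf] := descend Gp yF fM fc f_onto (loc_const1 dif Dc) difn.
have uz g h : cobd u g h = gm_act (f g) (- w (f h) (- theta (f g))).
  rewrite wf /cobd /u (derM dD) actF /dif /ev ffunE gm_funsE sub0r /= gm_actN gm_actB.
  by zmod.
exists (fun g h => gm_act g (- w h (- theta g))), u; split=> //.
- move=> g h l; have [g' <-] := presentation_onto f_onto g.
  have [h' <-] := presentation_onto f_onto h.
  have [l' <-] := presentation_onto f_onto l.
  by rewrite -!fM -!uz; exact: (cobd_cocycle u).
- have c1 : continuous (fun x : G * G => x.1) by move=> x; exact: cvg_fst.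
  have c2 : continuous (fun x : G * G => x.2) by move=> x; exact: cvg_snd.
  have l1 := loc_const_comp c1 thc; have l2 := loc_const_comp c2 wc.
  move=> x; have l3 := loc_const_comp c1 (Clc (- w x.2 (- theta x.1))) x.
  near=> x'.
  have e1 : theta x'.1 = theta x.1 by near: x'; exact: l1.
  have e2 : w x'.2 = w x.2 by near: x'; exact: l2.
  by rewrite e1 e2; near: x'; exact: l3.
- split; first by rewrite /u (der1 dD) /ev ffunE.
  by rewrite /u Dr /ev ffunE.
Unshelve. all: by end_near.
Qed.

End Surjectivity.

(** * Vanishing of cohomology in degrees at least three *)

Section InhomogeneousDifferential.
Local Open Scope ring_scope.
Variable G : groupType.

(* The terms of the differential of [f] other than the first one, which
   involves the action: on a word [g_1 ... g_(n+1)] it is the sum of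
   [(-1)^i f(... g_i g_(i+1) ...)] and of [(-1)^(n+1) f(g_1 ... g_n)]. *)
Fixpoint delta_tail (A : zmodType) (f : seq G -> A) (s : seq G) : A :=
  match s with
  | [::] => 0
  | x :: s' =>
      match s' with
      | [::] => - f [::]
      | y :: s'' => - f ((x * y)%g :: s'') - delta_tail (fun t => f (x :: t)) s'
      end
  end.

Definition tw_delta (M : gmodule G) (f : seq G -> M) (s : seq G) : M :=
  if s is x :: s' then gm_act x (f s') + delta_tail f s else 0.

Lemma delta_tail_cons (A : zmodType) (f : seq G -> A) x y s :
  delta_tail f (x :: y :: s) =
  - f ((x * y)%g :: s) - delta_tail (fun t => f (x :: t)) (y :: s).
Proof. by []. Qed.

Lemma eq_delta_tail (A : zmodType) (f g : seq G -> A) s :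
  (forall t, size t = (size s).-1 -> f t = g t) -> delta_tail f s = delta_tail g s.
Proof.
elim: s f g => [//|x s IHs] f g fg; case: s IHs fg => [_ fg|y s IHs fg]; first by rewrite /= fg.
rewrite !delta_tail_cons fg//; congr (_ - _).
by apply: IHs => t ts; apply: fg; rewrite /= ts.
Qed.

Lemma delta_tail_map (A B : zmodType) (phi : A -> B) (f : seq G -> A) s :
  {morph phi : a b / a - b} -> phi (delta_tail f s) = delta_tail (phi \o f) s.
Proof.
move=> phiB; have phi0 : phi 0 = 0 by rewrite -[0 in LHS](subrr 0) phiB subrr.
have phiN a : phi (- a) = - phi a by rewrite -[- a]sub0r phiB phi0 sub0r.
elim: s f => [//|x s IHs] f; case: s IHs => [_|y s IHs]; first exact: phiN.
by rewrite !delta_tail_cons phiB phiN IHs.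
Qed.

Lemma delta_tailB (A : zmodType) (f g : seq G -> A) s :
  delta_tail (fun t => f t - g t) s = delta_tail f s - delta_tail g s.
Proof.
elim: s f g => [|x s IHs] f g; first by rewrite subrr.
case: s IHs => [_|y s IHs]; first by rewrite /=; zmod.
by rewrite !delta_tail_cons IHs; zmod.
Qed.

(** The pairwise cancellations in the squared differential happen here; the surviving term cancels,
    in [tw_delta_delta], against the merge of the first two letters. *)
Lemma delta_tail_tail (A : zmodType) (f : seq G -> A) x y s :
  delta_tail (fun t => delta_tail f (x :: t)) (y :: s) =
  - delta_tail f ((x * y)%g :: s).
Proof.
elim: s f x y => [|z s IHs] f x y; first by [].
rewrite !delta_tail_cons (_ : (fun t => - _ - _) = fun t =>
  (fun t => - f ((x * y)%g :: t)) t - (fun t => delta_tail (fun t => f (x :: t)) (y :: t)) t)//.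
rewrite delta_tailB IHs.
rewrite -(@delta_tail_map _ _ -%R (fun t => f ((x * y)%g :: t))); last first.
  by move=> a b; zmod.
by rewrite !mulgA; zmod.
Qed.

Lemma tw_delta_delta (M : gmodule G) (f : seq G -> M) s :
  tw_delta (tw_delta f) s = 0.
Proof.
case: s => [//|x [|y s]]; first by rewrite /= gm_act0; zmod.
rewrite {1}/tw_delta delta_tail_cons.
rewrite (_ : (fun t => tw_delta f (x :: t)) =
  fun t => gm_act x (f t) - - delta_tail f (x :: t)); last first.
  by apply/funext => t; rewrite opprK.
rewrite delta_tailB -(@delta_tail_map _ _ -%R) ?delta_tail_tail; last first.
  by move=> a b; zmod.
rewrite -(@delta_tail_map _ _ (gm_act x)); last exact: gm_actB.
by rewrite /tw_delta gm_actD gm_actM; zmod.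
Qed.

Lemma tw_deltaB (M : gmodule G) (f g : seq G -> M) s :
  tw_delta (fun t => f t - g t) s = tw_delta f s - tw_delta g s.
Proof.
case: s => [|x s]; first by rewrite subrr.
by rewrite /tw_delta delta_tailB gm_actB; zmod.
Qed.

Lemma eq_tw_delta (M : gmodule G) (f g : seq G -> M) s :
  (forall t, (size t).+1 = size s -> f t = g t) -> tw_delta f s = tw_delta g s.
Proof.
case: s => [//|x s] fg; rewrite /tw_delta fg//; congr (_ + _).
by apply: eq_delta_tail => t ts; apply: fg; rewrite ts.
Qed.

Lemma tw_delta_map (M N : gmodule G) (phi : M -> N) (f : seq G -> M) s :
  {morph phi : a b / a - b} ->
  (forall g a, phi (gm_act g a) = gm_act g (phi a)) ->
  phi (tw_delta f s) = tw_delta (phi \o f) s.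
Proof.
move=> phiB phiM; have phi0 : phi 0 = 0 by rewrite -[0 in LHS](subrr 0) phiB subrr.
have phiD a b : phi (a + b) = phi a + phi b.
  rewrite -[b in LHS]opprK phiB; congr (_ + _); apply/eqP.
  by rewrite -[- b]sub0r phiB phi0 sub0r opprK.
case: s => [//|x s]; rewrite /tw_delta phiD phiM; congr (_ + _).
exact: delta_tail_map.
Qed.

(** The recursive form of [congr_mod], suited to induction on words. An [invariant] cochain is one
    that factors through the quotient by [U]. *)
Fixpoint cong (U : set G) (s t : seq G) : Prop :=
  match s, t with
  | [::], [::] => True
  | x :: s', y :: t' => U (x^-1 * y)%g /\ cong U s' t'
  | _, _ => False
  end.

Definition invariant (U : set G) (A : Type) (f : seq G -> A) : Prop :=
  forall s t, cong U s t -> f s = f t.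

Lemma congS (U V : set G) s t : U `<=` V -> cong U s t -> cong V s t.
Proof.
move=> UV; elim: s t => [|x s IHs] [|y t]//= [Uxy st].
by split; [exact: UV|exact: IHs].
Qed.

Lemma cong_size U s t : cong U s t -> size s = size t.
Proof. by elim: s t => [|x s IHs] [|y t]//= [_ /IHs ->]. Qed.

Lemma invariant_tw_delta (M : gmodule G) (U : set G) (f : seq G -> M) :
  normal_subgroup U -> trivial_on M U -> invariant U f -> invariant U (tw_delta f).
Proof.
move=> [U1 UM UV UJ] MU fU.
have H (h k : seq G -> M) s t : (forall a b, cong U a b -> h a = k b) ->
    cong U s t -> delta_tail h s = delta_tail k t.
  elim: s t h k => [|x s IHs] [|y t]//= h k hk [Uxy st].
  case: s t st IHs => [|x' s] [|y' t]//= st IHs; first by rewrite (hk [::] [::]).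
  have [Uxy' st'] := st; congr (_ - _).
    congr (- _); apply: hk; split=> //.
    (* [(x x')^-1 (y y')] is the conjugate of [x^-1 y] by [x'] times [x'^-1 y']. *)
    have := UM _ _ (UJ _ x' Uxy) Uxy'.
    by rewrite conjgE invgM !mulgA mulgK.
  exact: (IHs (y' :: t) _ _ (fun a b ab => hk (x :: a) (y :: b) (conj Uxy ab)) st).
case=> [|x s] [|y t] // xyst; have [Uxy st] := xyst.
rewrite /tw_delta; congr (_ + _); last by apply: H xyst.
by rewrite (fU s t)//; exact: (trivial_on_congr _ MU).
Qed.

End InhomogeneousDifferential.

Section PointedFunctions.
Variables (I : finType) (i0 : I) (A : finZmodType).
Local Open Scope ring_scope.

(** The functions vanishing at [i0] form a complement of the constants and so model the quotient by
    them; [pf_proj] is the quotient map. *)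
Record pointed_fun := PointedFun {
  pf_val :> {ffun I -> A}; pf_valP : pf_val i0 == 0 }.

Definition pointed_pred : {pred {ffun I -> A}} := fun f => f i0 == 0.

Lemma pointed_zmod_closed : zmod_closed pointed_pred.
Proof.
split=> [|f g /eqP f0 /eqP g0]; apply/eqP; first by rewrite ffunE.
by rewrite !ffunE f0 g0 subr0.
Qed.
HB.instance Definition _ :=
  GRing.isZmodClosed.Build {ffun I -> A} pointed_pred pointed_zmod_closed.
HB.instance Definition _ := [isSub for pf_val].
HB.instance Definition _ := [Finite of pointed_fun by <:].
HB.instance Definition _ :=
  GRing.SubChoice_isSubZmodule.Build {ffun I -> A} pointed_pred pointed_fun
    pointed_zmod_closed.

Lemma pf_proj_subproof (f : {ffun I -> A}) : [ffun n => f n - f i0] i0 == 0.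
Proof. by rewrite ffunE subrr. Qed.

Definition pf_proj (f : {ffun I -> A}) : pointed_fun := PointedFun (pf_proj_subproof f).

Lemma pf_projK (f : pointed_fun) : pf_proj f = f.
Proof.
by apply: val_inj; apply/ffunP => n; rewrite ffunE (eqP (pf_valP f)) subr0.
Qed.

Lemma pf_projD : {morph pf_proj : f g / f + g}.
Proof.
by move=> f g; apply: val_inj; apply/ffunP => n; rewrite !ffunE; zmod.
Qed.

Lemma pf_projB : {morph pf_proj : f g / f - g}.
Proof.
by move=> f g; apply: val_inj; apply/ffunP => n; rewrite !ffunE; zmod.
Qed.

Lemma pf_proj_eq0 f : pf_proj f = 0 -> forall n, f n = f i0.
Proof.
move=> /(congr1 val)/ffunP f0 n; have := f0 n; rewrite !ffunE => /eqP.
by rewrite subr_eq0 => /eqP.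
Qed.

End PointedFunctions.

Section QuotientByConstants.
Local Open Scope ring_scope.
Variables (G : groupType) (C : gmodule G) (I : finType) (sh : G -> I -> I).
Hypothesis sh1 : forall n, sh 1%g n = n.
Hypothesis shM : forall g h n, sh (g * h)%g n = sh h (sh g n).
Variable i0 : I.
Local Notation M := (gm_maps C sh1 shM).

Let act (g : G) (f : pointed_fun i0 C) : pointed_fun i0 C :=
  pf_proj i0 (gm_act g ((f : {ffun I -> C}) : M)).

Let pf_proj_act (g : G) (f : M) :
  pf_proj i0 (gm_act g f : M) = act g (pf_proj i0 f).
Proof.
apply: val_inj; apply/ffunP => n; rewrite !ffunE !gm_actB.
by zmod.
Qed.

Let actD g : {morph act g : a b / a + b}.
Proof.
move=> a b; rewrite /act -pf_projD; congr pf_proj.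
exact: (gm_actD g ((a : {ffun I -> C}) : M)).
Qed.

Let act1 a : act 1%g a = a.
Proof. by rewrite /act gm_act1 pf_projK. Qed.

Let actM g h a : act (g * h)%g a = act g (act h a).
Proof. by rewrite {1}/act gm_actM pf_proj_act. Qed.

Definition gm_quot : gmodule G := @GModule G (pointed_fun i0 C) act actD act1 actM.

Lemma gm_quot_act g (f : M) :
  gm_act g (pf_proj i0 f : gm_quot) = pf_proj i0 (gm_act g f : M).
Proof. exact/esym/pf_proj_act. Qed.

End QuotientByConstants.

Section DimensionShift.
Local Open Scope ring_scope.
Variables (G : groupType) (A : gmodule G) (U : set G) (K : finGroupType) (kap : G -> K).
Hypotheses (UN : normal_subgroup U) (AU : trivial_on A U).
Hypotheses (kapM : group_hom kap) (kap_onto : forall k, exists g, kap g = k).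
Hypothesis kapU : forall g, kap g = 1%g <-> U g.

Definition quotient_shift (g : G) (k : K) : K := ((kap g)^-1 * k)%g.

Lemma quotient_shift1 k : quotient_shift 1%g k = k.
Proof. by rewrite /quotient_shift (group_hom1 kapM) invg1 mul1g. Qed.

Lemma quotient_shiftM g h k :
  quotient_shift (g * h)%g k = quotient_shift h (quotient_shift g k).
Proof. by rewrite /quotient_shift kapM invgM mulgA. Qed.

Definition coinduced : gmodule G := gm_maps A quotient_shift1 quotient_shiftM.
Definition coinduced_quot : gmodule G :=
  gm_quot A quotient_shift1 quotient_shiftM 1%g.
Definition coinduced_const : A -> coinduced :=
  gm_const quotient_shift1 quotient_shiftM.
Definition coinduced_proj (m : coinduced) : coinduced_quot := pf_proj 1%g m.
Lemma coinduced_trivial : trivial_on coinduced U.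
Proof.
move=> g f Ug; apply/ffunP => k; rewrite gm_mapsE AU// /quotient_shift.
by move/kapU: Ug => ->; rewrite invg1 mul1g.
Qed.

Lemma coinduced_quot_trivial : trivial_on coinduced_quot U.
Proof.
move=> g f Ug; rewrite -[f]pf_projK.
rewrite [LHS](@gm_quot_act G A K _ quotient_shift1 quotient_shiftM).
by rewrite coinduced_trivial.
Qed.

Variables (n : nat) (z : seq G -> A).
Hypotheses (zU : invariant U z) (z_cocycle : forall s, size s = n.+2 -> tw_delta z s = 0).

Let sec (k : K) : G := projT1 (cid (kap_onto k)).
Let secK k : kap (sec k) = k. Proof. by rewrite /sec; case: cid. Qed.

(* The contracting homotopy of the coinduced module, applied to [z]. *)
Definition contraction (s : seq G) : coinduced :=
  [ffun k => gm_act (sec k) (z ((sec k)^-1%g :: s))] : {ffun K -> A}.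

Lemma cong_refl s : cong U s s.
Proof.
by have [U1 _ _ _] := UN; elim: s => [//|x s IHs]; split; rewrite ?mulVg.
Qed.

Lemma contraction_invariant : invariant U contraction.
Proof.
move=> s t st; apply/ffunP => k; rewrite !ffunE; congr (gm_act _ _); apply: zU.
by split=> //; rewrite mulVg; have [] := UN.
Qed.

(** This is the cocycle identity of [z] on the word [(sec k)^-1 :: s], acted upon by [sec k]. The
    section [sec] does not commute with translation, but it does so modulo [U], to which [z] and the
    action are blind. *)
Lemma contractionP s : size s = n.+1 -> tw_delta contraction s = coinduced_const (z s).
Proof.
case: s => [//|y s] ys; apply/ffunP => k; rewrite [RHS]ffunE /tw_delta.
rewrite ffunE gm_mapsE ffunE.
have evB : {morph (fun f : coinduced => (f : {ffun K -> A}) k) : a b / a - b}.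
  by move=> a b; rewrite !ffunE.
rewrite (delta_tail_map contraction (y :: s) evB).
set T := (X in _ + X = _).
set g := sec k; set g' := sec _.
have gg' : kap (y^-1 * g)%g = kap g' by rewrite kapM (group_homV kapM) !secK.
have Ugg' : U ((y^-1 * g)^-1 * g')%g.
  by apply/kapU; rewrite kapM (group_homV kapM) gg' mulVg.
have -> : gm_act g' (z (g'^-1%g :: s)) = gm_act (y^-1 * g)%g (z ((g^-1 * y)%g :: s)).
  rewrite -(trivial_on_congr _ AU Ugg'); congr (gm_act _ _); apply: zU.
  split; last exact: cong_refl.
  rewrite invgK; have [_ UM UV UJ] := UN.
  by have := UJ _ g'^-1%g Ugg'; rewrite conjgE invgM !invgK !mulgA mulgK.
rewrite -gm_actM mulVKg.
have := z_cocycle (s := [:: g^-1, y & s]%g); rewrite /= => /(_ (congr1 S ys)).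
move=> /(congr1 (gm_act g)); rewrite gm_act0 gm_actD gm_actVK => e.
have -> : T = gm_act g (delta_tail (fun t => z (g^-1%g :: t)) (y :: s)).
  rewrite (delta_tail_map (phi := gm_act g)); last exact: gm_actB.
  by apply: eq_delta_tail => t _; rewrite /= ffunE.
rewrite gm_actB gm_actN in e.
by rewrite -[RHS]subr0 -e; zmod.
Qed.

(** If modulo constants the contraction is a cocycle [e] plus the coboundary of [v], then
    [contraction - e - tw_delta v] is constant-valued, that is, a cochain of [A], and its coboundary
    is [z]. The term [e] leaves room for a correction by a cocycle of the coinduced module. *)
Lemma dimension_shift (V : set G) (e v : seq G -> coinduced) :
  normal_subgroup V -> trivial_on A V -> trivial_on coinduced V -> V `<=` U ->
  invariant V e -> invariant V v ->
  (forall s, size s = n.+1 -> tw_delta e s = 0) ->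
  (forall s, size s = n -> coinduced_proj (contraction s - e s - tw_delta v s) = 0) ->
  exists2 w : seq G -> A, invariant V w &
    forall s, size s = n.+1 -> tw_delta w s = z s.
Proof.
move=> VN AV MV VU eV vV de ev.
pose m s := contraction s - e s - tw_delta v s.
have mV : invariant V m.
  move=> s t st; rewrite /m (eV s t)// (contraction_invariant (congS VU st)).
  by rewrite (invariant_tw_delta VN MV vV st).
exists (fun s => (m s : {ffun K -> A}) 1%g) => [s t /mV -> //|s ss].
have inj : injective coinduced_const by exact: (gm_const_inj 1%g).
apply: inj.
rewrite (tw_delta_map (phi := coinduced_const)) => [|a b|g a]; first last.
- by rewrite /coinduced_const gm_act_const.
- exact: gm_constB.
rewrite (eq_tw_delta (g := m)); last first.
  move=> t ts; apply/ffunP => k; rewrite ffunE /=; apply/esym.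
  by apply: (pf_proj_eq0 (i0 := 1%g)); apply: ev; case: ts; rewrite ss => -[].
rewrite /m !tw_deltaB tw_delta_delta de// !subr0.
exact: contractionP.
Qed.

End DimensionShift.

Section Vanishing.
Local Open Scope ring_scope.
Variables (p q d : nat) (G F : topGroupType) (y : d.-tuple F) (f : F -> G).
Hypotheses (p_pr : prime p) (Gp : pro_p p G) (yF : free_pro_p p y).
Hypotheses (fM : group_hom f) (fc : continuous f) (f_onto : set_surj setT setT f).
Hypothesis fker : f @^-1` [set 1%g] = closed_normal_closure (demushkin_word q y).
Hypotheses (d_ge2 : (2 <= d)%N) (pq : (p %| q)%N).
Local Notation r := (demushkin_word q y).

Definition on_pairs (A : zmodType) (z : G -> G -> A) (s : seq G) : A :=
  if s is [:: g; h] then z g h else 0.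

Definition on_singles (A : zmodType) (u : G -> A) (s : seq G) : A :=
  if s is [:: g] then u g else 0.

Lemma on_pairs_invariant (A : zmodType) (z : G -> G -> A) :
  loc_const (fun x : G * G => z x.1 x.2) ->
  exists2 V : set G, open_normal V & invariant V (on_pairs z).
Proof.
have [Gc _ _ _] := Gp => zc.
have c : continuous (fun u : prod_topology (fun _ : 'I_2 => G) =>
    (u (Ordinal (ltn0Sn 1)), u (Ordinal (ltnSn 1)))).
  by apply: pair_continuous; apply: (@proj_continuous _ (fun _ : 'I_2 => G)).
have [|V Vo VP] := @loc_const_uniform G 2 _ (on_pairs z) Gc.
  move=> u; apply: filterS (loc_const_comp c zc u) => v /=.
  have w2 (u' : prod_topology (fun _ : 'I_2 => G)) :
      on_pairs z (words u') = z (u' (Ordinal (ltn0Sn 1))) (u' (Ordinal (ltnSn 1))).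
    have := size_words u'; have := nth_words u' (Ordinal (ltn0Sn 1)).
    have := nth_words u' (Ordinal (ltnSn 1)).
    by case: (words u') => [|a [|b [|]]]//= -> ->.
  by rewrite !w2.
exists V => // -[|a [|b [|? ?]]] [|a' [|b' [|? ?]]]//=;
  try by [case=> ? []]; try by [case=> ? [? []]].
move=> [Va [Vb _]]; apply: (VP [:: a; b] [:: a'; b']) => //; split=> // -[|[|i]]//=.
by rewrite !nth_nil mulVg; have [[]] := Vo.
Qed.

Lemma on_singles_invariant (A : zmodType) (u : G -> A) : loc_const u ->
  exists2 V : set G, open_normal V & invariant V (on_singles u).
Proof.
have [Gc _ _ _] := Gp => uc; have [V Vo VP] := loc_const_invariant Gc uc.
exists V => // -[|a [|? ?]] [|a' [|? ?]]//=; try by [case=> ? []].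
by move=> [Va _]; exact: VP.
Qed.

Lemma tw_delta_pairs (M : gmodule G) (z : seq G -> M) g h k :
  tw_delta z [:: g; h; k] = gm_act g (z [:: h; k]) - z [:: (g * h)%g; k]
    + z [:: g; (h * k)%g] - z [:: g; h].
Proof. by rewrite /tw_delta /=; zmod. Qed.

Lemma tw_delta_singles (M : gmodule G) (u : seq G -> M) g h :
  tw_delta u [:: g; h] = gm_act g (u [:: h]) - u [:: (g * h)%g] + u [:: g].
Proof. by rewrite /tw_delta /=; zmod. Qed.

Let vanishes (n : nat) : Prop :=
  forall (A : gmodule G) (U : set G) (z : seq G -> A),
    (forall a : A, a *+ p = 0) -> open_normal U -> trivial_on A U ->
    invariant U z -> (forall s, size s = n.+2 -> tw_delta z s = 0) ->
    exists (V : set G) (w : seq G -> A), [/\ open_normal V, invariant V w &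
      forall s, size s = n.+1 -> tw_delta w s = z s].

(** [vanishes n] concerns degree [n.+1]. In degree 3 the contraction of [z] gives a 2-cocycle [zQ]
    of the quotient [Q], with a primitive [u] on [F] and obstruction [u r - u 1] in [Q]. A lift [m]
    of it to [M] is the trace of a 2-cocycle [zm] of [M], and [zQ] minus the image of [zm] is a
    coboundary on [G]. In higher degrees the induction hypothesis applies to [Q] directly, with
    [e = 0]. *)
Lemma cohomology_vanishes n : (2 <= n)%N -> vanishes n.
Proof.
case: n => [|[|n]]// _; elim: n => [|n IHn] A U z pA Uo AU zU zc;
  have [K [kap [k [kapM kap_onto kapU _]]]] := pro_p_quotient Gp Uo;
  pose Q := coinduced_quot A kapM; pose M := coinduced A kapM;
  pose w := contraction kapM kap_onto z : seq G -> M;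
  have pM (m : M) : m *+ p = 0 by [apply/ffunP => i; rewrite ffunMnE pA ffunE];
  have pQ (b : Q) : b *+ p = 0 by [apply: val_inj; rewrite raddfMn; exact: pM];
  pose pr : M -> Q := @coinduced_proj _ _ _ _ kapM;
  have prB : {morph pr : a b / a - b} by [exact: pf_projB];
  have prD : {morph pr : a b / a + b} by [exact: pf_projD];
  have pr0 : pr 0 = 0 by [rewrite -[0 in LHS](subrr (0 : M)) prB subrr];
  have prK (b : Q) : pr (pf_val b) = b by [exact: pf_projK];
  have prM g (m : M) : pr (gm_act g m) = gm_act g (pr m)
    by [exact/esym/gm_quot_act];
  have wP := contractionP Uo.1 AU kapM kap_onto kapU zU zc;
  have wU := contraction_invariant Uo.1 kapM kap_onto zU;
  have MU : trivial_on M U := coinduced_trivial AU kapU;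
  have QU : trivial_on Q U := coinduced_quot_trivial AU kapU;
  have prw s : tw_delta w s = coinduced_const kapM (z s) ->
      tw_delta (fun t => pr (w t)) s = 0
    by [move=> ss; rewrite -(tw_delta_map w s prB prM) ss;
        apply: val_inj; apply/ffunP => i; rewrite !ffunE subrr];
  have prwU : invariant U (fun t => pr (w t)) by [move=> s t /wU e; rewrite /w e].
  pose zQ g h := pr (w [:: g; h]).
  have zQP : cocycle2 zQ.
    move=> g h l; apply/eqP; rewrite -subr_eq0; apply/eqP.
    by rewrite -(prw [:: g; h; l] (wP [:: g; h; l] erefl)) tw_delta_pairs /zQ; zmod.
  have zQc : loc_const (fun x : G * G => zQ x.1 x.2).
    move=> [g h] /=.
    have n1 := normal_coset_nbhs g Uo.1 (open_normal_nbhs Uo).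
    have n2 := normal_coset_nbhs h Uo.1 (open_normal_nbhs Uo).
    exists ([set x | U (g^-1 * x)%g], [set x | U (h^-1 * x)%g]) => //.
    by move=> [g' h'] [/= Ug Uh]; apply/esym/prwU.
  have Qlc := trivial_on_loc_const Uo QU.
  have Q1 : p_power_torsion p Q by exists 1%N => b; rewrite expn1.
  have [u [uc du _]] := pull_lift p_pr yF fM fc Qlc (fun _ => 0) Q1 zQP zQc.
  pose m : M := pf_val (u r - u 1%g).
  have [zm [um [zmP zmc umc dum [um1 umr]]]] :=
    trace_onto p_pr Gp yF fM fc f_onto fker d_ge2 pq m pM Uo MU.
  have [|||v [vc vf dv]] := @descend_cochain p d G F y f r Gp yF fM fc f_onto fker
    Q (fun g h => zQ g h - pr (zm g h)) (fun g => u g - pr (um g)).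
  - exact: (loc_const2 (fun a b : Q => a - b) uc (loc_const1 pr umc)).
  - move=> g h; rewrite cobdB du; congr (_ - _).
    by rewrite -dum /cobd prD prB prM.
  - by rewrite umr um1 pr0 prK; zmod.
  have [V Vo Vz] := on_pairs_invariant zmc.
  have [V' V'o V'v] := on_singles_invariant (loc_const1 (fun b : Q => pf_val b : M) vc).
  pose W := U `&` (V `&` V').
  have Wo : open_normal W by apply: open_normalI => //; exact: open_normalI.
  have WU : W `<=` U by move=> g [].
  have triv B : trivial_on B U -> trivial_on B W by move=> BU g b /WU; exact: BU.
  have [||||w' w'W dw'] := dimension_shift (kap_onto := kap_onto) Uo.1 AU kapU zU zc Wo.1
    (triv _ AU) (triv _ MU) WU
    (e := on_pairs zm) (v := on_singles (fun g => pf_val (v g) : M)).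
  - by move=> s t st; apply: Vz; apply: congS st => g [_ []].
  - by move=> s t st; apply: V'v; apply: congS st => g [_ []].
  - move=> [|g [|h [|l [|? ?]]]]// _; rewrite tw_delta_pairs /=.
    have := zmP g h l => e.
    transitivity (gm_act g (zm h l) + zm g (h * l)%g - (zm (g * h)%g l + zm g h)).
      by zmod.
    by rewrite e subrr.
  - move=> [|g [|h [|? ?]]]// _; rewrite -/pr !prB.
    rewrite -/(zQ g h) tw_delta_singles prD prB prM !prK -/(cobd v g h).
    by rewrite dv; zmod.
  by exists W, w'.
have [V [v [Vo vV dv]]] := IHn Q U _ pQ Uo QU prwU (fun s ss => prw s (wP s ss)).
pose W := U `&` V.
have Wo : open_normal W by exact: open_normalI.
have WU : W `<=` U by move=> g [].
have triv B : trivial_on B U -> trivial_on B W by move=> BU g b /WU; exact: BU.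
have [||||w' w'W dw'] := dimension_shift (kap_onto := kap_onto) Uo.1 AU kapU zU zc Wo.1
    (triv _ AU) (triv _ MU) WU
  (e := fun _ => 0) (v := fun s => pf_val (v s) : M).
- by [].
- by move=> s t st; rewrite (vV s t)//; apply: congS st => g [].
- move=> s _; rewrite -[RHS](subrr (tw_delta (fun _ => 0 : M) s)) -tw_deltaB.
  by apply: eq_tw_delta => t _; rewrite subrr.
- move=> s ss; rewrite -/pr !prB pr0 subr0 (tw_delta_map (phi := pr) _ _ prB prM).
  rewrite (eq_tw_delta (g := v)); last by move=> t _; exact: prK.
  by rewrite dv// subrr.
by exists W, w'.
Qed.

End Vanishing.

(** * Unipotent representations and the cochains of a Demushkin group *)

Lemma congr_mod_cong (G : topGroupType) (U : set G) s t :
  congr_mod U s t -> cong U s t.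
Proof.
elim: s t => [|x s IHs] [|y t] [st Ust] //.
split; first exact: (Ust 0%N).
by apply: IHs; split=> [|i]; [case: st|exact: (Ust i.+1)].
Qed.

(** * Homogeneous cochains as invariant functions on words *)

Section CochainBridge.
Local Open Scope ring_scope.
Variables (p : nat) (G : topGroupType).
Hypothesis Gp : pro_p p G.
Local Notation Fp := 'F_p.
Local Notation A := (cochain_dga G Fp).
Local Notation cval := (@cochain_val G Fp).

Lemma delta_tail_delta (h : seq G -> Fp) s : delta h s =
  tw_delta (h : seq G -> gm_triv G Fp) s.
Proof.
suff H (x : G) (t : seq G) (k : seq G -> Fp) :
    delta k (x :: t) = k t + delta_tail k (x :: t) by case: s => [//|x s]; exact: H.
elim: t x k => [|y t IHt] x k; first by rewrite delta1 /= subrr.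
rewrite delta_cons delta_tail_cons IHt.
by zmod.
Qed.

Lemma ddiffE (a : A) s : cval (ddiff a) s = tw_delta (cval a : seq G -> gm_triv G Fp) s.
Proof. exact: delta_tail_delta. Qed.

Lemma gdegE n (a : A) : gproj n a = a <-> forall s, size s != n -> cval a s = 0.
Proof.
have R := @restrP G Fp n (cval a).
by split=> [/(congr1 cval)/R//|/R e]; exact: val_inj.
Qed.

Lemma cochain_eq n (a b : A) : gproj n a = a -> gproj n b = b ->
  (forall s, size s = n -> cval a s = cval b s) -> a = b.
Proof.
move=> /gdegE an /gdegE bn ab; apply: val_inj; apply/funext => s.
rewrite -[LHS]/(cval a s) -[RHS]/(cval b s).
by have [/ab|sn] := eqVneq (size s) n; [|rewrite an// bn].
Qed.

Lemma cochain_mulE m n (a b : A) s t : gproj m a = a -> gproj n b = b ->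
  size s = m -> size t = n -> cval (a * b) (s ++ t) = cval a s * cval b t.
Proof.
move=> /gdegE am _ sm tn.
rewrite -[LHS]/(cup (cval a) (cval b) (s ++ t)) /cup.
have ms : (m < (size (s ++ t)).+1)%N by rewrite size_cat sm ltnS leq_addr.
rewrite (bigD1 (Ordinal ms))//= -{1 2}sm take_size_cat// drop_size_cat//.
rewrite big1 ?addr0// => i im; rewrite am ?mul0r// size_takel -1?ltnS//.
Qed.

Lemma cochain_make n (h : seq G -> Fp) (U : set G) : open_normal U -> invariant U h ->
  exists a : A, gproj n a = a /\ forall s, size s = n -> cval a s = h s.
Proof.
move=> Uo hU; have hc : restr n (h : seq G -> Fp^o) \in @is_cochain G Fp.
  apply/asboolP; split; last first.
    by exists n.+1 => s sn; rewrite /restr gtn_eqF.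
  move=> m; apply/(@loc_constP _ Fp); apply: (uniform_loc_const Uo) => s t sm st.
  rewrite /restr -st.1; case: ifP => // _; apply: hU.
  exact: congr_mod_cong.
exists (Cochain hc : A); split.
  by apply/gdegE => s sn; rewrite /= /restr (negPf sn).
by move=> s sn; rewrite /= /restr sn eqxx.
Qed.

Lemma cochain_invariant n (a : A) : gproj n a = a ->
  exists2 U, open_normal U & invariant U (cval a).
Proof.
have [Gc _ _ _] := Gp; move=> /gdegE an; have /asboolP[ac _] := cochainP a.
have [|U Uo UP] := @loc_const_uniform G n _ (cval a) Gc.
  exact: ((@loc_constP _ Fp _).1 (ac n)).
exists U => // s t st; have [sn|sn] := eqVneq (size s) n; last first.
  by rewrite !an// -(cong_size st).
apply: UP => //; elim: s t st {sn} => [|x s IHs] [|y t]//=.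
  by split=> // i; rewrite nth_nil mulVg; have [[]] := Uo.
by move=> [Uxy /IHs[st Ust]]; split=> [|[|i]]//=; rewrite st.
Qed.

Lemma cochain1 (u : G -> Fp) : loc_const u ->
  exists a : A, gproj 1 a = a /\ forall g, cval a [:: g] = u g.
Proof.
move=> uc; have [U Uo Uu] := on_singles_invariant Gp uc.
have [a [a1 aE]] := cochain_make 1 Uo Uu; exists a; split=> // g.
by rewrite aE.
Qed.

Lemma cochain1_loc_const (a : A) : gproj 1 a = a -> loc_const (fun g => cval a [:: g]).
Proof.
move=> /cochain_invariant[U Uo Ua]; apply: (invariant_loc_const Uo) => g h Ugh.
by apply: Ua; split.
Qed.

Lemma cochain2_loc_const (a : A) : gproj 2 a = a ->
  loc_const (fun x : G * G => cval a [:: x.1; x.2]).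
Proof.
move=> /cochain_invariant[U Uo Ua] [g h] /=.
have n1 := normal_coset_nbhs g Uo.1 (open_normal_nbhs Uo).
have n2 := normal_coset_nbhs h Uo.1 (open_normal_nbhs Uo).
exists ([set x | U (g^-1 * x)%g], [set x | U (h^-1 * x)%g]) => //.
by move=> [g' h'] [/= Ug Uh]; apply/esym/Ua.
Qed.

Lemma cvalD (a b : A) s : cval (a + b) s = cval a s + cval b s. Proof. by []. Qed.
Lemma cvalN (a : A) s : cval (- a) s = - cval a s. Proof. by []. Qed.
Lemma cvalZ c (a : A) s : cval (c *: a) s = c * cval a s. Proof. by []. Qed.

Lemma gprojD n (a b : A) : gproj n a = a -> gproj n b = b -> gproj n (a + b) = a + b.
Proof.
by move=> /gdegE ea /gdegE eb; apply/gdegE => s sn; rewrite cvalD ea// eb// addr0.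
Qed.

Lemma gprojZ n c (a : A) : gproj n a = a -> gproj n (c *: a) = c *: a.
Proof. by move=> /gdegE ea; apply/gdegE => s sn; rewrite cvalZ ea// mulr0. Qed.

Lemma gprojN n (a : A) : gproj n a = a -> gproj n (- a) = - a.
Proof. by rewrite -scaleN1r; exact: gprojZ. Qed.

Lemma ddiff1E (a : A) g h :
  cval (ddiff a) [:: g; h] = cval a [:: h] - cval a [:: (g * h)%g] + cval a [:: g].
Proof. by rewrite ddiffE tw_delta_singles. Qed.

Lemma ddiff2E (a : A) g h k : cval (ddiff a) [:: g; h; k] =
  cval a [:: h; k] - cval a [:: (g * h)%g; k] + cval a [:: g; (h * k)%g] - cval a [:: g; h].
Proof. by rewrite ddiffE tw_delta_pairs. Qed.

End CochainBridge.

(** * Matrix entries on inverses, commutators and powers *)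

Section UnipotentEntries.
Local Open Scope ring_scope.
Variables (F : groupType) (R : comNzRingType) (a b P : F -> R).
Hypotheses (aM : forall g h, a (g * h)%g = a g + a h)
  (bM : forall g h, b (g * h)%g = b g + b h)
  (PM : forall g h, P (g * h)%g = P g + P h - a g * b h).

Lemma add_hom1 (u : F -> R) : (forall g h, u (g * h)%g = u g + u h) -> u 1%g = 0.
Proof. by move=> uM; apply: (addrI (u 1%g)); rewrite -uM mulg1 addr0. Qed.

Lemma add_homV (u : F -> R) g :
  (forall g h, u (g * h)%g = u g + u h) -> u g^-1%g = - u g.
Proof.
by move=> uM; apply: (addrI (u g)); rewrite -uM mulgV subrr add_hom1.
Qed.

Lemma add_homX (u : F -> R) g n :
  (forall g h, u (g * h)%g = u g + u h) -> u (g ^+ n)%g = n%:R * u g.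
Proof.
move=> uM; elim: n => [|n IHn]; first by rewrite add_hom1// mul0r.
by rewrite expgS uM IHn -natr1; ring.
Qed.

Lemma add_homR (u : F -> R) g h :
  (forall g h, u (g * h)%g = u g + u h) -> u [~ g, h]%g = 0.
Proof.
move=> uM; rewrite commgEl conjgE !uM !(add_homV _ uM).
by ring.
Qed.

Lemma entry13_1 : P 1%g = 0.
Proof.
by apply: (addrI (P 1%g)); rewrite addr0 -[in RHS](mulg1 1%g) PM (add_hom1 aM) mul0r subr0.
Qed.

Lemma entry13V g : P g^-1%g = - P g - a g * b g.
Proof.
have := PM g g^-1%g; rewrite mulgV entry13_1 (add_homV _ bM) => e.
transitivity (P g^-1%g - 0); first by rewrite subr0.
by rewrite e; ring.
Qed.

Lemma entry13R g h : P [~ g, h]%g = a h * b g - a g * b h.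
Proof.
rewrite commgEl conjgE !PM !entry13V !bM !(add_homV _ aM) !(add_homV _ bM).
by ring.
Qed.

Lemma entry13X g n : P (g ^+ n)%g = n%:R * P g - 'C(n, 2)%:R * (a g * b g).
Proof.
elim: n => [|n IHn]; first by rewrite expg0 entry13_1 bin0n !mul0r subrr.
rewrite expgSr PM IHn (add_homX _ _ aM) binS bin1 natrD -natr1.
by ring.
Qed.

End UnipotentEntries.

(* [(a, b, c, P, Q, T)] are the entries above the diagonal of a homomorphism to
   unipotent 4 x 4 matrices, up to the signs of [P] and [Q]. *)
Section UnipotentCorner.
Local Open Scope ring_scope.
Variables (F : groupType) (R : comNzRingType) (a b c P Q T : F -> R).
Hypotheses (aM : forall g h, a (g * h)%g = a g + a h)
  (bM : forall g h, b (g * h)%g = b g + b h)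
  (cM : forall g h, c (g * h)%g = c g + c h)
  (PM : forall g h, P (g * h)%g = P g + P h - a g * b h)
  (QM : forall g h, Q (g * h)%g = Q g + Q h - b g * c h)
  (TM : forall g h, T (g * h)%g = T g + T h - a g * Q h - P g * c h).

Lemma entry14_1 : T 1%g = 0.
Proof.
apply: (addrI (T 1%g)); rewrite addr0 -[in RHS](mulg1 1%g) TM.
by rewrite (add_hom1 aM) (add_hom1 cM) mul0r mulr0 !subr0.
Qed.

Lemma entry14V g : T g^-1%g = - T g - a g * Q g - a g * b g * c g - P g * c g.
Proof.
have := TM g g^-1%g; rewrite mulgV entry14_1 (add_homV _ cM) (entry13V bM cM QM) => e.
transitivity (T g^-1%g - 0); first by rewrite subr0.
by rewrite e; ring.
Qed.

Lemma entry14R g h : T [~ g, h]%g =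
  - a g * Q h - P g * c h + a h * Q g - a h * b g * c h + P h * c g
  + a h * b h * c g - a g * b g * c h + a g * b h * c g.
Proof.
rewrite commgEl conjgE !TM !QM !entry14V !(entry13V aM bM PM) !(entry13V bM cM QM).
rewrite !cM !(add_homV _ aM) !(add_homV _ bM) !(add_homV _ cM).
by ring.
Qed.

Lemma entry14X g n : T (g ^+ n)%g = n%:R * T g
  - 'C(n, 2)%:R * (a g * Q g + P g * c g) + 'C(n, 3)%:R * (a g * b g * c g).
Proof.
elim: n => [|n IHn]; first by rewrite expg0 entry14_1 !bin0n !mul0r subrr addr0.
rewrite expgSr TM IHn (add_homX _ _ aM) (entry13X aM PM) !binS bin1 !natrD -!natr1.
by ring.
Qed.

Variables (q d : nat) (y : d.-tuple F).
Hypotheses (q0 : q%:R = 0 :> R) (q2 : 'C(q, 2)%:R = 0 :> R) (q3 : 'C(q, 3)%:R = 0 :> R).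
Local Notation r := (demushkin_word q y).
Local Notation yx m := (nth 1%g y m.*2).
Local Notation yy m := (nth 1%g y m.*2.+1).

(** For characters [a] and [b] this is the trace of their cup product: an alternating form that
    pairs the two generators of each commutator. *)
Lemma entry13_relator :
  P r = \sum_(m < d./2) (a (yy m) * b (yx m) - a (yx m) * b (yy m)).
Proof.
rewrite /demushkin_word PM (entry13X aM PM) (add_homX _ _ aM) q0 q2 !mul0r.
rewrite subrr add0r subr0.
have [H _] : P (\prod_(m < d./2) [~ yx m, yy m])%g =
    \sum_(m < d./2) (a (yy m) * b (yx m) - a (yx m) * b (yy m))
    /\ b (\prod_(m < d./2) [~ yx m, yy m])%g = 0; last by [].
elim/big_rec2: _ => [|m g s _ [Pg bg]].
  by rewrite (entry13_1 aM PM) (add_hom1 bM).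
rewrite PM Pg (entry13R aM bM PM) (add_homR _ _ aM) mul0r subr0.
by rewrite bM bg (add_homR _ _ bM) addr0.
Qed.

(* The values of [P] and [Q] on the generators are chosen so that [T] vanishes
   on each commutator of the relator. *)
Lemma entry14_relator :
  (forall m, (m < d./2)%N -> P (yx m) = - (a (yy m) * b (yx m))) ->
  (forall m, (m < d./2)%N -> P (yy m) = - (a (yx m) * b (yy m))) ->
  (forall m, (m < d./2)%N -> Q (yx m) = - (b (yy m) * c (yx m))) ->
  (forall m, (m < d./2)%N -> Q (yy m) = - (b (yx m) * c (yy m))) ->
  T r = 0.
Proof.
move=> Px Py Qx Qy.
rewrite /demushkin_word TM entry14X (entry13X aM PM) (add_homX _ _ aM) q0 q2 q3.
rewrite !mul0r !subr0 addr0 add0r.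
have [H _] : T (\prod_(m < d./2) [~ yx m, yy m])%g = 0
    /\ c (\prod_(m < d./2) [~ yx m, yy m])%g = 0; last by rewrite H mul0r subr0.
elim/big_rec: _ => [|m g _ [Tg cg]].
  by rewrite entry14_1 (add_hom1 cM).
rewrite TM Tg cM cg (add_homR _ _ aM) (add_homR _ _ cM) mul0r mulr0 !subr0 !addr0.
split=> //; rewrite entry14R Px// Py// Qx// Qy//.
by ring.
Qed.

End UnipotentCorner.

(** The identity [m * 'C(q, m) = q * 'C(q - 1, m - 1)] is used with [m = 2] and [m = 3]: an odd [p]
    is prime to 2, and it is prime to 3 unless [p = 3], in which case 9 divides [q]. *)
Lemma prime_power_bin p q : prime p -> odd p ->
  (exists f : nat, [/\ (1 <= f)%N, p = 3 -> (2 <= f)%N & q = (p ^ f)%N]) \/ q = 0 ->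
  [/\ p %| q, p %| 'C(q, 2) & p %| 'C(q, 3)]%N.
Proof.
move=> p_pr p_odd [[f [f1 f3 ->]]|->]; last by rewrite !bin0n !dvdn0.
have pq : (p %| p ^ f)%N by rewrite -{1}(expn1 p) dvdn_exp2l.
have p2 : (p %| 'C(p ^ f, 2))%N.
  have : (p %| 2 * 'C(p ^ f, 2))%N by rewrite -mul_bin_diag dvdn_mulr.
  by rewrite Gauss_dvdr// prime_coprime// dvdn_prime2//; apply: contraL p_odd => /eqP->.
split=> //; have e := mul_bin_diag (p ^ f) 2.
have [p3|p3] := eqVneq p 3; last first.
  have : (p %| 3 * 'C(p ^ f, 3))%N by rewrite -e dvdn_mulr.
  by rewrite Gauss_dvdr// prime_coprime// dvdn_prime2.
have : (3 * p %| 3 * 'C(p ^ f, 3))%N.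
  rewrite -e; apply: dvdn_mulr; rewrite -{1}p3 -{1}(expn1 p) -expnSr.
  by apply: dvdn_exp2l; exact: f3.
by rewrite dvdn_pmul2l.
Qed.

Section DgaLinear.
Local Open Scope ring_scope.
Variables (F : fieldType) (A : dga F).

Lemma ddiffD (a b : A) : ddiff (a + b) = ddiff a + ddiff b.
Proof. exact: linearD. Qed.
Lemma ddiffN (a : A) : ddiff (- a) = - ddiff a. Proof. exact: linearN. Qed.
Lemma ddiffB (a b : A) : ddiff (a - b) = ddiff a - ddiff b.
Proof. exact: linearB. Qed.
Lemma ddiffZ c (a : A) : ddiff (c *: a) = c *: ddiff a. Proof. exact: linearZ. Qed.
Lemma ddiff0 : ddiff (0 : A) = 0. Proof. exact: linear0. Qed.
Lemma ddiff_sum I (s : seq I) (P : pred I) (a : I -> A) :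
  ddiff (\sum_(i <- s | P i) a i) = \sum_(i <- s | P i) ddiff (a i).
Proof. exact: linear_sum. Qed.

End DgaLinear.

Section GalgLinear.
Local Open Scope ring_scope.
Variables (F : fieldType) (A : galg F) (n : nat).

Lemma gproj_add (a b : A) : gproj n (a + b) = gproj n a + gproj n b.
Proof. exact: linearD. Qed.
Lemma gproj_scale c (a : A) : gproj n (c *: a) = c *: gproj n a.
Proof. exact: linearZ. Qed.
Lemma gproj_bigsum I (s : seq I) (P : pred I) (a : I -> A) :
  gproj n (\sum_(i <- s | P i) a i) = \sum_(i <- s | P i) gproj n (a i).
Proof. exact: linear_sum. Qed.

End GalgLinear.

(** The data from which formality is deduced. [dm_om] is the matrix of the cup product in degree 1;
    [dm_C], [dm_L] and [dm_R] are the values of [f2] on the pairs chi, chi and e, chi and chi, e;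
    [dm_TP] is the equation of [f3] on three classes of degree 1. *)
Record degree2_model (F : fieldType) (A : dga F) (d : nat) := Degree2Model {
  dm_chi : 'I_d -> A;
  dm_e : A;
  dm_om : 'I_d -> 'I_d -> F;
  dm_C : 'I_d -> 'I_d -> A;
  dm_L : 'I_d -> A;
  dm_R : 'I_d -> A;
  dm_T : 'I_d -> 'I_d -> 'I_d -> A;
  dm_chi_deg : forall i, gproj 1 (dm_chi i) = dm_chi i;
  dm_chi_cocycle : forall i, ddiff (dm_chi i) = 0%R;
  dm_chi_span : forall a : A, gproj 1 a = a -> ddiff a = 0%R ->
    exists c : 'I_d -> F, a = (\sum_i c i *: dm_chi i)%R;
  dm_chi_free : forall c : 'I_d -> F,
    (\sum_i c i *: dm_chi i = 0)%R -> forall i, c i = 0%R;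
  dm_e_deg : gproj 2 dm_e = dm_e;
  dm_e_cocycle : ddiff dm_e = 0%R;
  dm_e_span : forall a : A, gproj 2 a = a -> ddiff a = 0%R ->
    exists (t : F) (b : A), a = (t *: dm_e + ddiff b)%R;
  dm_e_neq0 : forall b : A, ddiff b <> dm_e;
  dm_vanish : forall n (a : A), gproj n.+3 a = a -> ddiff a = 0%R ->
    exists2 b : A, gproj n.+2 b = b & ddiff b = a;
  dm_C_deg : forall i j, gproj 1 (dm_C i j) = dm_C i j;
  dm_CP : forall i j, ddiff (dm_C i j) = (dm_om i j *: dm_e - dm_chi i * dm_chi j)%R;
  dm_L_deg : forall i, gproj 2 (dm_L i) = dm_L i;
  dm_LP : forall i, ddiff (dm_L i) = (- (dm_e * dm_chi i))%R;
  dm_R_deg : forall i, gproj 2 (dm_R i) = dm_R i;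
  dm_RP : forall i, ddiff (dm_R i) = (- (dm_chi i * dm_e))%R;
  dm_T_deg : forall i j k, gproj 1 (dm_T i j k) = dm_T i j k;
  dm_TP : forall i j k, ddiff (dm_T i j k) =
    (dm_chi i * dm_C j k + dm_C i j * dm_chi k
     + dm_om i j *: dm_L k - dm_om j k *: dm_R i)%R
}.

Section DemushkinModel.
Local Open Scope ring_scope.
Variables (p q d : nat) (G F : topGroupType) (y : d.-tuple F) (f : F -> G).
Hypotheses (p_pr : prime p) (Gp : pro_p p G) (yF : free_pro_p p y).
Hypotheses (fM : group_hom f) (fc : continuous f) (f_onto : set_surj setT setT f).
Hypothesis fker : f @^-1` [set 1%g] = closed_normal_closure (demushkin_word q y).
Hypotheses (d_ge2 : (2 <= d)%N) (d_even : ~~ odd d).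
Hypotheses (pq : (p %| q)%N) (pq2 : (p %| 'C(q, 2))%N) (pq3 : (p %| 'C(q, 3))%N).
Local Notation r := (demushkin_word q y).
Local Notation Fp := 'F_p.
Local Notation A := (cochain_dga G Fp).
Local Notation cval := (@cochain_val G Fp).

Let triv (H : groupType) : gmodule H := gm_triv H Fp.

Let triv_lc (H : topGroupType) : loc_const_act (triv H).
Proof. by move=> a; exact: loc_const_cst. Qed.

Let pFp (a : Fp) : a *+ p = 0.
Proof. by rewrite -mulr_natr pchar_Fp_0// mulr0. Qed.

Let Fp_torsion : p_power_torsion p Fp.
Proof. by exists 1%N => a; rewrite expn1. Qed.

Let natp n : (p %| n)%N -> n%:R = 0 :> Fp.
Proof. by move=> /dvdnP[m ->]; rewrite natrM (_ : p%:R = 0) ?mulr0// -[RHS](pFp 1). Qed.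

Lemma free_primitive (z : F -> F -> Fp) (a : 'I_d -> Fp) :
  (forall g h k, z h k + z g (h * k)%g = z (g * h)%g k + z g h) ->
  loc_const (fun x : F * F => z x.1 x.2) ->
  exists u : F -> Fp, [/\ loc_const u,
    forall g h, u (g * h)%g = u g + u h - z g h & forall i, u (tnth y i) = a i].
Proof.
move=> zP zc.
have [u [uc du uy]] := free_lift p_pr yF (z := @FactorSet F (triv F) z zP (@triv_lc F) zc)
  a Fp_torsion.
by exists u; split=> // g h; have : cobd u g h = z g h := du g h; rewrite /cobd /= => <-; zmod.
Qed.

Lemma descend_scalar (z : G -> G -> Fp) (u : F -> Fp) :
  loc_const u -> (forall g h, u (g * h)%g = u g + u h - z (f g) (f h)) ->
  u r = u 1%g ->
  exists v : G -> Fp, [/\ loc_const v, forall g, v (f g) = u g &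
    forall g h, v (g * h)%g = v g + v h - z g h].
Proof.
move=> uc uz ur.
have [|v [vc vf dv]] := @descend_cochain p d G F y f r Gp yF fM fc f_onto fker
  (triv G) z u uc _ ur.
  by move=> g h; rewrite /cobd /= uz; zmod.
by exists v; split=> // g h; have : cobd v g h = z g h := dv g h; rewrite /cobd /= => <-; zmod.
Qed.

Lemma loc_const_cup (H : topGroupType) (u v : H -> Fp) : loc_const u -> loc_const v ->
  loc_const (fun x : H * H => u x.1 * v x.2).
Proof.
move=> uc vc.
have c1 : continuous (fun x : H * H => x.1) by move=> x; exact: cvg_fst.
have c2 : continuous (fun x : H * H => x.2) by move=> x; exact: cvg_snd.
exact: (loc_const2 *%R (loc_const_comp c1 uc) (loc_const_comp c2 vc)).
Qed.

Lemma loc_const_pull2 (z : G -> G -> Fp) : loc_const (fun x : G * G => z x.1 x.2) ->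
  loc_const (fun x : F * F => z (f x.1) (f x.2)).
Proof.
move=> zc; have c : continuous (fun x : F * F => (f x.1, f x.2)).
  apply: pair_continuous => x.
    by apply: continuous_comp; [exact: cvg_fst|exact: fc].
  by apply: continuous_comp; [exact: cvg_snd|exact: fc].
exact: (loc_const_comp c zc).
Qed.

Let y_nth (i : 'I_d) : tnth y i = nth 1%g y i. Proof. exact: tnth_nth. Qed.

Let half_lt m : (m < d./2)%N -> (m.*2.+1 < d)%N.
Proof. by move=> md; rewrite -[d]odd_double_half (negPf d_even) -doubleS leq_double. Qed.

Lemma free_character i : exists u : F -> Fp, [/\ loc_const u,
  forall g h, u (g * h)%g = u g + u h, forall j, u (tnth y j) = (i == j)%:R &
  u r = 0].
Proof.
have [||u [uc uM uy]] := @free_primitive (fun _ _ => 0) (fun j => (i == j)%:R).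
  - by move=> *; rewrite addr0.
  - exact: loc_const_cst.
have uM' g h : u (g * h)%g = u g + u h by rewrite uM subr0.
exists u; split=> //; rewrite /demushkin_word uM' (add_homX _ _ uM') natp// mul0r add0r.
elim/big_rec: _ => [|m g _ ug]; first by rewrite add_hom1.
by rewrite uM' ug (add_homR _ _ uM') addr0.
Qed.


Lemma relator_hom_eq0 (u : F -> Fp) : (forall g h, u (g * h)%g = u g + u h) -> u r = 0.
Proof.
move=> uM; rewrite /demushkin_word uM (add_homX _ _ uM) natp// mul0r add0r.
elim/big_rec: _ => [|m g _ ug]; first by rewrite add_hom1.
by rewrite uM ug (add_homR _ _ uM) addr0.
Qed.

Lemma free_hom_eq0 (u : F -> Fp) : loc_const u ->
  (forall g h, u (g * h)%g = u g + u h) -> (forall i, u (tnth y i) = 0) ->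
  forall g, u g = 0.
Proof.
move=> uc uM uy.
apply: (@free_derivation_eq0 p d F y (triv F) p_pr yF Fp_torsion (@triv_lc F) u) => //.
by move=> g h; rewrite /cobd /= uM; zmod.
Qed.

Lemma cochain_vanish n (a : A) : gproj n.+3 a = a -> ddiff a = 0 ->
  exists2 b : A, gproj n.+2 b = b & ddiff b = a.
Proof.
move=> an da; have [U Uo Ua] := cochain_invariant Gp an.
have [||V [w [Vo Vw dw]]] := cohomology_vanishes p_pr Gp yF fM fc f_onto fker d_ge2 pq
  (n := n.+2) isT (A := triv G) pFp Uo _ Ua.
- by [].
- by move=> s _; rewrite -ddiffE da.
have [b [bn bw]] := cochain_make n.+2 Vo Vw; exists b => //.
apply: (cochain_eq (n := n.+3)) => // [|s sn]; first exact: (ddiff_deg bn).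
rewrite ddiffE -(dw s sn); apply: (@eq_tw_delta G (triv G) (cval b) w) => t ts; apply: bw.
by move: ts; rewrite sn => -[].
Qed.

Lemma trace_primitive (a : A) : gproj 2 a = a -> ddiff a = 0 ->
  exists u : F -> Fp, loc_const u /\
    forall g h, u (g * h)%g = u g + u h - cval a [:: f g; f h].
Proof.
move=> a2 da.
have [||u [uc uM _]] := @free_primitive (fun g h => cval a [:: f g; f h]) (fun=> 0).
- move=> g h k; have e : cval (ddiff a) [:: f g; f h; f k] = 0 by rewrite da.
  rewrite ddiff2E in e; rewrite !fM; apply/eqP.
  by rewrite -subr_eq0 -[X in _ == X]e; apply/eqP; zmod.
- apply: (loc_const_pull2 (z := fun g h => cval a [:: g; h])).
  exact: cochain2_loc_const.
by exists u.
Qed.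

Lemma coboundary_of_primitive (a : A) (u : F -> Fp) : gproj 2 a = a -> loc_const u ->
  (forall g h, u (g * h)%g = u g + u h - cval a [:: f g; f h]) -> u r = u 1%g ->
  exists2 b : A, gproj 1 b = b & ddiff b = a.
Proof.
move=> a2 uc uM ur.
have [v [vc vf vM]] := descend_scalar (z := fun g h => cval a [:: g; h]) uc uM ur.
have [b [b1 bv]] := cochain1 Gp vc; exists b => //.
apply: (cochain_eq (n := 2)) => // [|[|g [|h [|? ?]]]//]; first exact: (ddiff_deg b1).
by move=> _; rewrite ddiff1E !bv vM; zmod.
Qed.

(** The index of the other generator in the same commutator of the relator. *)
Definition partner (l : nat) : nat := if odd l then l.-1 else l.+1.

Lemma partner_double m : partner m.*2 = m.*2.+1.
Proof. by rewrite /partner odd_double. Qed.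

Lemma partner_doubleS m : partner m.*2.+1 = m.*2.
Proof. by rewrite /partner /= odd_double. Qed.

Lemma demushkin_model : inhabited (degree2_model A d).
Proof.
have [chiF chiFP] := choice free_character.
have chiFc i : loc_const (chiF i) by have [] := chiFP i.
have chiFM i : forall g h, chiF i (g * h)%g = chiF i g + chiF i h by have [] := chiFP i.
have chiFy i j : chiF i (tnth y j) = (i == j)%:R by have [] := chiFP i.
have chiFr i : chiF i r = 0 by have [] := chiFP i.
have /choice[chiG chiGP] i : exists v : G -> Fp, [/\ loc_const v,
    forall g, v (f g) = chiF i g & forall g h, v (g * h)%g = v g + v h - 0].
  apply: (descend_scalar (z := fun _ _ => 0)) => //.
    by move=> g h; rewrite subr0.
  by rewrite chiFr (add_hom1 (chiFM i)).
have chiGc i : loc_const (chiG i) by have [] := chiGP i.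
have chiGf i g : chiG i (f g) = chiF i g by have [] := chiGP i.
have chiGM i g h : chiG i (g * h)%g = chiG i g + chiG i h.
  by have [_ _ ->] := chiGP i; rewrite subr0.
have /choice[chi chiP] i := cochain1 Gp (chiGc i).
have chi1 i : gproj 1 (chi i) = chi i by have [] := chiP i.
have chiE i g : cval (chi i) [:: g] = chiG i g by have [] := chiP i.
have chid i : ddiff (chi i) = 0.
  apply: (cochain_eq (n := 2)); [exact: (ddiff_deg (chi1 i))|exact: linear0|].
  move=> [|g [|h [|? ?]]]// _; rewrite ddiff1E !chiE chiGM.
  by rewrite -[RHS]/(0 : Fp); zmod.
(* The generator values are those that [entry14_relator] asks of [P] and of [Q]; the same formula
   serves both, so one family [D] can play the two roles. *)
have /choice[D0 D0P] (ij : 'I_d * 'I_d) : exists u : F -> Fp, [/\ loc_const u,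
    forall g h, u (g * h)%g = u g + u h - chiF ij.1 g * chiF ij.2 h &
    forall l, u (tnth y l) = - (chiF ij.1 (nth 1%g y (partner l)) * chiF ij.2 (tnth y l))].
  apply: (free_primitive (z := fun g h => chiF ij.1 g * chiF ij.2 h)) => [g h k|].
    by rewrite !chiFM; ring.
  exact: loc_const_cup.
pose D i j := D0 (i, j).
have Dc i j : loc_const (D i j) by have [] := D0P (i, j).
have DM i j g h : D i j (g * h)%g = D i j g + D i j h - chiF i g * chiF j h.
  by rewrite /D; have [_ -> _] := D0P (i, j).
have Dx i j m : (m < d./2)%N -> D i j (nth 1%g y m.*2) =
    - (chiF i (nth 1%g y m.*2.+1) * chiF j (nth 1%g y m.*2)).
  move=> md; have m2 : (m.*2 < d)%N := ltnW (half_lt md).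
  have [_ _ /(_ (Ordinal m2))] := D0P (i, j).
  by rewrite !y_nth /= partner_double.
have Dy i j m : (m < d./2)%N -> D i j (nth 1%g y m.*2.+1) =
    - (chiF i (nth 1%g y m.*2) * chiF j (nth 1%g y m.*2.+1)).
  move=> md; have [_ _ /(_ (Ordinal (half_lt md)))] := D0P (i, j).
  by rewrite !y_nth /= partner_doubleS.
have D1 i j : D i j 1%g = 0 := entry13_1 (chiFM i) (DM i j).
pose om i j := D i j r.
pose i0 : 'I_d := Ordinal (ltnW d_ge2); pose i1 : 'I_d := Ordinal d_ge2.
have nq := natp pq; have nq2 := natp pq2; have nq3 := natp pq3.
(* Only the first commutator contributes. So [D i1 i0], a primitive of [e] on [F], has trace 1, and
   multiples of it are subtracted below wherever a trace must be removed. *)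
have om10 : D i1 i0 r = 1.
  rewrite (entry13_relator (chiFM i1) (chiFM i0) (DM i1 i0) y nq nq2).
  have chi_nth i k (kd : (k < d)%N) : chiF i (nth 1%g y k) = (i == Ordinal kd)%:R.
    by rewrite -(y_nth (Ordinal kd)) chiFy.
  have d0 : (0 < d./2)%N by rewrite half_gt0.
  rewrite (bigD1 (Ordinal d0))//= big1 ?addr0 => [|m m0].
    by rewrite (chi_nth i1 _ d_ge2) (chi_nth i0 _ (ltnW d_ge2)) (chi_nth i1 _ (ltnW d_ge2))
      !eqxx mulr1 (_ : (i1 == Ordinal _) = false)// mul0r subr0.
  have md := half_lt (ltn_ord m).
  rewrite (chi_nth i1 _ md) (chi_nth i1 _ (ltnW md)).
  have -> : (i1 == Ordinal md) = false.
    by apply/negP => /eqP/(congr1 val)/= -[e]; case/eqP: m0; apply: val_inj => /=; lia.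
  have -> : (i1 == Ordinal (ltnW md)) = false.
    by apply/negP => /eqP/(congr1 val)/= e; move: (odd_double m); rewrite -e.
  by rewrite !mul0r subr0.
have /choice[T0 T0P] (ijk : 'I_d * 'I_d * 'I_d) : exists u : F -> Fp, [/\ loc_const u,
    forall g h, u (g * h)%g = u g + u h
      - (chiF ijk.1.1 g * D ijk.1.2 ijk.2 h + D ijk.1.1 ijk.1.2 g * chiF ijk.2 h) &
    forall l, u (tnth y l) = 0].
  apply: (free_primitive (z := fun g h => chiF ijk.1.1 g * D ijk.1.2 ijk.2 h
    + D ijk.1.1 ijk.1.2 g * chiF ijk.2 h)) => [g h k|].
    by rewrite !chiFM !DM; ring.
  by apply: (loc_const2 +%R); exact: loc_const_cup.
pose T i j k := T0 (i, j, k).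
have Tc i j k : loc_const (T i j k) by have [] := T0P (i, j, k).
have TM i j k g h : T i j k (g * h)%g = T i j k g + T i j k h
    - chiF i g * D j k h - D i j g * chiF k h.
  by rewrite /T; have [_ -> _] := T0P (i, j, k); rewrite opprD addrA.
have T1 i j k : T i j k 1%g = 0 := entry14_1 (chiFM i) (chiFM k) (TM i j k).
have Tr i j k : T i j k r = 0.
  by apply: (entry14_relator (chiFM i) (chiFM j) (chiFM k) (DM i j) (DM j k)
    (TM i j k) nq nq2 nq3) => m md; rewrite ?Dx ?Dy.
pose e : A := chi i1 * chi i0.
have e2 : gproj 2 e = e by exact: (gproj_mul (chi1 i1) (chi1 i0)).
have eE g h : cval e [:: f g; f h] = chiF i1 g * chiF i0 h.
  by rewrite (@cochain_mulE p G 1 1 _ _ [:: f g] [:: f h])// !chiE !chiGf.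
have ed : ddiff e = 0.
  by rewrite /e (ddiff_leibniz _ (chi1 i1)) !chid mul0r mulr0 scaler0 addr0.
have chi_mul i j g h : cval (chi i * chi j) [:: f g; f h] = chiF i g * chiF j h.
  by rewrite (@cochain_mulE p G 1 1 _ _ [:: f g] [:: f h])// !chiE !chiGf.
(* On [F] the cochain [om i j * D i1 i0 - D i j] is a primitive, and it descends because its trace
   [om i j * 1 - om i j] vanishes. *)
have /choice[C0 C0P] (ij : 'I_d * 'I_d) : exists c : A, [/\ gproj 1 c = c,
    forall g, cval c [:: f g] = om ij.1 ij.2 * D i1 i0 g - D ij.1 ij.2 g &
    ddiff c = om ij.1 ij.2 *: e - chi ij.1 * chi ij.2].
  case: ij => i j /=.
  have [|||v [vc vf vM]] := descend_scalar
    (z := fun g h => om i j * (chiG i1 g * chiG i0 h) - chiG i g * chiG j h)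
    (u := fun g => om i j * D i1 i0 g - D i j g).
  - by apply: (loc_const2 (fun a b : Fp => om i j * a - b)).
  - by move=> g h; rewrite !DM !chiGf; ring.
  - by rewrite om10 !D1 mulr1 /om; ring.
  have [c [c1 cE]] := cochain1 Gp vc; exists c; split=> // [g|]; first by rewrite cE vf.
  apply: (cochain_eq (n := 2)); first exact: (ddiff_deg c1).
    apply: gprojD; first exact: gprojZ.
    by apply: gprojN; exact: (gproj_mul (chi1 i) (chi1 j)).
  move=> [|g [|h [|? ?]]]// _; rewrite ddiff1E !cE vM cvalD cvalN cvalZ.
  rewrite (@cochain_mulE p G 1 1 _ _ [:: g] [:: h])//.
  by rewrite (@cochain_mulE p G 1 1 _ _ [:: g] [:: h])// !chiE; ring.
pose C i j := C0 (i, j).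
have C1 i j : gproj 1 (C i j) = C i j by have [] := C0P (i, j).
have CE i j g : cval (C i j) [:: f g] = om i j * D i1 i0 g - D i j g.
  by have [] := C0P (i, j).
have CP i j : ddiff (C i j) = om i j *: e - chi i * chi j by have [] := C0P (i, j).
have e_mulE k g h l : cval (e * chi k) [:: f g; f h; f l]
    = chiF i1 g * chiF i0 h * chiF k l.
  by rewrite (@cochain_mulE p G 2 1 _ _ [:: f g; f h] [:: f l])// eE chiE chiGf.
have mul_eE k g h l : cval (chi k * e) [:: f g; f h; f l]
    = chiF k g * (chiF i1 h * chiF i0 l).
  by rewrite (@cochain_mulE p G 1 2 _ _ [:: f g] [:: f h; f l])// eE chiE chiGf.
(* [b] is a primitive of [- (e * chi k)] on [G]. Its pullback to [F] plus the cup product of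
   [D i1 i0] and [chiF k] is a cocycle, with primitive [lam]. Subtracting a multiple of [e] from [b]
   makes the trace of that primitive 0, as is needed for [TT]; [R] is treated alike. *)
have /choice[L LP] k : exists l : A, [/\ gproj 2 l = l, ddiff l = - (e * chi k) &
    exists lam : F -> Fp, [/\ loc_const lam, lam r = lam 1%g & forall g h,
      lam (g * h)%g = lam g + lam h
        - (cval l [:: f g; f h] + D i1 i0 g * chiF k h)]].
  have [||b b2 bd] := @cochain_vanish 0 (- (e * chi k)).
  - by apply: gprojN; exact: (gproj_mul e2 (chi1 k)).
  - by rewrite ddiffN (ddiff_leibniz _ e2) ed chid mul0r mulr0 scaler0 addr0 oppr0.
  have [||lam [lc lM _]] := @free_primitive
    (fun g h => cval b [:: f g; f h] + D i1 i0 g * chiF k h) (fun=> 0).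
  - move=> g h l; have E : cval (ddiff b) [:: f g; f h; f l]
        = - (chiF i1 g * chiF i0 h * chiF k l) by rewrite bd cvalN e_mulE.
    rewrite ddiff2E in E; rewrite !fM !chiFM !DM; apply/eqP; rewrite -subr_eq0.
    rewrite -[X in _ == X](subrr (- (chiF i1 g * chiF i0 h * chiF k l))) -{1}E.
    by apply/eqP; ring.
  - apply: (loc_const2 +%R); last exact: loc_const_cup.
    apply: (loc_const_pull2 (z := fun g h => cval b [:: g; h])).
    exact: cochain2_loc_const.
  exists (b - (lam r - lam 1%g) *: e); split.
  - by apply: gprojD => //; apply: gprojN; exact: gprojZ.
  - by rewrite ddiffB ddiffZ ed scaler0 subr0.
  exists (fun g => lam g - (lam r - lam 1%g) * D i1 i0 g); split.
  - by apply: (loc_const2 (fun a b : Fp => a - (lam r - lam 1%g) * b)).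
  - by rewrite om10 D1; ring.
  - by move=> g h; rewrite lM DM cvalD cvalN cvalZ eE; ring.
have /choice[R RP] k : exists l : A, [/\ gproj 2 l = l, ddiff l = - (chi k * e) &
    exists lam : F -> Fp, [/\ loc_const lam, lam r = lam 1%g & forall g h,
      lam (g * h)%g = lam g + lam h
        - (cval l [:: f g; f h] - chiF k g * D i1 i0 h)]].
  have [||b b2 bd] := @cochain_vanish 0 (- (chi k * e)).
  - by apply: gprojN; exact: (gproj_mul (chi1 k) e2).
  - by rewrite ddiffN (ddiff_leibniz _ (chi1 k)) ed chid mul0r mulr0 scaler0 addr0 oppr0.
  have [||lam [lc lM _]] := @free_primitive
    (fun g h => cval b [:: f g; f h] - chiF k g * D i1 i0 h) (fun=> 0).
  - move=> g h l; have E : cval (ddiff b) [:: f g; f h; f l]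
        = - (chiF k g * (chiF i1 h * chiF i0 l)) by rewrite bd cvalN mul_eE.
    rewrite ddiff2E in E; rewrite !fM !chiFM !DM; apply/eqP; rewrite -subr_eq0.
    rewrite -[X in _ == X](subrr (- (chiF k g * (chiF i1 h * chiF i0 l)))) -{1}E.
    by apply/eqP; ring.
  - apply: (loc_const2 (fun a b : Fp => a - b)); last exact: loc_const_cup.
    apply: (loc_const_pull2 (z := fun g h => cval b [:: g; h])).
    exact: cochain2_loc_const.
  exists (b - (lam r - lam 1%g) *: e); split.
  - by apply: gprojD => //; apply: gprojN; exact: gprojZ.
  - by rewrite ddiffB ddiffZ ed scaler0 subr0.
  exists (fun g => lam g - (lam r - lam 1%g) * D i1 i0 g); split.
  - by apply: (loc_const2 (fun a b : Fp => a - (lam r - lam 1%g) * b)).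
  - by rewrite om10 D1; ring.
  - by move=> g h; rewrite lM DM cvalD cvalN cvalZ eE; ring.
have L2 k : gproj 2 (L k) = L k by have [] := LP k.
have R2 k : gproj 2 (R k) = R k by have [] := RP k.
have /choice[TT TTP] (ijk : 'I_d * 'I_d * 'I_d) : exists b : A, gproj 1 b = b /\
    ddiff b = chi ijk.1.1 * C ijk.1.2 ijk.2 + C ijk.1.1 ijk.1.2 * chi ijk.2
     + om ijk.1.1 ijk.1.2 *: L ijk.2 - om ijk.1.2 ijk.2 *: R ijk.1.1.
  case: ijk => [[i j] k] /=.
  have [_ _ [lam [lc lr lM]]] := LP k; have [_ _ [rho [rc rr rM]]] := RP i.
  (* On [F], substituting [om i j * D i1 i0 - D i j] for [C i j] regroups the cochain as [om i j]
     times that of [lam], minus [om j k] times that of [rho], minus that of [T i j k]. All three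
     primitives have trace 0. *)
  have [||||b b1 bd] := @coboundary_of_primitive (chi i * C j k + C i j * chi k
     + om i j *: L k - om j k *: R i)
     (fun g => om i j * lam g - om j k * rho g - T i j k g).
  - apply: gprojD; last by apply: gprojN; exact: gprojZ.
    apply: gprojD; last exact: gprojZ.
    apply: gprojD; first exact: (gproj_mul (chi1 i) (C1 j k)).
    exact: (gproj_mul (C1 i j) (chi1 k)).
  - apply: (loc_const2 (fun a b : Fp => a - b)) => //.
    by apply: (loc_const2 (fun a b : Fp => om i j * a - om j k * b)).
  - move=> g h; rewrite !cvalD cvalN !cvalZ.
    rewrite (@cochain_mulE p G 1 1 (chi i) _ [:: f g] [:: f h])//.
    rewrite (@cochain_mulE p G 1 1 (C i j) _ [:: f g] [:: f h])//.
    by rewrite !chiE !CE !chiGf lM rM TM; ring.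
  - by rewrite Tr T1 lr rr.
  by exists b.
apply: inhabits; apply: (@Degree2Model Fp A d chi e om C L R (fun i j k => TT (i, j, k))).
- exact: chi1.
- exact: chid.
- move=> a a1 ad; exists (fun i => cval a [:: f (tnth y i)]).
  apply: (cochain_eq a1) => [|[|x [|? ?]]// _].
    by rewrite gproj_bigsum; apply: eq_bigr => i _; rewrite gproj_scale chi1.
  have [g <-] := presentation_onto f_onto x.
  have sumE (c : 'I_d -> Fp) s : cval (\sum_i c i *: chi i) s = \sum_i c i * cval (chi i) s.
    by elim/big_rec2: _ => // i u v _ <-; rewrite cvalD cvalZ.
  apply/eqP; rewrite -subr_eq0; apply/eqP; move: g.
  apply: free_hom_eq0.
  + apply: (loc_const2 (fun a b : Fp => a - b)).
      exact: (loc_const_comp fc (cochain1_loc_const Gp a1)).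
    apply: (loc_const_comp (f := fun g => cval _ [:: g]) fc).
    apply: cochain1_loc_const => //.
    by rewrite gproj_bigsum; apply: eq_bigr => i _; rewrite gproj_scale chi1.
  + move=> g h; have E : cval (ddiff a) [:: f g; f h] = 0 by rewrite ad.
    rewrite ddiff1E -fM in E; rewrite !sumE fM.
    rewrite (eq_bigr (fun i => cval a [:: f (tnth y i)] * cval (chi i) [:: f g]
      + cval a [:: f (tnth y i)] * cval (chi i) [:: f h])) => [|i _]; last first.
      by rewrite !chiE chiGM mulrDr.
    rewrite big_split /= -fM -[cval a [:: f (g * h)%g]]addr0 -E.
    by zmod.
  + move=> i; rewrite sumE (bigD1 i)//= chiE chiGf chiFy eqxx mulr1 big1 ?addr0 ?subrr// => j ji.
    by rewrite chiE chiGf chiFy (negPf ji) mulr0.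
- move=> c c0 j; have : cval (\sum_i c i *: chi i) [:: f (tnth y j)] = 0 by rewrite c0.
  have -> : cval (\sum_i c i *: chi i) [:: f (tnth y j)]
      = \sum_i c i * cval (chi i) [:: f (tnth y j)].
    by elim/big_rec2: _ => // i u v _ <-; rewrite cvalD cvalZ.
  rewrite (bigD1 j)//= chiE chiGf chiFy eqxx mulr1 big1 ?addr0// => i ij.
  by rewrite chiE chiGf chiFy (negPf ij) mulr0.
- exact: e2.
- exact: ed.
- move=> a a2 ad; have [u [uc uM]] := trace_primitive a2 ad.
  have [||||b b1 bd] := @coboundary_of_primitive (a - (u r - u 1%g) *: e)
    (fun g => u g - (u r - u 1%g) * D i1 i0 g).
  + by apply: gprojD => //; apply: gprojN; exact: gprojZ.
  + by apply: (loc_const2 (fun a b : Fp => a - (u r - u 1%g) * b)).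
  + by move=> g h; rewrite uM DM cvalD cvalN cvalZ eE; ring.
  + by rewrite om10 D1; ring.
  by exists (u r - u 1%g), b; rewrite bd addrC subrK.
(* If [b] were a primitive of [e] on [G], then [D i1 i0] minus its pullback would be a homomorphism
   from [F] to the prime field, hence 0 at [r], whereas its value there is 1. *)
- move=> b0 be; pose b := gproj 1 b0.
  have bd : ddiff b = e by rewrite /b ddiff_gproj be e2.
  have b1 : gproj 1 b = b by exact: gproj_id.
  pose v g := cval b [:: f g].
  have vM g h : v (g * h)%g = v g + v h - chiF i1 g * chiF i0 h.
    by rewrite -eE -bd ddiff1E /v -fM; zmod.
  have v1 : v 1%g = 0 := entry13_1 (chiFM i1) vM.
  have vr : v r = 0.
    by rewrite -v1 /v (group_hom1 fM) (presentation_relator fker).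
  have := @relator_hom_eq0 (fun g => D i1 i0 g - v g).
  rewrite om10 vr subr0 => H; have /eqP := oner_neq0 Fp; apply; apply: H => g h.
  by rewrite DM vM; ring.
- exact: cochain_vanish.
- exact: C1.
- exact: CP.
- exact: L2.
- by move=> k; have [] := LP k.
- exact: R2.
- by move=> k; have [] := RP k.
- by move=> i j k; have [] := TTP (i, j, k).
- by move=> i j k; have [] := TTP (i, j, k).
Qed.

End DemushkinModel.

(** * Multilinear maps in a basis of the cohomology *)

Section MultilinearExtension.
Local Open Scope ring_scope.
Variables (F : fieldType) (H : galg F) (I : finType) (deg : I -> nat).
Variables (b : I -> H) (co : H -> I -> F).
Hypothesis co_linear : forall c x y k, co (c *: x + y) k = c * co x k + co y k.
Hypothesis co_b : forall k l, co (b k) l = (k == l)%:R.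
Hypothesis co_deg : forall n x k, gproj n x = x -> deg k != n -> co x k = 0.
Hypothesis coE : forall x, x = \sum_k co x k *: b k.

Section Extension.
Variables (B : galg F) (n : nat) (c : {ffun 'I_n -> I} -> B).

Definition mlin (t : n.-tuple H) : B :=
  \sum_(s : {ffun 'I_n -> I}) (\prod_i co (tnth t i) (s i)) *: c s.

Lemma mlin_multilinear : multilinear mlin.
Proof.
move=> t i a x y; rewrite /mlin scaler_sumr -big_split; apply: eq_bigr => s _ /=.
rewrite scalerA -scalerDl; congr (_ *: _).
have E z : \prod_j co (tnth [tuple if j == i then z else tnth t j | j < n] j) (s j)
    = co z (s i) * \prod_(j | j != i) co (tnth t j) (s j).
  rewrite (bigD1 i)//= tnth_mktuple eqxx; congr (_ * _).
  by apply: eq_bigr => j /negPf ji; rewrite tnth_mktuple ji.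
by rewrite !E co_linear mulrDl mulrA.
Qed.

Lemma gdeg_sum (m : int) J (r : seq J) (P : pred J) (f : J -> B) :
  (forall j, P j -> gdeg m (f j)) -> gdeg m (\sum_(j <- r | P j) f j).
Proof.
move=> fP; elim/big_rec: _ => [|j x Pj xm]; first exact: gdeg0.
by rewrite -[f j]scale1r; apply: gdeg_linear => //; exact: fP.
Qed.

Lemma gdegZ (m : int) a (x : B) : gdeg m x -> gdeg m (a *: x).
Proof. by move=> xm; rewrite -[a *: x]addr0; apply: gdeg_linear => //; exact: gdeg0. Qed.

(** A basis tuple whose degrees differ from those of the arguments has coefficient 0 by [co_deg], so
    only terms of the right degree survive. *)
Lemma mlin_graded (r : int) :
  (forall s : {ffun 'I_n -> I}, gdeg (\sum_i (deg (s i) : int) + r) (c s)) -> graded_map r mlin.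
Proof.
move=> cr; split; first exact: mlin_multilinear.
move=> e t te; apply: gdeg_sum => s _.
have [/forallP es|/forallPn[i ie]] := boolP [forall i, deg (s i) == tnth e i].
  apply: gdegZ; rewrite (eq_bigr (fun i => (deg (s i) : int))); first exact: cr.
  by move=> i _; rewrite (eqP (es i)).
rewrite [X in X *: _](bigD1 i)//= (co_deg (te i) ie) mul0r scale0r.
exact: gdeg0.
Qed.

Lemma mlin_basis (s : {ffun 'I_n -> I}) t : (forall i, tnth t i = b (s i)) ->
  mlin t = c s.
Proof.
move=> ts; rewrite /mlin (bigD1 s)//= [X in _ + X]big1 ?addr0 => [|s' s's].
  by rewrite big1 ?scale1r// => i _; rewrite ts co_b eqxx.
have /existsP[i si] : [exists i, s' i != s i].
  by apply: contraNT s's => /existsPn e; apply/eqP/ffunP => i; apply/eqP; rewrite -[_ == _]negbK.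
by rewrite (bigD1 i)//= ts co_b eq_sym (negPf si) mul0r scale0r.
Qed.

End Extension.

Definition lin1 (B : galg F) (c : I -> B) : 1.-tuple H -> B :=
  mlin (fun s => c (s ord0)).
Definition lin2 (B : galg F) (c : I -> I -> B) : 2.-tuple H -> B :=
  mlin (fun s => c (s ord0) (s (lift ord0 ord0))).
Definition lin3 (B : galg F) (c : I -> I -> I -> B) : 3.-tuple H -> B :=
  mlin (fun s => c (s ord0) (s (lift ord0 ord0)) (s (lift ord0 (lift ord0 ord0)))).

Lemma lin1_graded (B : galg F) (c : I -> B) (r : int) :
  (forall k, gdeg ((deg k : int) + r) (c k)) -> graded_map r (lin1 c).
Proof. by move=> cr; apply: mlin_graded => s; rewrite big_ord_recl big_ord0 addr0. Qed.

Lemma lin2_graded (B : galg F) (c : I -> I -> B) (r : int) :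
  (forall k l, gdeg ((deg k : int) + (deg l : int) + r) (c k l)) -> graded_map r (lin2 c).
Proof.
by move=> cr; apply: mlin_graded => s; rewrite !big_ord_recl big_ord0 addr0.
Qed.

Lemma lin3_graded (B : galg F) (c : I -> I -> I -> B) (r : int) :
  (forall k l m, gdeg ((deg k : int) + (deg l : int) + (deg m : int) + r) (c k l m)) ->
  graded_map r (lin3 c).
Proof.
move=> cr; apply: mlin_graded => s; rewrite !big_ord_recl big_ord0 addr0.
by rewrite !addrA; exact: cr.
Qed.

Let ffs (J : eqType) n (t : n.-tuple J) : {ffun 'I_n -> J} := [ffun i => tnth t i].

Lemma lin1_basis (B : galg F) (c : I -> B) k : lin1 c [tuple b k] = c k.
Proof.
rewrite /lin1 (@mlin_basis B _ _ (ffs [tuple k])) => [|i]; first by rewrite ffunE.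
by rewrite ffunE !(tnth_nth (b k)) !(tnth_nth k); case: i => -[].
Qed.

Lemma lin2_basis (B : galg F) (c : I -> I -> B) k l : lin2 c [tuple b k; b l] = c k l.
Proof.
rewrite /lin2 (@mlin_basis B _ _ (ffs [tuple k; l])) => [|i]; first by rewrite !ffunE.
by rewrite ffunE !(tnth_nth (b k)) !(tnth_nth k); case: i => -[|[]].
Qed.

Lemma lin3_basis (B : galg F) (c : I -> I -> I -> B) k l m :
  lin3 c [tuple b k; b l; b m] = c k l m.
Proof.
rewrite /lin3 (@mlin_basis B _ _ (ffs [tuple k; l; m])) => [|i]; first by rewrite !ffunE.
by rewrite ffunE !(tnth_nth (b k)) !(tnth_nth k); case: i => -[|[|[]]].
Qed.

Lemma linear_basis_eq (V : lmodType F) (f g : H -> V) : linear f -> linear g ->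
  (forall k, f (b k) = g (b k)) -> forall x, f x = g x.
Proof.
move=> fl gl fg x; rewrite [x]coE.
have Z (h : H -> V) : linear h -> h 0 = 0.
  by move=> hl; have := hl 1 0 0; rewrite !scale1r addr0 => /(congr1 (fun z => z - h 0));
    rewrite subrr addrK.
elim/big_rec: _ => [|k y _ e]; first by rewrite !Z.
by rewrite fl gl fg e.
Qed.

End MultilinearExtension.

Section MultilinearArguments.
Local Open Scope ring_scope.
Variables (F : fieldType) (V W : lmodType F).

Lemma multilinear1 (f : 1.-tuple V -> W) : multilinear f ->
  linear (fun x => f [tuple x]).
Proof.
move=> fl a x y; have := fl [tuple 0] ord0 a x y.
have E z : [tuple if j == ord0 then z else tnth [tuple (0 : V)] j | j < 1] = [tuple z].
  by apply: eq_from_tnth => i; rewrite tnth_mktuple ord1.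
by rewrite !E.
Qed.

Lemma multilinear2l (f : 2.-tuple V -> W) y : multilinear f ->
  linear (fun x => f [tuple x; y]).
Proof.
move=> fl a x x'; have := fl [tuple 0; y] ord0 a x x'.
have E z : [tuple if j == ord0 then z else tnth [tuple (0 : V); y] j | j < 2] = [tuple z; y].
  apply: eq_from_tnth => i; rewrite tnth_mktuple !(tnth_nth 0).
  by case: i => -[|[|]].
by rewrite !E.
Qed.

Lemma multilinear2r (f : 2.-tuple V -> W) x : multilinear f ->
  linear (fun y => f [tuple x; y]).
Proof.
move=> fl a y y'; have := fl [tuple x; 0] ord_max a y y'.
have E z : [tuple if j == ord_max then z else tnth [tuple x; (0 : V)] j | j < 2]
    = [tuple x; z].
  apply: eq_from_tnth => i; rewrite tnth_mktuple !(tnth_nth 0).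
  by case: i => -[|[|]].
by rewrite !E.
Qed.

Lemma multilinear3_1 (f : 3.-tuple V -> W) y z : multilinear f ->
  linear (fun x => f [tuple x; y; z]).
Proof.
move=> fl a x x'; have := fl [tuple 0; y; z] ord0 a x x'.
have E u : [tuple if j == ord0 then u else tnth [tuple (0 : V); y; z] j | j < 3]
    = [tuple u; y; z].
  apply: eq_from_tnth => i; rewrite tnth_mktuple !(tnth_nth 0).
  by case: i => -[|[|[|]]].
by rewrite !E.
Qed.

Lemma multilinear3_2 (f : 3.-tuple V -> W) x z : multilinear f ->
  linear (fun y => f [tuple x; y; z]).
Proof.
move=> fl a y y'; have := fl [tuple x; 0; z] (inord 1) a y y'.
have E u : [tuple if j == inord 1 then u else tnth [tuple x; (0 : V); z] j | j < 3]
    = [tuple x; u; z].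
  apply: eq_from_tnth => i; rewrite tnth_mktuple !(tnth_nth 0) -val_eqE /= inordK//.
  by case: i => -[|[|[|]]].
by rewrite !E.
Qed.

Lemma multilinear3_3 (f : 3.-tuple V -> W) x y : multilinear f ->
  linear (fun z => f [tuple x; y; z]).
Proof.
move=> fl a z z'; have := fl [tuple x; y; 0] ord_max a z z'.
have E u : [tuple if j == ord_max then u else tnth [tuple x; y; (0 : V)] j | j < 3]
    = [tuple x; y; u].
  apply: eq_from_tnth => i; rewrite tnth_mktuple !(tnth_nth 0).
  by case: i => -[|[|[|]]].
by rewrite !E.
Qed.

End MultilinearArguments.

Lemma gproj_idem (F : fieldType) (B : galg F) n (x : B) : gproj n (gproj n x) = gproj n x.
Proof. by rewrite gproj_proj eqxx. Qed.

(** * Cohomology classes through representing cocycles *)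

Section Represents.
Local Open Scope ring_scope.
Variables (F : fieldType) (A : dga F).
Local Notation H := (cohomology_galg A).
Implicit Types (a b : A) (x y h : H).

Lemma representsP c a b x y : represents a x -> represents b y ->
  represents (c *: a + b) (c *: x + y).
Proof.
by move=> [u -> ->] [v -> ->]; exists (c *: u + v) => //; rewrite linearP.
Qed.

Lemma represents_cocycle a x : represents a x -> ddiff a = 0.
Proof. by move=> [[z /= /eqP zP] -> _]. Qed.

Lemma represents_exists a : ddiff a = 0 -> exists x : H, represents a x.
Proof.
by move=> /eqP da; exists (coclass (Cocycle (da : a \in @is_cocycle F A))), (Cocycle da).
Qed.

Lemma represents_inj a x y : represents a x -> represents a y -> x = y.
Proof. by move=> [u -> ->] [v uv ->]; congr coclass; apply: val_inj. Qed.

Lemma represents_ddiff a : represents (ddiff a) (0 : H).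
Proof.
have da : ddiff a \in @is_cocycle F A by apply/eqP; exact: ddiffK.
exists (Cocycle da) => //; rewrite -[LHS](linear0 (@coclass F A)).
apply/esym/coclass_eq; rewrite subr0; apply/asboolP; by exists a.
Qed.

Lemma represents0 : represents (0 : A) (0 : H).
Proof. by rewrite -(ddiff0 A); exact: represents_ddiff. Qed.

Lemma representsD a b x y : represents a x -> represents b y ->
  represents (a + b) (x + y).
Proof. by move=> ax by_; have := representsP 1 ax by_; rewrite !scale1r. Qed.

Lemma representsZ c a x : represents a x -> represents (c *: a) (c *: x).
Proof. by move=> ax; have := representsP c ax represents0; rewrite !addr0. Qed.

Lemma representsN a x : represents a x -> represents (- a) (- x).
Proof. by move=> ax; have := representsZ (-1) ax; rewrite !scaleN1r. Qed.

Lemma representsB a b x y : represents a x -> represents b y ->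
  represents (a - b) (x - y).
Proof. by move=> ax /representsN; exact: representsD. Qed.

Lemma represents_sum (J : finType) (a : J -> A) (x : J -> H) :
  (forall j, represents (a j) (x j)) -> represents (\sum_j a j) (\sum_j x j).
Proof.
move=> ax; elim/big_rec2: _ => [|j u v _ uv]; first exact: represents0.
exact: representsD.
Qed.

Lemma represents_mul a b x y : represents a x -> represents b y ->
  represents (a * b) (x * y).
Proof.
move=> [u -> ->] [v -> ->]; exists (u * v) => //.
exact: coclass_mul.
Qed.

Lemma represents1 : represents (1 : A) (1 : H).
Proof. by exists 1. Qed.

Lemma represents_eq0 a : represents a (0 : H) -> exists b, ddiff b = a.
Proof.
move=> [z ->]; rewrite -[X in X = _ -> _](linear0 (@coclass F A)) => /esym/coclass_eq.
by rewrite subr0 => /asboolP.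
Qed.

Lemma represents_gproj n a x : represents a x -> represents (gproj n a) (gproj n x).
Proof. by move=> [z -> ->]; exists (cocycle_proj n z) => //; exact: coclass_proj. Qed.

Lemma represents_lift x : exists a, represents a x.
Proof. by exists (lrepr x : cocycle A); exists (lrepr x); last exact/esym/lreprK. Qed.

Lemma represents_lift_deg n x : gproj n x = x ->
  exists2 a, gproj n a = a & represents a x.
Proof.
move=> xn; have [a ax] := represents_lift x; exists (gproj n a); first exact: gproj_id.
by rewrite -xn; exact: represents_gproj.
Qed.

Lemma gproj0_ddiff a : gproj 0 (ddiff a) = 0.
Proof.
have [N ->] := gproj_sum a; rewrite ddiff_sum gproj_bigsum big1// => i _.
by rewrite ddiff_gproj gproj_proj.
Qed.

Lemma ddiff_deg0 a : ddiff (gproj 0 a) = 0.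
Proof. by have [c ->] := gproj_conn a; rewrite ddiffZ ddiff1 scaler0. Qed.

Lemma coboundary_deg n a : (exists b, ddiff b = a) -> gproj n.+1 a = a ->
  exists2 b, gproj n b = b & ddiff b = a.
Proof.
move=> [b <-] an; exists (gproj n b); first exact: gproj_id.
by rewrite ddiff_gproj.
Qed.

Lemma gdegM (m n : int) (B : galg F) (a b : B) :
  gdeg m a -> gdeg n b -> gdeg (m + n) (a * b).
Proof.
case: m n => [m|m] [n|n] /=; last by move=> -> ->; rewrite mul0r.
- exact: gproj_mul.
- by move=> _ ->; rewrite mulr0; exact: gdeg0.
- by move=> -> _; rewrite mul0r; exact: gdeg0.
Qed.

Lemma gdegD (m : int) (B : galg F) (a b : B) : gdeg m a -> gdeg m b -> gdeg m (a + b).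
Proof. by move=> am bm; rewrite -[a]scale1r; exact: gdeg_linear. Qed.

Lemma gdegN (m : int) (B : galg F) (a : B) : gdeg m a -> gdeg m (- a).
Proof. by move=> am; rewrite -scaleN1r; exact: gdegZ. Qed.

End Represents.

Section ModelBasis.
Local Open Scope ring_scope.
Variables (F : fieldType) (A : dga F) (d : nat) (M : degree2_model A d).
Local Notation H := (cohomology_galg A).

(** [None] stands for the unit, [Some None] for the class of [e] and [Some (Some i)] for that of
    [chi_i]. *)
Definition model_index : finType := option (option 'I_d).
Local Notation I := model_index.

Definition model_deg (k : I) : nat :=
  match k with None => 0 | Some None => 2 | Some (Some _) => 1 end.

Definition model_rep (k : I) : A :=
  match k with None => 1 | Some None => dm_e M | Some (Some i) => dm_chi M i end.

Lemma model_rep_deg k : gproj (model_deg k) (model_rep k) = model_rep k.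
Proof.
by case: k => [[i|]|] /=; [exact: dm_chi_deg|exact: dm_e_deg|exact: gproj_one].
Qed.

Lemma model_rep_cocycle k : ddiff (model_rep k) = 0.
Proof.
by case: k => [[i|]|] /=; [exact: dm_chi_cocycle|exact: dm_e_cocycle|exact: ddiff1].
Qed.

Definition model_b (k : I) : H := projT1 (cid (represents_exists (model_rep_cocycle k))).

Lemma model_bP k : represents (model_rep k) (model_b k).
Proof. by rewrite /model_b; case: cid. Qed.

Lemma model_b_deg k : gproj (model_deg k) (model_b k) = model_b k.
Proof.
apply: (represents_inj _ (model_bP k)).
by rewrite -{1}model_rep_deg; apply: represents_gproj; exact: model_bP.
Qed.

Lemma model_b1 : model_b None = 1.
Proof. exact: (represents_inj (model_bP None) (represents1 A)). Qed.

Lemma sum_model_index (V : nmodType) (f : I -> V) :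
  \sum_k f k = f None + (f (Some None) + \sum_i f (Some (Some i))).
Proof.
have E (J : finType) (g : option J -> V) : \sum_k g k = g None + \sum_j g (Some j).
  rewrite (bigD1 None)//=; congr (_ + _).
  rewrite (reindex_omap Some id) => [|[j|]]//=.
  by apply: eq_bigl => j; rewrite eqxx.
by rewrite !E.
Qed.

Lemma model_span (x : H) : exists c : I -> F, x = \sum_k c k *: model_b k.
Proof.
have [N ->] := gproj_sum x.
have H1 n : exists c : I -> F, gproj n x = \sum_k c k *: model_b k.
  have [a an ax] := represents_lift_deg (gproj_idem n x).
  have da := represents_cocycle ax.
  case: n an ax => [|[|[|n]]] an ax.
  - have [c cE] := gproj_conn x; exists (fun k => if k is None then c else 0).
    rewrite sum_model_index cE model_b1 scale0r add0r big1 ?addr0// => i _.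
    by rewrite scale0r.
  - have [c aE] := dm_chi_span M an da.
    exists (fun k => if k is Some (Some i) then c i else 0).
    rewrite sum_model_index !scale0r !add0r; apply: (represents_inj ax).
    by rewrite aE; apply: represents_sum => i; apply/representsZ/(model_bP (Some (Some i))).
  - have [t [b aE]] := dm_e_span M an da.
    exists (fun k => if k is Some None then t else 0).
    rewrite sum_model_index scale0r add0r [X in _ + X]big1 ?addr0 => [|i _]; last first.
      by rewrite scale0r.
    apply: (represents_inj ax); rewrite aE -[_ *: model_b _]addr0.
    apply: representsD; last exact: represents_ddiff.
    exact/representsZ/(model_bP (Some None)).
  - have [b _ bE] := dm_vanish M an da; exists (fun=> 0).
    rewrite big1 => [|i _]; last by rewrite scale0r.
    by apply: (represents_inj ax); rewrite -bE; exact: represents_ddiff.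
elim: N => [|N [c cE]].
  by exists (fun=> 0); rewrite big_ord0 big1// => i _; rewrite scale0r.
have [c' c'E] := H1 N; exists (fun k => c k + c' k).
rewrite big_ord_recr cE c'E.
under [RHS]eq_bigr do rewrite scalerDl.
by rewrite big_split.
Qed.

(** A relation among classes makes a combination of representatives a coboundary, which is then
    examined degree by degree. Degrees 0 and 1 contain no nonzero coboundary, as there is nothing in
    negative degree and scalars are cocycles; in degree 2, [dm_e_neq0] concludes. *)
Lemma model_free (c : I -> F) : \sum_k c k *: model_b k = 0 -> forall k, c k = 0.
Proof.
move=> c0.
have : represents (\sum_k c k *: model_rep k) (0 : H).
  by rewrite -c0; apply: represents_sum => k; apply/representsZ/model_bP.
move=> /represents_eq0[a]; rewrite sum_model_index /= => ad.
have chi_proj n : gproj n (\sum_i c (Some (Some i)) *: dm_chi M i) =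
    if n == 1%N then \sum_i c (Some (Some i)) *: dm_chi M i else 0.
  rewrite gproj_bigsum; case: ifP => n1.
    by apply: eq_bigr => i _; rewrite gproj_scale (eqP n1) dm_chi_deg.
  by apply: big1 => i _; rewrite gproj_scale -dm_chi_deg gproj_proj n1 scaler0.
have e_proj n : gproj n (dm_e M) = if n == 2 then dm_e M else 0.
  by rewrite -{1}dm_e_deg gproj_proj dm_e_deg.
have one_proj n : gproj n (1 : A) = if n == 0%N then 1 else 0.
  by rewrite -{1}(gproj_one A) gproj_proj gproj_one.
have c1 : c None = 0.
  have := congr1 (gproj 0) ad; rewrite gproj0_ddiff !gproj_add !gproj_scale.
  rewrite chi_proj e_proj one_proj /= scaler0 !addr0 => /esym/eqP.
  by rewrite scaler_eq0 oner_eq0 orbF => /eqP.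
have c2 : c (Some None) = 0.
  have := congr1 (gproj 2) ad; rewrite -ddiff_gproj !gproj_add !gproj_scale.
  rewrite chi_proj e_proj one_proj /= scaler0 add0r addr0 => e.
  apply/eqP/negPn/negP => c2; apply: (@dm_e_neq0 _ _ _ M ((c (Some None))^-1 *: gproj 1 a)).
  by rewrite ddiffZ e scalerA mulVf// scale1r.
have c3 i : c (Some (Some i)) = 0.
  apply: (@dm_chi_free _ _ _ M (fun i => c (Some (Some i)))).
  have := congr1 (gproj 1) ad; rewrite -ddiff_gproj ddiff_deg0 !gproj_add !gproj_scale.
  by rewrite chi_proj e_proj one_proj /= !scaler0 !add0r => <-.
by case=> [[i|]|].
Qed.

Definition model_co (x : H) : I -> F := projT1 (cid (model_span x)).

Lemma model_coE x : x = \sum_k model_co x k *: model_b k.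
Proof. by rewrite /model_co; case: cid. Qed.

Lemma model_co_unique x (c : I -> F) : x = \sum_k c k *: model_b k ->
  forall k, model_co x k = c k.
Proof.
move=> xE k; apply/eqP; rewrite -subr_eq0; apply/eqP; move: k; apply: model_free.
under eq_bigr do rewrite scalerBl.
by rewrite sumrB -xE -model_coE subrr.
Qed.

Lemma model_co_linear c x y k :
  model_co (c *: x + y) k = c * model_co x k + model_co y k.
Proof.
apply: (model_co_unique (c := fun k => c * model_co x k + model_co y k)).
rewrite {1}[x]model_coE {1}[y]model_coE scaler_sumr -big_split; apply: eq_bigr => l _.
by rewrite scalerDl scalerA.
Qed.

Lemma model_co_b k l : model_co (model_b k) l = (k == l)%:R.
Proof.
apply: (model_co_unique (c := fun l => (k == l)%:R)).
rewrite (bigD1 k)//= eqxx scale1r big1 ?addr0// => j jk.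
by rewrite eq_sym (negPf jk) scale0r.
Qed.

Lemma model_co_deg n x k : gproj n x = x -> model_deg k != n -> model_co x k = 0.
Proof.
move=> xn kn.
rewrite (model_co_unique (c := fun k => if model_deg k == n then model_co x k else 0)).
  by rewrite (negPf kn).
rewrite -{1}xn {1}[x]model_coE gproj_bigsum; apply: eq_bigr => l _.
rewrite gproj_scale -{1}model_b_deg gproj_proj model_b_deg eq_sym.
by case: eqP; rewrite ?scaler0 ?scale0r.
Qed.

End ModelBasis.

(** * Formality *)

Section LinearCombinators.
Local Open Scope ring_scope.
Variable F : fieldType.

Lemma linear_fun_add (U V : lmodType F) (f g : U -> V) :
  linear f -> linear g -> linear (fun x => f x + g x).
Proof. by move=> fl gl a x y; rewrite fl gl scalerDr addrACA. Qed.

Lemma linear_fun_opp (U V : lmodType F) (f : U -> V) :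
  linear f -> linear (fun x => - f x).
Proof. by move=> fl a x y; rewrite fl opprD scalerN. Qed.

Lemma linear_fun_sub (U V : lmodType F) (f g : U -> V) :
  linear f -> linear g -> linear (fun x => f x - g x).
Proof. by move=> fl gl; apply: linear_fun_add => //; exact: linear_fun_opp. Qed.

Lemma linear_fun_mulr (U : lmodType F) (B : algType F) (f : U -> B) b :
  linear f -> linear (fun x => f x * b).
Proof. by move=> fl a x y; rewrite fl mulrDl scalerAl. Qed.

Lemma linear_fun_mull (U : lmodType F) (B : algType F) (f : U -> B) b :
  linear f -> linear (fun x => b * f x).
Proof. by move=> fl a x y; rewrite fl mulrDr scalerAr. Qed.

Lemma linear_fun_comp (U V W : lmodType F) (f : V -> W) (g : U -> V) :
  linear f -> linear g -> linear (fun x => f (g x)).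
Proof. by move=> fl gl a x y; rewrite gl fl. Qed.

Lemma mul_linearl (B : algType F) (u : B) : linear (fun x : B => x * u).
Proof. exact: (@linear_fun_mulr B B id u (fun _ _ _ => erefl)). Qed.

Lemma mul_linearr (B : algType F) (u : B) : linear (fun x : B => u * x).
Proof. exact: (@linear_fun_mull B B id u (fun _ _ _ => erefl)). Qed.

Lemma linear_zero (V W : lmodType F) (f : V -> W) : linear f -> f 0 = 0.
Proof.
move=> fl; have := fl 1 0 0; rewrite !scale1r addr0 => e.
by apply: (addrI (f 0)); rewrite addr0.
Qed.

Lemma linear_scale (V W : lmodType F) (f : V -> W) c x : linear f -> f (c *: x) = c *: f x.
Proof. by move=> fl; have := fl c x 0; rewrite (linear_zero fl) !addr0. Qed.

End LinearCombinators.

Section ModelFormality.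
Local Open Scope ring_scope.
Variables (F : fieldType) (A : dga F) (d : nat) (M : degree2_model A d).
Local Notation H := (cohomology_galg A).
Local Notation I := (model_index d).
Local Notation b := (model_b M).
Local Notation co := (model_co M).
Local Notation rep := (model_rep M).
Local Notation deg := (@model_deg d).

Lemma gdeg_eq (B : galg F) (m n : int) (a : B) : m = n -> gdeg m a -> gdeg n a.
Proof. by move=> ->. Qed.

Lemma model_ext (V : lmodType F) (f g : H -> V) : linear f -> linear g ->
  (forall k, f (b k) = g (b k)) -> forall x, f x = g x.
Proof. by apply: (linear_basis_eq (co := co)) => x; exact: model_coE. Qed.

Definition model_f1 : 1.-tuple H -> A := lin1 co rep.

Lemma model_f1_graded : graded_map 0 model_f1.
Proof.
apply: (lin1_graded (deg := deg)); [exact: model_co_linear|exact: model_co_deg|].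
by move=> k; rewrite addr0; exact: model_rep_deg.
Qed.

Definition f1 (x : H) : A := model_f1 [tuple x].

Lemma f1_linear : linear f1.
Proof. exact: (multilinear1 model_f1_graded.1). Qed.

Lemma f1_b k : f1 (b k) = rep k.
Proof. by apply: lin1_basis => *; exact: model_co_b. Qed.

Lemma f1_represents x : represents (f1 x) x.
Proof.
have f1E : f1 x = \sum_k co x k *: rep k.
  apply: (model_ext (g := fun x => \sum_k co x k *: rep k) f1_linear) => [a u v|k].
    rewrite scaler_sumr -big_split; apply: eq_bigr => k _.
    by rewrite model_co_linear scalerDl scalerA.
  rewrite f1_b (bigD1 k)//= model_co_b eqxx scale1r big1 ?addr0// => l lk.
  by rewrite model_co_b eq_sym (negPf lk) scale0r.
rewrite {2}[x](model_coE M) f1E; apply: represents_sum => k.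
exact/representsZ/model_bP.
Qed.

Definition model_prod (k l : I) : H :=
  match k, l with
  | None, _ => b l
  | _, None => b k
  | Some (Some i), Some (Some j) => dm_om M i j *: b (Some None)
  | _, _ => 0
  end.

Lemma model_mulb k l : b k * b l = model_prod k l.
Proof.
have R := represents_mul (model_bP M k) (model_bP M l).
have Z (a : A) : represents (ddiff a) (0 : H) := represents_ddiff a.
case: k l R => [[i|]|] [[j|]|] /= R; rewrite ?(model_b1 M) ?mul1r ?mulr1//;
  apply: (represents_inj R).
- have -> : dm_chi M i * dm_chi M j = dm_om M i j *: dm_e M - ddiff (dm_C M i j).
    by rewrite dm_CP; zmod.
  rewrite -[X in represents _ X]subr0; apply: representsB; last exact: Z.
  exact/representsZ/(model_bP M (Some None)).
- rewrite -[X in represents X _]opprK -dm_RP -[X in represents _ X]oppr0.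
  exact/representsN/Z.
- rewrite -[X in represents X _]opprK -dm_LP -[X in represents _ X]oppr0.
  exact/representsN/Z.
- have [||s _ <-] := @dm_vanish _ _ _ M 1 (dm_e M * dm_e M).
  + exact: (gproj_mul (dm_e_deg M) (dm_e_deg M)).
  + by rewrite (ddiff_leibniz _ (dm_e_deg M)) dm_e_cocycle mul0r mulr0 scaler0 addr0.
  exact: Z.
Qed.

Lemma model_square_primitive :
  exists2 s : A, gproj 3 s = s & ddiff s = - (dm_e M * dm_e M).
Proof.
apply: (@dm_vanish _ _ _ M 1).
  by rewrite -scaleN1r gproj_scale; congr (_ *: _); exact: (gproj_mul (dm_e_deg M) (dm_e_deg M)).
rewrite ddiffN (ddiff_leibniz _ (dm_e_deg M)) dm_e_cocycle.
by rewrite mul0r mulr0 scaler0 addr0 oppr0.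
Qed.

(** The values of [f2] on basis classes. They vanish as soon as one argument is the unit, which [f1]
    sends to 1. The square of the class of [e] is 0 for reasons of degree, but [f2] must still
    provide a primitive on cochains. *)
Definition model_c2 (k l : I) : A :=
  match k, l with
  | Some (Some i), Some (Some j) => dm_C M i j
  | Some None, Some (Some i) => dm_L M i
  | Some (Some i), Some None => dm_R M i
  | Some None, Some None => projT1 (cid2 model_square_primitive)
  | _, _ => 0
  end.

Lemma model_c2_deg k l : gdeg ((deg k : int) + (deg l : int) - 1) (model_c2 k l).
Proof.
case: k l => [[i|]|] [[j|]|]; try exact: gdeg0.
- exact: dm_C_deg.
- exact: dm_R_deg.
- exact: dm_L_deg.
- by rewrite /model_c2; case: cid2.
Qed.

Definition model_f2 : 2.-tuple H -> A := lin2 co model_c2.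

Lemma model_f2_graded : graded_map (-1) model_f2.
Proof.
apply: (lin2_graded (deg := deg)); [exact: model_co_linear|exact: model_co_deg|].
exact: model_c2_deg.
Qed.

Definition f2 (x y : H) : A := model_f2 [tuple x; y].

Lemma f2_linearl y : linear (f2^~ y).
Proof. exact: (multilinear2l _ model_f2_graded.1). Qed.

Lemma f2_linearr x : linear (f2 x).
Proof. exact: (multilinear2r _ model_f2_graded.1). Qed.

Lemma f2_b k l : f2 (b k) (b l) = model_c2 k l.
Proof. by apply: lin2_basis => *; exact: model_co_b. Qed.

Lemma ddiff_linear_comp (U : lmodType F) (f : U -> A) : linear f -> linear (fun x => ddiff (f x)).
Proof. by move=> fl a x y; rewrite fl ddiffD ddiffZ. Qed.

Lemma f2P x y : ddiff (f2 x y) = f1 (x * y) - f1 x * f1 y.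
Proof.
move: x; apply: model_ext.
- exact/ddiff_linear_comp/f2_linearl.
- apply: linear_fun_sub; first exact: (linear_fun_comp f1_linear (@mul_linearl F H y)).
  exact/linear_fun_mulr/f1_linear.
move=> k; move: y; apply: model_ext.
- exact/ddiff_linear_comp/f2_linearr.
- apply: linear_fun_sub; first exact: (linear_fun_comp f1_linear (@mul_linearr F H (b k))).
  exact/linear_fun_mull/f1_linear.
move=> l; rewrite f2_b model_mulb !f1_b.
have f1Z c x : f1 (c *: x) = c *: f1 x := linear_scale c x f1_linear.
have f10 : f1 0 = 0 := linear_zero f1_linear.
case: k l => [[i|]|] [[j|]|]; rewrite /model_c2 /model_prod ?f1Z ?f10 ?f1_b /=;
  rewrite ?mul1r ?mulr1 ?subrr ?ddiff0 ?sub0r//.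
- exact: dm_CP.
- exact: dm_RP.
- exact: dm_LP.
- by case: cid2.
Qed.

End ModelFormality.

Section DgaSigns.
Local Open Scope ring_scope.
Variables (F : fieldType) (A : dga F).

Lemma ddiff_mul_cocycle (a b : A) : ddiff b = 0 -> ddiff (a * b) = ddiff a * b.
Proof.
move=> db; have [N ->] := gproj_sum a.
rewrite mulr_suml !ddiff_sum mulr_suml; apply: eq_bigr => i _.
by rewrite (ddiff_leibniz _ (gproj_id i a)) db mulr0 scaler0 addr0.
Qed.

Lemma ddiff_cocycle_mul n (a b : A) : gproj n a = a -> ddiff a = 0 ->
  ddiff (a * b) = (-1) ^+ n *: (a * ddiff b).
Proof. by move=> an da; rewrite (ddiff_leibniz _ an) da mul0r add0r. Qed.

(** The Leibniz rule in degree [n - 1], with an integer degree so that [n = 0] is allowed: there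
    [a = 0]. *)
Lemma ddiff_mul_shift (n : nat) (a b : A) : gdeg ((n : int) - 1) a ->
  ddiff (a * b) = ddiff a * b - (-1) ^+ n *: (a * ddiff b).
Proof.
case: n => [|n] an.
  have a0 : a = 0 by [].
  by rewrite a0 !mul0r ddiff0 mul0r scaler0 subr0.
have an' : gdeg n a by apply: (gdeg_eq (m := (n.+1 : int) - 1) _ an); lia.
by rewrite (ddiff_leibniz _ an') exprS mulN1r scaleNr opprK.
Qed.

Lemma sign_cases n : ((-1) ^+ n = 1 :> F) \/ ((-1) ^+ n = -1 :> F).
Proof. by rewrite -signr_odd; case: odd; [right|left]. Qed.

End DgaSigns.

Section ModelFormality3.
Local Open Scope ring_scope.
Variables (F : fieldType) (A : dga F) (d : nat) (M : degree2_model A d).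
Local Notation H := (cohomology_galg A).
Local Notation I := (model_index d).
Local Notation b := (model_b M).
Local Notation co := (model_co M).
Local Notation rep := (model_rep M).
Local Notation deg := (@model_deg d).
Local Notation f1 := (f1 M).
Local Notation f2 := (f2 M).
Local Notation c2 := (model_c2 M).

Lemma f2_1l y : f2 1 y = 0.
Proof.
rewrite -(model_b1 M); move: y.
apply: (@model_ext _ _ _ M A _ (fun=> 0)); first exact: f2_linearr.
  by move=> a u v; rewrite scaler0 addr0.
by move=> k; rewrite f2_b.
Qed.

Lemma f2_1r x : f2 x 1 = 0.
Proof.
rewrite -(model_b1 M); move: x.
apply: (@model_ext _ _ _ M A _ (fun=> 0)); first exact: f2_linearl.
  by move=> a u v; rewrite scaler0 addr0.
by move=> k; rewrite f2_b; case: k => [[i|]|].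
Qed.

Lemma f2_deg m n x y : gproj m x = x -> gproj n y = y ->
  gdeg ((m : int) + (n : int) - 1) (f2 x y).
Proof.
move=> xm yn; have [_ /(_ [tuple m; n] [tuple x; y])] := model_f2_graded M.
rewrite !big_ord_recl big_ord0 addr0; apply.
by case=> -[|[|]].
Qed.

(** The coboundary that [f3] must have on three basis classes. *)
Definition phi3 (k l m : I) : A :=
  f2 (b k * b l) (b m) - f2 (b k) (b l * b m)
  - (-1) ^+ deg k *: (rep k * c2 l m) + c2 k l * rep m.

Lemma phi3_cocycle k l m : ddiff (phi3 k l m) = 0.
Proof.
rewrite /phi3 ddiffD !ddiffB !f2P ddiffZ.
rewrite (ddiff_cocycle_mul _ (model_rep_deg M k) (model_rep_cocycle M k)).
rewrite (ddiff_mul_cocycle _ (model_rep_cocycle M m)) -!f2_b !f2P !f1_b.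
rewrite scalerA -exprMn mulrNN mulr1 expr1n scale1r mulrBr mulrBl !mulrA.
by zmod.
Qed.

Lemma phi3_deg k l m :
  gdeg ((deg k : int) + (deg l : int) + (deg m : int) - 1) (phi3 k l m).
Proof.
have D1 := model_b_deg M; have D2 := model_rep_deg M.
apply: gdegD; first apply: gdegD; first apply: gdegD.
- apply: (gdeg_eq _ (f2_deg (gproj_mul (D1 k) (D1 l)) (D1 m))); lia.
- apply/gdegN/(gdeg_eq _ (f2_deg (D1 k) (gproj_mul (D1 l) (D1 m)))); lia.
- apply/gdegN/gdegZ; apply: (gdeg_eq _ (gdegM (m := deg k) (D2 k) (model_c2_deg M l m))); lia.
- apply: (gdeg_eq _ (gdegM (n := deg m) (model_c2_deg M k l) (D2 m))); lia.
Qed.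

(** In total degree at least 4, [phi3] is a cocycle of degree at least 3, where cohomology vanishes.
    Below that, either an entry is the unit and [phi3] is 0, or all three entries have degree 1 and
    [dm_T] answers. *)
Lemma model_c3_exists k l m : exists t : A,
  gdeg ((deg k : int) + (deg l : int) + (deg m : int) - 2) t /\ ddiff t = phi3 k l m.
Proof.
have [klm|klm] := leqP 4 (deg k + deg l + deg m).
  have [n nE] : exists n, (deg k + deg l + deg m)%N = n.+4.
    by exists (deg k + deg l + deg m - 4)%N; lia.
  have [|t tn td] := dm_vanish M (n := n) _ (phi3_cocycle k l m).
    by apply: (gdeg_eq (n := n.+3) _ (phi3_deg k l m)); lia.
  by exists t; split=> //; apply: (gdeg_eq (m := n.+2) _ tn); lia.
have Z u v : u = v -> phi3 k l m = u - v -> exists t : A,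
    gdeg ((deg k : int) + (deg l : int) + (deg m : int) - 2) t /\ ddiff t = phi3 k l m.
  by move=> -> e; exists 0; rewrite ddiff0 e subrr; split=> //; exact: gdeg0.
have [e|kN] := eqVneq k None.
  apply: (Z 0 0) => //; rewrite /phi3 e (model_b1 M) mul1r f2_1l f2_b /=.
  by rewrite scale1r mul1r mul0r; zmod.
have [e|lN] := eqVneq l None.
  apply: (Z 0 0) => //; rewrite /phi3 e (model_b1 M) mulr1 mul1r.
  have -> : c2 None m = 0 by [].
  have -> : c2 k None = 0 by case: (k) => [[]|].
  by rewrite mulr0 scaler0 mul0r; zmod.
have [e|mN] := eqVneq m None.
  apply: (Z 0 0) => //; rewrite /phi3 e (model_b1 M) mulr1 f2_1r f2_b.
  have -> : c2 l None = 0 by case: (l) => [[]|].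
  by rewrite mulr0 scaler0 mulr1; zmod.
case: k l m klm kN lN mN {Z} => [[i|]|]// [[j|]|]// [[k|]|]// _ _ _ _.
exists (dm_T M i j k); split; first exact: dm_T_deg.
rewrite dm_TP /phi3 !model_mulb /= !(linear_scale _ _ (f2_linearl M _)).
by rewrite (linear_scale _ _ (f2_linearr M _)) !f2_b /= expr1 scaleN1r; zmod.
Qed.

Definition model_c3 (k l m : I) : A := projT1 (cid (model_c3_exists k l m)).

Definition model_f3 : 3.-tuple H -> A := lin3 co model_c3.

Lemma model_f3_graded : graded_map (-2) model_f3.
Proof.
apply: (lin3_graded (deg := deg)); [exact: model_co_linear|exact: model_co_deg|].
by move=> k l m; rewrite /model_c3; case: cid => t [].
Qed.

Definition f3 (x y z : H) : A := model_f3 [tuple x; y; z].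

Lemma f3_b k l m : f3 (b k) (b l) (b m) = model_c3 k l m.
Proof. by apply: lin3_basis => *; exact: model_co_b. Qed.

(** The sign of the degree of [x], extended to a linear map: identities that involve it are then
    linear in [x] and can be checked on the basis. *)
Definition sign_twist (x : H) : H := \sum_k ((-1) ^+ deg k * co x k) *: b k.

Lemma sign_twist_linear : linear sign_twist.
Proof.
move=> c x y; rewrite /sign_twist scaler_sumr -big_split; apply: eq_bigr => k _ /=.
by rewrite model_co_linear scalerA -scalerDl; congr (_ *: _); ring.
Qed.

Lemma sign_twistE n x : gproj n x = x -> sign_twist x = (-1) ^+ n *: x.
Proof.
move=> xn; rewrite [X in _ *: X](model_coE M) scaler_sumr; apply: eq_bigr => k _.
rewrite scalerA; have [->//|kn] := eqVneq (deg k) n.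
by rewrite (model_co_deg M xn kn) !mulr0.
Qed.

Lemma f3P x y z : ddiff (f3 x y z) =
  f2 (x * y) z - f2 x (y * z) - f1 (sign_twist x) * f2 y z + f2 x y * f1 z.
Proof.
have ml := @mul_linearl F H; have mr := @mul_linearr F H.
have f2l := f2_linearl M; have f2r := f2_linearr M; have f1l := f1_linear M.
have F3 := (model_f3_graded).1.
have comp (g h : H -> H) (k : H -> A) : linear k -> linear h -> linear (fun x => k (h x)).
  exact: linear_fun_comp.
move: x; apply: (@model_ext _ _ _ M).
- exact/ddiff_linear_comp/(multilinear3_1 _ _ F3).
- apply: linear_fun_add; last exact/linear_fun_mulr/f2l.
  apply: linear_fun_sub; first apply: linear_fun_sub.
  + exact: (linear_fun_comp (f2l z) (ml y)).
  + exact: f2l.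
  + apply: linear_fun_mulr; exact: (linear_fun_comp f1l sign_twist_linear).
move=> k; move: y; apply: (@model_ext _ _ _ M).
- exact/ddiff_linear_comp/(multilinear3_2 _ _ F3).
- apply: linear_fun_add; last exact/linear_fun_mulr/f2r.
  apply: linear_fun_sub; first apply: linear_fun_sub.
  + exact: (linear_fun_comp (f2l z) (mr (b k))).
  + exact: (linear_fun_comp (f2r (b k)) (ml z)).
  + exact/linear_fun_mull/f2l.
move=> l; move: z; apply: (@model_ext _ _ _ M).
- exact/ddiff_linear_comp/(multilinear3_3 _ _ F3).
- apply: linear_fun_add; last exact/linear_fun_mull/f1l.
  apply: linear_fun_sub; first apply: linear_fun_sub.
  + exact: f2r.
  + exact: (linear_fun_comp (f2r (b k)) (mr (b l))).
  + exact/linear_fun_mull/f2r.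
move=> m; rewrite f3_b /model_c3; case: cid => t [_ /= ->].
rewrite /phi3 -!f2_b (sign_twistE (model_b_deg M k)) (linear_scale _ _ f1l) !f1_b.
by rewrite scalerAl.
Qed.

Lemma model_A3_formal : A3_formal A.
Proof.
exists (model_f1 M), (model_f2 M), model_f3; split.
- by split; [exact: model_f1_graded|exact: model_f2_graded|exact: model_f3_graded].
- by exists id; [exists id|move=> x; exact: f1_represents].
- by move=> x y _ _; exact: f2P.
move=> i x y z xi _ _; have := f3P x y z.
rewrite (sign_twistE xi) (linear_scale _ _ (f1_linear M)) -scalerAl => e.
by rewrite -[ddiff _]/(ddiff (f3 x y z)) e; zmod.
Qed.

End ModelFormality3.

(** * Independence of the choices *)

Section HochschildTwo.
Local Open Scope ring_scope.
Variables (F : fieldType) (H : galg F).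

Lemma tuple3_eta (a : 3.-tuple H) : exists x y z, a = [tuple x; y; z].
Proof.
case/tupleP: a => x a; case/tupleP: a => y a; case/tupleP: a => z a.
by exists x, y, z; apply: val_inj; rewrite /= (tuple0 a).
Qed.

Lemma hochschild_diff2 (g : 2.-tuple H -> H) e x y z :
  hochschild_diff (-1) g e [tuple x; y; z] =
  (-1) ^+ e *: (x * g [tuple y; z]) - g [tuple x * y; z] + g [tuple x; y * z]
  - g [tuple x; y] * z.
Proof.
rewrite /hochschild_diff !big_ord_recl big_ord0 addr0 mulN1r /=.
have -> : (-1 : F) ^ (- (e : int)) = (-1) ^+ e.
  by rewrite -exprnN -exprVn invrN invr1.
have -> : (-1) ^+ 1 = -1 :> F by rewrite expr1.
have -> : (-1) ^+ 2 = 1 :> F by rewrite sqrrN expr1n.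
have -> : (-1) ^+ 3 = -1 :> F by rewrite exprS sqrrN expr1n mulr1.
rewrite !scale1r !scaleN1r addrA; congr (_ *: (_ * _) - g _ + g _ - g _ * _).
- by congr g; apply: eq_from_tnth => i; rewrite tnth_mktuple !(tnth_nth 0); case: i => -[|[]].
- by apply: eq_from_tnth => i; rewrite tnth_mktuple !(tnth_nth 0); case: i => -[|[]].
- by apply: eq_from_tnth => i; rewrite tnth_mktuple !(tnth_nth 0); case: i => -[|[]].
- by apply: eq_from_tnth => i; rewrite tnth_mktuple !(tnth_nth 0); case: i => -[|[]].
Qed.

End HochschildTwo.

Section Independence.
Local Open Scope ring_scope.
Variables (F : fieldType) (A : dga F) (d : nat) (M : degree2_model A d).
Local Notation H := (cohomology_galg A).
Local Notation I := (model_index d).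
Local Notation b := (model_b M).
Local Notation co := (model_co M).
Local Notation deg := (@model_deg d).
Local Notation f1 := (f1 M).
Local Notation f2 := (f2 M).
Local Notation f3 := (f3 M).
Local Notation sign_twist := (sign_twist M).

Lemma represents_gdeg (m : int) (a : A) (x : H) : represents a x -> gdeg m a -> gdeg m x.
Proof.
case: m => m ax /= am; last by apply: (represents_inj ax); rewrite am; exact: represents0.
by apply: (represents_inj _ ax); rewrite -{1}am; exact: represents_gproj.
Qed.

Lemma represents_ext (f : H -> A) (g : H -> H) : linear f -> linear g ->
  (forall k, represents (f (b k)) (g (b k))) -> forall x, represents (f x) (g x).
Proof.
move=> fl gl fg x; rewrite [x](model_coE M).
elim/big_rec: _ => [|k y _ e]; first by rewrite !linear_zero//; exact: represents0.
by rewrite fl gl; exact: representsP.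
Qed.

Section Comparison.
Variables (g1 : 1.-tuple H -> A) (g2 : 2.-tuple H -> A) (m3 : 3.-tuple H -> H).
Hypothesis g1_graded : graded_map 0 g1.
Hypothesis g2_graded : graded_map (-1) g2.
Hypothesis g1_represents : forall x, represents (g1 [tuple x]) x.
Hypothesis g2_homogeneous : forall x y : H, homogeneous x -> homogeneous y ->
  ddiff (g2 [tuple x; y]) = g1 [tuple x * y] - g1 [tuple x] * g1 [tuple y].
Hypothesis m3_linear : multilinear m3.
Hypothesis m3_represents : forall (i : nat) (x y z : H),
  gdeg i x -> homogeneous y -> homogeneous z ->
  represents ((-1) ^+ i *: (g1 [tuple x] * g2 [tuple y; z]) - g2 [tuple x; y] * g1 [tuple z]
    - g2 [tuple x * y; z] + g2 [tuple x; y * z]) (m3 [tuple x; y; z]).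

Let G1 x := g1 [tuple x].
Let G2 x y := g2 [tuple x; y].

Let G1l : linear G1. Proof. exact: (multilinear1 g1_graded.1). Qed.
Let G2l y : linear (G2^~ y). Proof. exact: (multilinear2l _ g2_graded.1). Qed.
Let G2r x : linear (G2 x). Proof. exact: (multilinear2r _ g2_graded.1). Qed.

Let b_homogeneous k : homogeneous (b k).
Proof. by exists (deg k); exact: model_b_deg. Qed.

Let G1_deg k : gproj (deg k) (G1 (b k)) = G1 (b k).
Proof.
have [_ /(_ [tuple deg k] [tuple b k])] := g1_graded.
rewrite big_ord_recl big_ord0 !addr0; apply.
by case=> -[]//= ?; exact: model_b_deg.
Qed.

Let G2_deg k l : gdeg ((deg k : int) + (deg l : int) - 1) (G2 (b k) (b l)).
Proof.
have [_ /(_ [tuple deg k; deg l] [tuple b k; b l])] := g2_graded.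
rewrite !big_ord_recl big_ord0 addr0; apply.
by case=> -[|[]]//= ?; exact: model_b_deg.
Qed.

Let G2P x y : ddiff (G2 x y) = G1 (x * y) - G1 x * G1 y.
Proof.
have ml := @mul_linearl F H; have mr := @mul_linearr F H.
move: x; apply: (@model_ext _ _ _ M); first exact/ddiff_linear_comp/G2l.
  by apply: linear_fun_sub; [exact: (linear_fun_comp G1l (ml y))|exact: linear_fun_mulr].
move=> k; move: y; apply: (@model_ext _ _ _ M); first exact/ddiff_linear_comp/G2r.
  by apply: linear_fun_sub; [exact: (linear_fun_comp G1l (mr _))|exact: linear_fun_mull].
by move=> l; exact: g2_homogeneous.
Qed.

(** [G1] and [f1] represent the same classes, so on the basis they differ by coboundaries. In degree
    0 they coincide, and [h = 0] has the required degree -1. *)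
Let homotopy_exists k : exists h : A,
  gdeg ((deg k : int) - 1) h /\ ddiff h = G1 (b k) - f1 (b k).
Proof.
have D : gdeg (deg k) (G1 (b k) - f1 (b k)).
  by apply/gdegD/gdegN; [exact: G1_deg|rewrite f1_b; exact: model_rep_deg].
have [a ad] : exists a, ddiff a = G1 (b k) - f1 (b k).
  apply: represents_eq0; rewrite -[X in represents _ X](subrr (b k)).
  by apply: representsB; [exact: g1_represents|exact: f1_represents].
move: D; case: (deg k) => [|n] D.
  exists 0; split; first exact: gdeg0.
  by rewrite -D -ad gproj0_ddiff ddiff0.
have [|h hn hd] := coboundary_deg _ D; first by exists a.
by exists h; split=> //; apply: (gdeg_eq (m := n) _ hn); lia.
Qed.

Let h_b k : A := projT1 (cid (homotopy_exists k)).
Let hh (x : H) : A := lin1 co h_b [tuple x].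

Let hhb k : hh (b k) = h_b k.
Proof. by apply: lin1_basis => *; exact: model_co_b. Qed.

Let hhl : linear hh.
Proof. by apply/multilinear1/mlin_multilinear; exact: model_co_linear. Qed.

Let hh_deg k : gdeg ((deg k : int) - 1) (hh (b k)).
Proof. by rewrite hhb /h_b; case: cid => h []. Qed.

Let hhP x : ddiff (hh x) = G1 x - f1 x.
Proof.
move: x; apply: (@model_ext _ _ _ M); first exact/ddiff_linear_comp/hhl.
  by apply: linear_fun_sub => //; exact: f1_linear.
by move=> k; rewrite hhb /h_b; case: cid => h [].
Qed.

(** [G2] and [f2] are primitives of the failures of [G1] and [f1] to be multiplicative. The terms in
    [hh] carry one failure to the other, so [psi] is a cocycle on basis classes; its class [g] is
    the Hochschild cochain whose coboundary will be [m3]. *)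
Let psi x y := G2 x y - f2 x y - hh (x * y) + hh x * G1 y + f1 (sign_twist x) * hh y.

Let psil y : linear (psi^~ y).
Proof.
apply: linear_fun_add; last first.
  exact/linear_fun_mulr/(linear_fun_comp (f1_linear M) (sign_twist_linear M)).
apply: linear_fun_add; last exact: linear_fun_mulr.
apply: linear_fun_sub; last exact: (linear_fun_comp hhl (@mul_linearl F H y)).
by apply: linear_fun_sub => //; exact: f2_linearl.
Qed.

Let psir x : linear (psi x).
Proof.
apply: linear_fun_add; last exact: linear_fun_mull.
apply: linear_fun_add; last exact: linear_fun_mull.
apply: linear_fun_sub; last exact: (linear_fun_comp hhl (@mul_linearr F H x)).
by apply: linear_fun_sub => //; exact: f2_linearr.
Qed.

Let f1_sign_twist k : f1 (sign_twist (b k)) = (-1) ^+ deg k *: f1 (b k).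
Proof. by rewrite (sign_twistE M (model_b_deg M k)) (linear_scale _ _ (f1_linear M)). Qed.

Let f1_deg k : gproj (deg k) (f1 (b k)) = f1 (b k).
Proof. by rewrite f1_b; exact: model_rep_deg. Qed.

Let psi_cocycle k l : ddiff (psi (b k) (b l)) = 0.
Proof.
rewrite /psi !ddiffD !ddiffN f2P G2P hhP f1_sign_twist -scalerAl ddiffZ.
rewrite (ddiff_mul_cocycle _ (represents_cocycle (g1_represents (b l)))).
rewrite (ddiff_cocycle_mul _ (f1_deg k) (represents_cocycle (f1_represents M (b k)))).
rewrite scalerA -exprMn mulrNN mulr1 expr1n scale1r !hhP mulrBl mulrBr -/(G1 _).
by zmod.
Qed.

Let psi_deg k l : gdeg ((deg k : int) + (deg l : int) - 1) (psi (b k) (b l)).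
Proof.
have hh_mul n x : gproj n x = x -> gdeg ((n : int) - 1) (hh x).
  move=> xn; rewrite [x](model_coE M).
  have -> : hh (\sum_j co x j *: b j) = \sum_j co x j *: hh (b j).
    elim/big_rec2: _ => [|j u v _ uv]; first exact: linear_zero.
    by rewrite hhl uv.
  apply: gdeg_sum => j _; have [jn|jn] := eqVneq (deg j) n.
    by rewrite -jn; apply: gdegZ.
  by rewrite (model_co_deg M xn jn) scale0r; exact: gdeg0.
have Bk := model_b_deg M k; have Bl := model_b_deg M l.
rewrite /psi f1_sign_twist.
apply: gdegD; first apply: gdegD; first apply: gdegD; first apply: gdegD.
- exact: G2_deg.
- exact/gdegN/f2_deg.
- by apply: gdegN; apply: (gdeg_eq _ (hh_mul _ _ (gproj_mul Bk Bl))); lia.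
- apply: (gdeg_eq _ (gdegM (n := deg l) (hh_deg k) (G1_deg l))); lia.
- rewrite -scalerAl; apply: gdegZ.
  apply: (gdeg_eq _ (gdegM (m := deg k) (f1_deg k) (hh_deg l))); lia.
Qed.

Let g_b k l : H := projT1 (cid (represents_exists (psi_cocycle k l))).

Let g_bP k l : represents (psi (b k) (b l)) (g_b k l).
Proof. by rewrite /g_b; case: cid. Qed.

Let g : 2.-tuple H -> H := lin2 co g_b.

Let g_graded : graded_map (-1) g.
Proof.
apply: (lin2_graded (deg := deg)); [exact: model_co_linear|exact: model_co_deg|].
by move=> k l; exact: (represents_gdeg (g_bP k l) (psi_deg k l)).
Qed.

Let gl y : linear (fun x => g [tuple x; y]).
Proof. exact: (multilinear2l _ g_graded.1). Qed.
Let gr x : linear (fun y => g [tuple x; y]).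
Proof. exact: (multilinear2r _ g_graded.1). Qed.

Let gP x y : represents (psi x y) (g [tuple x; y]).
Proof.
move: x; apply: represents_ext => // k; move: y; apply: represents_ext => // l.
rewrite (_ : g _ = g_b k l); first exact: g_bP.
by apply: lin2_basis => *; exact: model_co_b.
Qed.

(** The cocycle defining [m3] is, up to a coboundary, the Hochschild expression in [psi], with
    multipliers [f1] on the left and [G1] on the right. The analogous cocycle for [f1] and [f2] is
    absorbed by [f3]; the other terms under [ddiff] come from the homotopy [hh]. *)
Let comparison k l m :
  let x := b k in let y := b l in let z := b m in
  (-1) ^+ deg k *: (G1 x * G2 y z) - G2 x y * G1 z - G2 (x * y) z + G2 x (y * z) =
  (-1) ^+ deg k *: (f1 x * psi y z) - psi x y * G1 z - psi (x * y) z + psi x (y * z)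
  - ddiff (f3 x y z - (-1) ^+ (deg k + deg l) *: (f2 x y * hh z)
           - (-1) ^+ deg k *: (hh x * G2 y z)).
Proof.
move=> x y z; rewrite !ddiffB !ddiffZ f3P.
rewrite (ddiff_mul_shift _ (hh_deg k)).
have D : gdeg (((deg k + deg l)%N : int) - 1) (f2 x y).
  by apply: (gdeg_eq _ (f2_deg M (model_b_deg M k) (model_b_deg M l))); lia.
rewrite (ddiff_mul_shift _ D) f2P !hhP G2P /psi.
rewrite (sign_twistE M (gproj_mul (model_b_deg M k) (model_b_deg M l))) !f1_sign_twist.
rewrite (linear_scale _ _ (f1_linear M)) exprD -/x -/y !mulrA.
(* All signs depend on the parities of the degrees of [x] and [y]; once these are fixed, an identity
   in an abelian group is left. *)
have [->|->] := sign_cases F (deg k); have [->|->] := sign_cases F (deg l);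
  rewrite ?mulrNN ?mulr1 ?mul1r ?scale1r ?scaleN1r;
  rewrite !(mulrDl, mulrDr, mulNr, mulrN, opprD, opprK) !mulrA; zmod.
Qed.

(** With [sign_twist] in place of the sign, both sides are linear in each argument, so basis classes
    suffice. There [comparison] gives both sides the same representing cocycle up to a
    coboundary. *)
Lemma comparison_hcoboundary : exists g : 2.-tuple H -> H,
  graded_map (-1) g /\ is_hochschild_diff (-1) g m3.
Proof.
exists g; split=> // e a; have [x [y [z ->]]] := tuple3_eta a.
rewrite hochschild_diff2 theadE => xe.
rewrite scalerAl -(sign_twistE M xe); move: x {xe}.
have ml := @mul_linearl F H; have mr := @mul_linearr F H.
apply: (@model_ext _ _ _ M); first exact: (multilinear3_1 _ _ m3_linear).
  apply: linear_fun_sub; last exact: linear_fun_mulr.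
  apply: linear_fun_add; last exact: gl.
  apply: linear_fun_sub; last exact: (linear_fun_comp (gl z) (ml y)).
  exact/linear_fun_mulr/sign_twist_linear.
move=> k; move: y; apply: (@model_ext _ _ _ M); first exact: (multilinear3_2 _ _ m3_linear).
  apply: linear_fun_sub; last exact/linear_fun_mulr/gr.
  apply: linear_fun_add; last exact: (linear_fun_comp (gr (b k)) (ml z)).
  apply: linear_fun_sub; last exact: (linear_fun_comp (gl z) (mr (b k))).
  exact/linear_fun_mull/gl.
move=> l; move: z; apply: (@model_ext _ _ _ M); first exact: (multilinear3_3 _ _ m3_linear).
  apply: linear_fun_sub; last exact: mr.
  apply: linear_fun_add; last exact: (linear_fun_comp (gr (b k)) (mr (b l))).
  apply: linear_fun_sub; last exact: gr.
  exact/linear_fun_mull/gr.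
move=> m; rewrite (sign_twistE M (model_b_deg M k)) -scalerAl.
apply: (represents_inj (m3_represents (model_b_deg M k) (b_homogeneous l) (b_homogeneous m))).
rewrite -!/(G1 _) -!/(G2 _ _) comparison -[X in represents _ X]subr0.
apply: representsB; last exact: represents_ddiff.
rewrite (_ : _ - _ = (-1) ^+ deg k *: (b k * g [tuple b l; b m]) -
  g [tuple b k; b l] * b m - g [tuple b k * b l; b m] + g [tuple b k; b l * b m]); last by zmod.
apply: representsD; last exact: gP.
apply: representsB; last exact: gP.
apply: representsB; first apply: representsZ; apply: represents_mul => //;
  by [exact: f1_represents|exact: g1_represents|exact: gP].
Qed.

End Comparison.

(** For an arbitrary choice of maps, [m3] is a Hochschild coboundary by comparison with the model.
    Conversely the maps of the model admit [m3 = 0], since their cocycle is the coboundary of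
    [- f3]. *)
Lemma model_canonical_class (gamma : HH H 3 (-1)) : is_canonical_class gamma <-> gamma = 0.
Proof.
split=> [[g1 [g2 [m3 [[g1g g2g] g1r g2P m3P ->]]]]|->].
  rewrite -[RHS](linear0 (@lpi F _ (@is_hcoboundary F H 3 (-1)))).
  apply/lpi_eq; rewrite subr0; apply/asboolP.
  have /asboolP[[m3l _] _] := valP m3.
  exact: (comparison_hcoboundary g1g g2g g1r g2P m3l m3P).
exists (model_f1 M), (model_f2 M), 0; split.
- by split; [exact: model_f1_graded|exact: model_f2_graded].
- exact: f1_represents.
- by move=> x y _ _; exact: f2P.
- move=> i x y z xi _ _; rewrite -[X in represents _ X]oppr0.
  rewrite (_ : _ + _ = - ddiff (f3 x y z)); first exact/representsN/represents_ddiff.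
  rewrite f3P (sign_twistE M xi) (linear_scale _ _ (f1_linear M)) -scalerAl.
  by rewrite -!/(f2 _ _) -!/(f1 _); zmod.
- by rewrite -[LHS](linear0 (@lpi F _ (@is_hcoboundary F H 3 (-1)))).
Qed.

End Independence.

Theorem theorem6p6 (p d q : nat)
    (hp : prime p) (hpodd : odd p)
    (hd : (2 <= d)%N) (hdeven : ~~ odd d)
    (hq : (exists f : nat, [/\ (1 <= f)%N, p = 3 -> (2 <= f)%N & q = (p ^ f)%N])
          \/ q = 0)
    (G : topGroupType) (x : d.-tuple G)
    (hG : one_relator_pro_p p (@demushkin_word q d) x) :
  (forall gamma : HH (cohomology_galg (cochain_dga G 'F_p)) 3 (-1),
     is_canonical_class gamma <-> gamma = 0%R) /\
  A3_formal (cochain_dga G 'F_p).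

Proof.
have [Gp [F [y [f [yF [fM fc] f_onto _ fker]]]]] := hG.
have [pq pq2 pq3] := prime_power_bin hp hpodd hq.
have [M] := demushkin_model hp Gp yF fM fc f_onto fker hd hdeven pq pq2 pq3.
split; [exact: (model_canonical_class M)|exact: (model_A3_formal M)].
Qed.
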